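(* The topological realization of the projective Fraïssé limit of the family $\mathcal{T}_{\mathcal{M}3}$ is homeomorphic to the Ważewski dendrite $D_3$.
   Context: A graph is a pair $A=(V(A),E(A))$ with $E(A)\subseteq V(A)^2$ reflexive and symmetric. An epimorphism is a map on vertices sending edges to edges that is surjective on vertices and on edges. A topological graph is a graph whose vertex set is compact, zero-dimensional, second-countable and whose edge set is closed; epimorphisms between them are continuous. A subset $S\subseteq V(G)$ is disconnected if $S=P\cup Q$ with $P,Q$ nonempty disjoint closed and no edge between $P$ and $Q$; otherwise connected. An epimorphism is monotone if preimages of closed connected sets are connected. A tree is a finite graph in which any two distinct vertices are joined by a unique path of pairwise distinct vertices; the order of a vertex is the number of non-degenerate edges containing it. $\mathcal{T}_{\mathcal{M}3}$ is the class of trees with at least two vertices, all of order $\le 3$, with all monotone epimorphisms; it is a projective Fraïssé family (countably many isomorphism types, closure under composition and identities, joint projection and amalgamation properties). The projective Fraïssé limit of such a family $\mathcal F$ is the unique topological graph $\mathbb F$ which is an inverse limit $\varprojlim\{F_n,\alpha_n\}$ of members of $\mathcal F$ with bonding maps in the family (edges coordinatewise) such that (i) every $A\in\mathcal F$ is the image of $\mathbb F$ under some admissible epimorphism, and (ii) for admissible $f\colon \mathbb F\to A$ and $g\colon B\to A$ in the family there is admissible $h\colon\mathbb F\to B$ with $f=g\circ h$; here an epimorphism $\mathbb F\to A$ is admissible iff it is of the form $h'\circ\alpha^\infty_m$ with $h'\colon F_m\to A$ in the family and $\alpha_m^\infty$ the projection. The edge relation of this limit is transitive, and its topological realization is the quotient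 space $V(\mathbb F)/E(\mathbb F)$. The Ważewski dendrite $D_3$ is the (unique up to homeomorphism) dendrite in which every ramification point has order $3$ and the set of ramification points is dense. *)

(* Defs.v *)
From HB Require Import structures.
From mathcomp Require Import all_boot all_order all_algebra.
From mathcomp Require Import all_classical all_reals topology normedtype.
Set Implicit Arguments. Unset Strict Implicit. Unset Printing Implicit Defensive.
Import Order.TTheory GRing.Theory Num.Theory.
Import numFieldNormedType.Exports.

Record fgr := MkFgr {
  fvert : finType;
  fedge : rel fvert;
  fedge_refl : reflexive fedge;
  fedge_sym : symmetric fedge }.
Arguments fedge : clear implicits.

Definition gpath (G : fgr) (u v : fvert G) (s : seq (fvert G)) : bool :=
  [&& path.path (fedge G) u s, last u s == v & uniq (u :: s)].

Definition is_tree (G : fgr) : Prop :=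
  forall u v : fvert G, u != v -> exists! s : seq (fvert G), gpath u v s.

Definition vorder (G : fgr) (v : fvert G) : nat :=
  #|[set w : fvert G | (w != v) && fedge G v w]|.

Definition inTM3 (G : fgr) : Prop :=
  [/\ is_tree G, 2 <= #|fvert G| & forall v : fvert G, vorder v <= 3].

Definition gepi (A B : fgr) (f : fvert A -> fvert B) : Prop :=
  [/\ forall x y, fedge A x y -> fedge B (f x) (f y),
      forall b : fvert B, exists a : fvert A, f a = b &
      forall b1 b2 : fvert B, fedge B b1 b2 ->
        exists a1 a2 : fvert A, [/\ fedge A a1 a2, f a1 = b1 & f a2 = b2]].

(* connected subsets (every subset of a finite graph is closed) *)
Definition gconnected (G : fgr) (S : {set fvert G}) : Prop :=
  ~ exists P Q : {set fvert G},
      [/\ P != finset.set0, Q != finset.set0, [disjoint P & Q], P :|: Q = S &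
          forall p q, p \in P -> q \in Q -> ~~ fedge G p q].

Definition monotone_epi (A B : fgr) (f : fvert A -> fvert B) : Prop :=
  gepi f /\ forall S : {set fvert B}, gconnected S -> gconnected (f @^-1: S).

Definition TM3_mor (A B : fgr) (f : fvert A -> fvert B) : Prop :=
  [/\ inTM3 A, inTM3 B & monotone_epi f].

Section Limit.
Variables (F : nat -> fgr) (alpha : forall n, fvert (F n.+1) -> fvert (F n)).

Definition limV : Type :=
  {x : forall n, fvert (F n) | forall n, alpha (x n.+1) = x n}.

Definition limproj (m : nat) (x : limV) : fvert (F m) := proj1_sig x m.

Definition limE (x y : limV) : Prop :=
  forall n, fedge (F n) (limproj n x) (limproj n y).

(* the inverse-limit topology (subspace of the product of discrete spaces) *)
Definition limopen (U : set limV) : Prop :=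
  forall x, U x -> exists n, forall y, limproj n y = limproj n x -> U y.

Definition admissible (A : fgr) (f : limV -> fvert A) : Prop :=
  exists m (h : fvert (F m) -> fvert A), TM3_mor h /\ forall x, f x = h (limproj m x).

Definition is_TM3_Fraisse_limit : Prop :=
  [/\ forall n, TM3_mor (@alpha n),
      (forall A : fgr, inTM3 A -> exists f : limV -> fvert A, admissible f) &
      (forall (A B : fgr) (f : limV -> fvert A) (g : fvert B -> fvert A),
         admissible f -> TM3_mor g ->
         exists h : limV -> fvert B, admissible h /\ forall x, f x = g (h x))].

(* X is (homeomorphic to) the topological realization V(F)/E(F): there is a
   quotient map q : V(F) -> X whose fibres are exactly the E(F)-classes. *)
Definition realization_homeomorphic (X : topologicalType) : Prop :=
  exists q : limV -> X,
    [/\ forall z : X, exists x, q x = z,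
        forall x y, q x = q y <-> limE x y &
        forall U : set X, open U <-> limopen (q @^-1` U)].
End Limit.

Local Open Scope classical_set_scope.
Local Open Scope ring_scope.

Definition unit_circle (R : realType) : set (R * R)%type :=
  [set p | p.1 ^+ 2 + p.2 ^+ 2 = 1].

Definition locally_connected (T : topologicalType) : Prop :=
  forall (x : T) (U : set T), nbhs x U ->
    exists V : set T, [/\ open V, connected V, V x & V `<=` U].

(* X contains a simple closed curve (a subset homeomorphic to the circle;
   since the circle is compact and X Hausdorff, this is the same as a
   continuous injective image of the circle) *)
Definition has_simple_closed_curve (R : realType) (T : topologicalType) : Prop :=
  exists g : (R * R)%type -> T,
    {within @unit_circle R, continuous g} /\ {in @unit_circle R &, injective g}.

Definition dendrite (R : realType) (X : pseudoMetricType R) : Prop :=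
  [/\ hausdorff_space X, compact [set: X], connected [set: X],
      [set: X] !=set0 &
      locally_connected X /\ ~ @has_simple_closed_curve R X].

Definition order_ge (T : topologicalType) (p : T) (k : nat) : Prop :=
  exists xs : seq T, [/\ size xs = k, all (fun x => x != p) xs &
    forall i j, (i < k)%N -> (j < k)%N -> i != j ->
      connected_component (~` [set p]) (nth p xs i) !=
      connected_component (~` [set p]) (nth p xs j)].

Definition ramification_point (T : topologicalType) (p : T) : Prop :=
  order_ge p 3.

Definition Wazewski_D3 (R : realType) (X : pseudoMetricType R) : Prop :=
  [/\ dendrite X,
      (forall p : X, ramification_point p -> ~ order_ge p 4) &
      dense [set p : X | ramification_point p]].

(* Main.v *)
(** A decomposition of the dendrite [X] over a tree [A] of the family cuts [X] at
    finitely many points of order 2 into closed connected pieces indexed by the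
    vertices of [A], two pieces meeting, in a single cut point, exactly when the
    vertices are adjacent.  Two facts drive the proof.  Any given point of order 2
    becomes a cut point after passing to a larger tree of the family; and along
    every monotone epimorphism [B -> A] a decomposition over [A] lifts to one over
    [B], because the epimorphism splits vertices one at a time and ramification
    points are dense.  Alternating these with the projective extension property
    yields nested decompositions over cofinally many [F n] that eventually
    separate any two points of [X]; sending a thread to the unique point of its
    nested pieces is the required quotient map.

    Points of order 2 are plentiful: as [X] contains no simple closed curve, every
    inner point of an arc separates its ends, and the third sides at distinct
    ramification points of an arc are disjoint, so only countably many points of
    the arc are ramified. *)
From HB Require Import structures.
Require Import Defs.
From mathcomp Require Import all_boot boolp.
Set Implicit Arguments. Unset Strict Implicit. Unset Printing Implicit Defensive.

(** * Finite trees *)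

(** The bound 3 on orders is the obstacle on the finite side. Splitting a vertex adds an edge at
    both halves, so each half may inherit at most two neighbours; contracting an edge between
    vertices of orders r and s leaves order at most r + s - 2, so the contraction stays in the
    family when one end has order at most 2. Every nontrivial fibre of a morphism contains such an
    edge, and this is why morphisms decompose into single splits within the family. Lifting a split
    prescribes which old cut points go to which part; when one part is to receive none and the other
    two, a branch between these two has to be cut off, and density of the ramification points
    provides one in every piece. Because of the same bound, a point with three old cut points on one
    side cannot be cut out at once. Trees are used through bridges, which pass along collapses of an
    edge more easily than paths do. *)

Lemma gconnectedP (G : fgr) (S : {set fvert G}) :
  gconnected S <-> forall (P : {set fvert G}) x, x \in S -> x \in P ->
    (forall y z, y \in S -> y \in P -> z \in S -> fedge G y z -> z \in P) ->
    S \subset P.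
Proof.
split=> [cS P x xS xP clP|h [P [Q [P0 Q0 dPQ PQS nPQ]]]].
  apply/negPn/negP => /subsetPn[z zS zP]; apply: cS.
  exists (S :&: P), (S :\: P); split.
  - by apply/set0Pn; exists x; rewrite !inE xS.
  - by apply/set0Pn; exists z; rewrite !inE zS zP.
  - by rewrite -setI_eq0; apply/eqP/setP => y; rewrite !inE; do 2 case: (_ \in _).
  - by apply/setP => y; rewrite !inE; do 2 case: (_ \in _).
  move=> p q /[!inE] /andP[pS pP] /andP[qP qS]; apply/negP => /(clP p q pS pP qS).
  by rewrite (negPf qP).
have /set0Pn[p pP] := P0; have /set0Pn[q qQ] := Q0.
have pS : p \in S by rewrite -PQS inE pP.
have qS : q \in S by rewrite -PQS inE qQ orbT.
have nQP y : y \in Q -> y \in P -> False.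
  by move=> yQ yP; move: dPQ; rewrite -setI_eq0 => /eqP/setP/(_ y); rewrite !inE yP yQ.
have sSP : S \subset P.
  apply: (h P p) => // y z yS yP; rewrite -PQS inE => /orP[//|zQ] yz.
  by have := nPQ _ _ yP zQ; rewrite yz.
exact: (nQP q qQ (subsetP sSP q qS)).
Qed.

(** [P] stands for one side of the graph after deletion of the edge from [u] to [v]; describing it
    as a set with a single outgoing edge avoids deleting anything. *)
Definition bridge (G : fgr) (u v : fvert G) (P : {set fvert G}) : Prop :=
  [/\ u \in P, v \notin P &
    forall x y, x \in P -> y \notin P -> fedge G x y -> x = u /\ y = v].

Definition bridged (G : fgr) : Prop :=
  forall u v : fvert G, u != v -> fedge G u v -> exists P, bridge u v P.

Lemma bridgeC (G : fgr) (u v : fvert G) P : bridge u v P -> bridge v u (~: P).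
Proof.
case=> uP vP h; split; rewrite ?inE ?uP// => x y.
by rewrite !inE negbK => xP yP; rewrite fedge_sym => /(h _ _ yP xP)[-> ->].
Qed.

Lemma tree_connected (G : fgr) : is_tree G -> gconnected [set: fvert G].
Proof.
move=> tG; apply/gconnectedP => P x _ xP clP; apply/subsetP => z _.
have [<-//|xz] := eqVneq x z.
have [s [/and3P[+ /eqP + _] _]] := tG x z xz.
elim: s x xP {xz} => [x xP _ <-//|a s IH x xP /=] /andP[xa pa] la.
by apply: (IH a) => //; apply: clP xa; rewrite ?inE.
Qed.

(** Take for [P] what [u] still reaches once the edge is deleted: were [v] among it, a shortened
    path avoiding the edge would be a second simple path besides the edge itself. *)
Lemma tree_bridged (G : fgr) : is_tree G -> bridged G.
Proof.
move=> tG u v uv euv.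
pose e := [rel x y | fedge G x y && ~~ ([&& x == u & y == v] || [&& x == v & y == u])].
exists [set z | connect e u z].
have vP : ~~ connect e u v.
  apply/connectP => -[s0 ps0 ls0].
  move: ls0; case/shortenP: ps0 => s ps us _ ls.
  have [s' [_ us']] := tG u v uv.
  have e1 : s' = s.
    apply: us'; rewrite /gpath us -ls eqxx !andbT; apply: sub_path ps => a b.
    by case/andP.
  have e2 : s' = [:: v].
    by apply: us'; rewrite /gpath /= euv eqxx inE uv.
  by move: ps; rewrite -e1 e2 /= !eqxx andbF.
split; rewrite ?inE ?connect0// => x y; rewrite !inE => ux uy xy.
have [/andP[/eqP-> /eqP->]//|nxy] := boolP ((x == u) && (y == v)).
have nxv : x != v by apply: contraNneq vP => <-.
exfalso; move/negP: uy; apply; apply: connect_trans ux (connect1 _).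
by rewrite /= xy (negPf nxv) (negPf nxy).
Qed.

(** Where two simple paths first part, at [u], one crosses the bridge to [a] and can come back only
    through [u], and the other can leave the side of [u] only through [u]; so they cannot end at the
    same vertex. *)
Lemma bridged_tree (G : fgr) :
  gconnected [set: fvert G] -> bridged G -> is_tree G.
Proof.
move=> cG bG u v uv.
have cuv : connect (fedge G) u v.
  have /gconnectedP/(_ [set z | connect (fedge G) u z] u) := cG.
  move=> /(_ _ _ _)/subsetP/(_ v); rewrite !inE; apply => // y z _.
  by rewrite !inE => uy _ yz; apply: connect_trans uy (connect1 yz).
have [s1 p1 e1] := connectP cuv.
move: e1; case/shortenP: p1 => s ps us _ ls.
exists s; split; first by rewrite /gpath ps us ls eqxx.
move=> t /and3P[pt /eqP lt ut].
move: ps us ls pt lt ut {cuv s1 uv}.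
elim: s u t => [|a s IH] u t /=.
  move=> _ _ <-; case: t => //= b t _ lt /andP[]; rewrite -lt.
  by rewrite mem_last.
move=> /andP[ua pa] /andP[nu us] ls; case: t => [|b t] /=.
  by move=> _ e; move: nu; rewrite e ls mem_last.
move=> /andP[ub pb] lt /andP[nub ut].
have [eab|nab] := eqVneq a b; first by rewrite -eab in pb lt ut *; rewrite (IH a t).
exfalso; have nua : u != a by apply: contraNneq nu => ->; rewrite mem_head.
have [P [uP aP cP]] := bG u a nua ua.
have cross c r : c \notin P -> path (fedge G) c r -> u \notin r -> last c r \notin P.
  elim: r c => //= d r IHr c cNP /andP[cd pr]; rewrite inE negb_or => /andP[ud ur].
  apply: IHr => //; apply/negP => dP.
  by rewrite fedge_sym in cd; have [du _] := cP d c dP cNP cd; rewrite du eqxx in ud.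
have vP : v \notin P.
  by rewrite ls; apply: cross => //; move: nu; rewrite inE negb_or => /andP[].
have cross2 c r : c \in P -> path (fedge G) c r -> u \notin c :: r -> last c r \in P.
  elim: r c => //= d r IHr c cIP /andP[cd pr].
  rewrite inE negb_or => /andP[uc udr].
  apply: IHr => //; apply/negPn/negP => dP.
  by have [cu _] := cP c d cIP dP cd; rewrite cu eqxx in uc.
have bP : b \in P.
  by apply/negPn/negP => bP; have [_ ba] := cP u b uP bP ub; rewrite ba eqxx in nab.
by move: vP; rewrite -lt cross2.
Qed.

Lemma gconnected_imset (A B : fgr) (f : fvert B -> fvert A) (S : {set fvert B}) :
  (forall x y, fedge B x y -> fedge A (f x) (f y)) ->
  gconnected S -> gconnected (f @: S).
Proof.
move=> fe /gconnectedP cS; apply/gconnectedP => P y /imsetP[x xS ->] fxP clP.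
have /subsetP sSP : S \subset f @^-1: P.
  apply: (cS _ x) => //; first by rewrite inE.
  move=> a b aS /[!inE] faP bS ab.
  by apply: clP (fe _ _ ab) => //; apply: imset_f.
by apply/subsetP => _ /imsetP[z zS ->]; have := sSP z zS; rewrite inE.
Qed.

(** Only the bridge leads from one side to the other, and [S] does not contain both of its ends. *)
Lemma bridge_side (G : fgr) (u v : fvert G) P (S : {set fvert G}) x y :
  bridge u v P -> ~~ ((u \in S) && (v \in S)) -> gconnected S ->
  x \in S -> y \in S -> (x \in P) = (y \in P).
Proof.
move=> [uP vP cP] nuv /gconnectedP cS.
have side z w : z \in S -> w \in S -> z \in P -> w \in P.
  move=> zS wS zP; have /subsetP sub : S \subset P; last exact: sub.
  apply: (cS P z) => // a b aS aP bS ab; apply/negPn/negP => bP.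
  by have [ea eb] := cP _ _ aP bP ab; rewrite -ea -eb aS bS in nuv.
by move=> xS yS; apply/idP/idP; apply: side.
Qed.

(** * Collapsing a single edge *)

Definition elementary (B A : fgr) (f : fvert B -> fvert A) (u v : fvert B) : Prop :=
  [/\ u != v, fedge B u v, f u = f v, gepi f &
    forall x y, f x = f y -> x = y \/ (x = u /\ y = v) \/ (x = v /\ y = u)].

Section Elementary.
Variables (B A : fgr) (f : fvert B -> fvert A) (u v : fvert B).
Hypothesis ef : elementary f u v.

Lemma elementary_sat (P : {set fvert B}) x y :
  (u \in P) = (v \in P) -> f x = f y -> (x \in P) = (y \in P).
Proof. by case: ef => _ _ _ _ h uvP /h[->|[[-> ->]|[-> ->]]]. Qed.

Lemma elementary_out x y : y != u -> y != v -> f x = f y -> x = y.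
Proof.
case: ef => _ _ _ _ h yu yv /h[//|[[_ e]|[_ e]]].
  by rewrite e eqxx in yv.
by rewrite e eqxx in yu.
Qed.

Lemma elementary_in x : f x = f u -> x = u \/ x = v.
Proof. by case: ef => _ _ _ _ h /h[->|[[-> _]|[-> _]]]; auto. Qed.

(** A set closed under the edges of the preimage is saturated there, [u] and [v] being adjacent, so
    it descends to [A] and fills [S]. *)
Lemma elementary_connected (S : {set fvert A}) :
  gconnected S -> gconnected (f @^-1: S).
Proof.
case: ef => nuv euv fuv [_ fs fl] _ /gconnectedP cS; apply/gconnectedP => P x.
rewrite inE => fxS xP clP.
have sat a b : f a \in S -> f a = f b -> a \in P -> b \in P.
  move=> faS fab aP; have [_ _ _ _ h] := ef; case: (h _ _ fab) => [<-//|].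
  by case=> -[ea eb]; apply: (clP a) => //; rewrite ?inE -?fab // ea eb // fedge_sym.
have /subsetP sSP : S \subset f @: (P :&: f @^-1: S).
  apply: (cS _ (f x)) => //; first by apply: imset_f; rewrite !inE xP.
  move=> _ b _ /imsetP[p /setIP[pP] /[!inE] fpS ->] bS /fl[a' [b' [ab ea eb]]].
  rewrite -eb; apply: imset_f; rewrite !inE eb bS andbT.
  have a'P : a' \in P by apply: sat pP; rewrite ?ea.
  by apply: clP ab; rewrite ?inE ?ea ?eb.
apply/subsetP => z /[!inE] fzS; have /imsetP[p /setIP[pP] /[!inE] fpS e] := sSP _ fzS.
by apply: sat pP => //.
Qed.

Lemma elementary_bridged_down : bridged B -> bridged A.
Proof.
case: ef => nuv euv fuv [fe fs fl] h bB a b nab /fl[x [y [xy ea eb]]].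
have nxy : x != y by apply: contraNneq nab => e; rewrite -ea -eb e.
have [P bP] := bB _ _ nxy xy.
have nn : ~~ ((x \in [set u; v]) && (y \in [set u; v])).
  apply: contraNN nab => /andP[]; rewrite -ea -eb !inE.
  by do 2 case/orP => /eqP->; rewrite ?fuv.
(* The bridge is not the collapsed edge, so [u] and [v] lie on the same side of it and [P] is
   saturated. *)
have uvP : (u \in P) = (v \in P).
  apply: (bridge_side bP nn); rewrite ?inE ?eqxx ?orbT //.
  apply/gconnectedP => Q z; rewrite !inE => zuv zQ clQ.
  have [uQ|uQ] := boolP (u \in Q); last first.
    move: zuv => /orP[]/eqP e; subst z; first by rewrite zQ in uQ.
    by case/negP: uQ; apply: (clQ v); rewrite ?inE ?eqxx ?orbT // fedge_sym.
  apply/subsetP => w; rewrite !inE => /orP[]/eqP-> //.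
  by apply: (clQ u); rewrite ?inE ?eqxx ?orbT.
have [xP yP cP] := bP.
exists (f @: P); split; first by rewrite -ea imset_f.
  apply/imsetP => -[p pP e]; case/negP: yP.
  by rewrite -(elementary_sat uvP (_ : f p = f y)) // -e eb.
move=> _ b' /imsetP[p pP ->] b'P /fl[x' [y' [xy' ex ey]]].
have x'P : x' \in P by rewrite (elementary_sat uvP ex).
have y'P : y' \notin P by apply: contra b'P => y'P; rewrite -ey imset_f.
have [e1 e2] := cP _ _ x'P y'P xy'.
by rewrite -ex -ey e1 e2.
Qed.

(** For an elementary map this excludes a common neighbour of [u] and [v]: the resulting triangle
    would collapse to an edge, and its edges are not bridges. *)
Definition unique_lifts : Prop := forall x y x' y', fedge B x y -> fedge B x' y' ->
  f x = f x' -> f y = f y' -> f x <> f y -> x = x' /\ y = y'.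

Lemma elementary_bridged_up : unique_lifts -> bridged A -> bridged B.
Proof.
case: ef => nuv euv fuv [fe fs fl] h ul bA.
(* One side of the collapsed edge is [u] with everything hanging off its other neighbours, and the
   latter is read off from the bridges of [A] at [f u]. *)
have [P bP] : exists P, bridge u v P.
  pose N := [set w | [&& fedge B u w, w != u & w != v]].
  have fN w : w \in N -> f w != f u.
    rewrite !inE => /and3P[_ nu nv].
    by apply/eqP => /elementary_in[e|e]; [rewrite e eqxx in nu|rewrite e eqxx in nv].
  have /(@fin_all_exists _ _ (fun w P => w \in N -> bridge (f w) (f u) P))[s hs] :
      forall w, exists P : {set fvert A}, w \in N -> bridge (f w) (f u) P.
    move=> w; have [wN|_] := boolP (w \in N); last by exists set0.
    have [|P hP] := bA (f w) (f u) (fN _ wN); last by exists P.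
    by rewrite fedge_sym; apply: fe; move: wN; rewrite inE => /and3P[].
  exists (u |: \bigcup_(w in N) f @^-1: s w); split; first by rewrite !inE eqxx.
    rewrite !inE eq_sym (negPf nuv) /=; apply/bigcupP => -[w wN].
    by rewrite inE -fuv; have [_ /negPf-> _] := hs _ wN.
  move=> p q; rewrite !inE negb_or => + /andP[qu qN].
  have {}qN w : w \in N -> f q \notin s w.
    by move=> wN; apply: contra qN => qs; apply/bigcupP; exists w; rewrite ?wN // inE.
  case/orP => [/eqP->|/bigcupP[w wN]] pq.
    split=> //; apply/eqP/negPn/negP => qv.
    have qIN : q \in N by rewrite inE pq qu qv.
    by have := qN q qIN; have [-> _ _] := hs _ qIN.
  move: pq; rewrite inE => ps pq; have [_ us cs] := hs _ wN.
  have [e1 e2] := cs _ _ ps (qN _ wN) (fe _ _ pq).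
  have [eq|eq] := elementary_in e2; first by rewrite eq eqxx in qu.
  have := wN; rewrite inE fedge_sym => /and3P[uw _ _].
  have [|_ e] := ul p q w u pq uw e1 e2; first by rewrite e1 e2; apply/eqP/fN.
  by rewrite e eqxx in qu.
move=> x y nxy xy.
have [e|nf] := eqVneq (f x) (f y).
  case: (h _ _ e) => [e'|[[-> ->]|[-> ->]]]; first by rewrite e' eqxx in nxy.
    by exists P.
  by exists (~: P); apply: bridgeC.
have [Q [xQ yQ cQ]] := bA _ _ nf (fe _ _ xy).
exists (f @^-1: Q); split; rewrite ?inE // => x' y' /[!inE] x'Q y'Q xy'.
have [e1 e2] := cQ _ _ x'Q y'Q (fe _ _ xy').
by apply: ul => //; rewrite e1 e2; apply/eqP.
Qed.

Lemma vorder_elementary_up y :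
  unique_lifts -> y != u -> y != v -> (vorder y <= vorder (f y))%N.
Proof.
case: ef => nuv euv fuv [fe fs fl] h ul yu yv; rewrite /vorder.
rewrite -(card_in_imset (f := f)) => [|w w']; last first.
  rewrite !inE => /andP[wy yw] /andP[wy' yw'] e.
  have [] := ul y w y w' yw yw' erefl e => // e2.
  by move: wy; rewrite (elementary_out yu yv (esym e2)) eqxx.
apply: subset_leq_card; apply/subsetP => _ /imsetP[w + ->].
rewrite !inE => /andP[wy /fe->]; rewrite andbT.
by apply: contraNneq wy => /(elementary_out yu yv) ->.
Qed.

Lemma vorder_elementary_down y :
  y != u -> y != v -> (vorder (f y) <= vorder y)%N.
Proof.
case: ef => nuv euv fuv [fe fs fl] h yu yv; rewrite /vorder.
apply: leq_trans (leq_imset_card f _); apply: subset_leq_card.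
apply/subsetP => b; rewrite !inE => /andP[nb /fl[y' [b' [yb ey eb]]]].
have e := elementary_out yu yv ey; subst y'.
rewrite -eb imset_f // inE yb andbT; apply: contraNneq nb => e.
by rewrite -eb e.
Qed.

(** The edge between [u] and [v] is counted once at each end and disappears in the image. *)
Lemma vorder_elementary_in : (vorder (f u) <= (vorder u).-1 + (vorder v).-1)%N.
Proof.
case: ef => nuv euv fuv [fe fs fl] h; rewrite /vorder.
rewrite (cardsD1 v) (cardsD1 u [set w | (w != v) && fedge B v w]) !inE.
rewrite (eq_sym v) nuv euv fedge_sym euv /=.
apply: leq_trans (leq_add (leq_imset_card f _) (leq_imset_card f _)).
apply: leq_trans (leq_card_setU _ _); apply: subset_leq_card.
apply/subsetP => b; rewrite !inE => /andP[nb /fl[y [b' [yb ey eb]]]].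
have bu : b' != u by apply: contraNneq nb => e; rewrite -eb e.
have bv : b' != v by apply: contraNneq nb => e; rewrite -eb e fuv.
by rewrite -eb; case: (elementary_in ey) => e; subst y; apply/orP;
  [left|right]; rewrite imset_f // !inE bu bv yb.
Qed.

End Elementary.

Definition nbr (G : fgr) (v : fvert G) : {set fvert G} :=
  [set w | (w != v) && fedge G v w].

Lemma gconnected1 (G : fgr) (a : fvert G) : gconnected [set a].
Proof.
by apply/gconnectedP => P x /set1P-> aP _; apply/subsetP => _ /set1P->.
Qed.

Lemma TM3_id (A : fgr) : inTM3 A -> TM3_mor (@id (fvert A)).
Proof.
move=> hA; split=> //; split; first by split=> // [b|b1 b2]; [exists b|exists b1, b2].
by move=> S cS; rewrite (_ : _ @^-1: S = S) //; apply/setP => x; rewrite inE.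
Qed.

Lemma TM3_comp (A B C : fgr) (f : fvert B -> fvert A) (g : fvert C -> fvert B) :
  TM3_mor f -> TM3_mor g -> TM3_mor (f \o g).
Proof.
move=> [hB hA [[fe fs fl] fc]] [hC _ [[ge gs gl] gc]]; split=> //; split.
  split=> [x y /ge/fe//|b|b1 b2 /fl[a1 [a2 [/gl[c1 [c2 [c12 <- <-]]] <- <-]]]].
    by have [a <-] := fs b; have [c <-] := gs a; exists c.
  by exists c1, c2.
move=> S /fc/gc; rewrite (_ : (f \o g) @^-1: S = g @^-1: (f @^-1: S)) //.
by apply/setP => x; rewrite !inE.
Qed.

(** * Splitting a vertex *)

Section Split.
Variables (A : fgr) (a : fvert A) (N : {set fvert A}).

(* [None] is a new vertex adjacent to [a] that takes over the neighbours in [N]. *)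
Definition split_rel (p q : option (fvert A)) : bool :=
  match p, q with
  | None, None => true
  | None, Some y => (y == a) || (y \in nbr a :&: N)
  | Some x, None => (x == a) || (x \in nbr a :&: N)
  | Some x, Some y => [&& fedge A x y, ~~ ((x == a) && (y \in nbr a :&: N))
                       & ~~ ((y == a) && (x \in nbr a :&: N))]
  end.

Lemma split_rel_refl : reflexive split_rel.
Proof.
move=> [x|//] /=; rewrite fedge_refl !inE /= andbb.
by apply/negP => /andP[/eqP->]; rewrite eqxx.
Qed.

Lemma split_rel_sym : symmetric split_rel.
Proof.
move=> [x|] [y|] //=; rewrite fedge_sym; congr (_ && _); exact: andbC.
Qed.

Definition split_graph : fgr := MkFgr split_rel_refl split_rel_sym.

Definition split_map : fvert split_graph -> fvert A := odflt a.

Lemma split_elementary : elementary split_map None (Some a : fvert split_graph).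
Proof.
split=> //=; first by rewrite /= eqxx.
  split=> [x y|b|x y xy]; last 2 first.
  - by exists (Some b).
  - have [/andP[xa yN]|h1] := boolP ((x == a) && (y \in nbr a :&: N)).
      by exists None, (Some y); rewrite /= yN orbT (eqP xa).
    have [/andP[ya xN]|h2] := boolP ((y == a) && (x \in nbr a :&: N)).
      by exists (Some x), None; rewrite /= xN orbT (eqP ya).
    by exists (Some x), (Some y); rewrite /= h1 h2 xy.
  case: x y => [x|] [y|] //=; rewrite ?fedge_refl //.
  - by case/and3P.
  - by case/orP => [/eqP->|]; rewrite ?fedge_refl // fedge_sym !inE => /andP[/andP[]].
  - by case/orP => [/eqP->|]; rewrite ?fedge_refl // !inE => /andP[/andP[]].
by move=> [x|] [y|] //= e; subst; auto.
Qed.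

Lemma split_unique_lifts : unique_lifts split_map.
Proof.
have na y : y \in nbr a :&: N -> y <> a by rewrite !inE => /andP[/andP[/eqP]].
move=> [x|] [y|] [x'|] [y'|] //=; intros; subst => //.
all: try by [].
all: repeat match goal with
 | H : is_true [&& _, _ & _] |- _ => case/and3P: H => *
 | H : is_true ((_ == _) || _) |- _ => case/orP: H => [/eqP ?|?]; subst
 end; try by [].
all: try by exfalso; match goal with
 | H : is_true (~~ ((?z == ?z) && ?b)), K : is_true ?b |- _ => rewrite eqxx K in H
 end.
Qed.

Lemma vorder_split_None : (vorder (None : fvert split_graph) <= #|nbr a :&: N|.+1)%N.
Proof.
rewrite /vorder; apply: (@leq_trans #|Some @: (a |: (nbr a :&: N))|).
  apply: subset_leq_card; apply/subsetP => -[x|]; rewrite !inE //= => h.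
  by apply: imset_f; rewrite !inE; move: h; rewrite !inE.
by rewrite (leq_trans (leq_imset_card _ _)) // cardsU1; case: (_ \notin _).
Qed.

Lemma vorder_split_Some :
  (vorder (Some a : fvert split_graph) <= #|nbr a :\: N|.+1)%N.
Proof.
rewrite /vorder; apply: (@leq_trans #|None |: Some @: (nbr a :\: N)|).
  apply: subset_leq_card; apply/subsetP => -[x|] /=; last by rewrite !inE.
  rewrite !inE /= eqxx /= => /andP[na /and3P[ax h _]].
  have {}na : x != a by apply: contraNneq na => ->.
  by apply: imset_f; move: h; rewrite !inE na ax /= !andbT.
rewrite cardsU1 (leq_trans (leq_add (leq_b1 _) (leq_imset_card _ _))) //.
Qed.

(** Each half keeps at most two old neighbours and gains the new edge, whence order at most 3; all
    other orders do not grow. *)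
Lemma split_TM3 : inTM3 A -> (#|nbr a :&: N| <= 2)%N -> (#|nbr a :\: N| <= 2)%N ->
  TM3_mor split_map.
Proof.
move=> hA N1 N2; have [tA cA oA] := hA.
have el := split_elementary; have ul := split_unique_lifts.
have [_ _ _ [fe fs fl] _] := el.
split=> //; last by split=> // S; apply: elementary_connected el _.
split.
- apply: bridged_tree; last exact: (elementary_bridged_up el ul (tree_bridged tA)).
  have := elementary_connected el (tree_connected tA).
  by rewrite preimsetT.
- by rewrite /= card_option (leq_trans cA).
move=> y; have [->|yN] := eqVneq y None; first exact: leq_trans vorder_split_None _.
have [->|ya] := eqVneq y (Some a); first exact: leq_trans vorder_split_Some _.
exact: leq_trans (vorder_elementary_up el ul yN ya) (oA _).
Qed.

End Split.

(** * Contracting an edge *)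

Section Contract.
Variables (B : fgr) (u v : fvert B).
Hypotheses (vu : v != u) (euv : fedge B u v).

(** The merged vertex is represented by [v]: [u] is removed from the vertex set, and the default
    value of [insubd] sends it to [v]. *)
Definition contract_map (x : fvert B) : {x : fvert B | x != u} :=
  insubd (exist _ v vu : {x : fvert B | x != u}) x.

Definition contract_rel (p q : {x : fvert B | x != u}) : bool :=
  [exists x, exists y, [&& contract_map x == p, contract_map y == q & fedge B x y]].

Lemma contract_rel_refl : reflexive contract_rel.
Proof.
move=> p; apply/existsP; exists (val p); apply/existsP; exists (val p).
by rewrite /contract_map valKd eqxx fedge_refl.
Qed.

Lemma contract_rel_sym : symmetric contract_rel.
Proof.
move=> p q; apply/idP/idP => /existsP[x /existsP[y /and3P[xp yq xy]]];
  apply/existsP; exists y; apply/existsP; exists x; by rewrite xp yq fedge_sym xy.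
Qed.

Definition contract_graph : fgr := MkFgr contract_rel_refl contract_rel_sym.

Lemma val_contract_map x : val (contract_map x) = if x == u then v else x.
Proof. by rewrite val_insubd /=; case: eqP. Qed.

Lemma contract_elementary :
  elementary (contract_map : fvert B -> fvert contract_graph) u v.
Proof.
split=> //; first by rewrite eq_sym.
- by apply/val_inj; rewrite !val_contract_map eqxx (negPf vu).
- split=> [x y xy|p|p q /existsP[x /existsP[y /and3P[/eqP xp /eqP yq xy]]]].
  + by apply/existsP; exists x; apply/existsP; exists y; rewrite !eqxx.
  + by exists (val p); rewrite /contract_map valKd.
  + by exists x, y.
move=> x y /(congr1 val); rewrite !val_contract_map.
by case: (eqVneq x u) => [->|xu]; case: (eqVneq y u) => [->|yu]; auto.
Qed.

(** The merged vertex has order at most (2 - 1) + (3 - 1) = 3, the 2 being the bound assumed for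
    [u]. *)
Lemma contract_TM3 (A : fgr) (g : fvert B -> fvert A) : TM3_mor g -> g u = g v ->
  (vorder u <= 2)%N -> TM3_mor (g \o val : fvert contract_graph -> fvert A).
Proof.
move=> [hB hA [[ge gs gl] gc]] guv du; have [tB cB oB] := hB.
have el := contract_elementary; have [_ _ cuv [fe fs fl] _] := el.
have gval x : g (val (contract_map x)) = g x.
  by rewrite val_contract_map; case: eqVneq => [->|].
have tC : inTM3 contract_graph.
  split.
  - apply: bridged_tree; last exact: (elementary_bridged_down el (tree_bridged tB)).
    have := gconnected_imset fe (tree_connected tB).
    rewrite (_ : _ @: _ = [set: _]) //; apply/setP => p; rewrite !inE.
    by have [x <-] := fs p; rewrite imset_f ?inE.
  - have [_ cA _] := hA; apply: leq_trans cA _.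
    rewrite -!cardsT; apply: leq_trans (leq_imset_card (g \o val) _).
    apply: subset_leq_card; apply/subsetP => a _; have [x <-] := gs a.
    by rewrite -gval; apply: (imset_f (g \o val)); rewrite inE.
  move=> p; have [x <-] := fs p.
  have [->|xu] := eqVneq x u.
    apply: leq_trans (vorder_elementary_in el) _.
    by have := oB v; move: du; case: (vorder u) => [|[|[]]] //; case: (vorder v) => [|[|[|[]]]].
  have [->|xv] := eqVneq x v.
    rewrite -cuv; apply: leq_trans (vorder_elementary_in el) _.
    by have := oB v; move: du; case: (vorder u) => [|[|[]]] //; case: (vorder v) => [|[|[|[]]]].
  exact: leq_trans (vorder_elementary_down el xu xv) (oB x).
split=> //; split.
  split=> [p q /fl[x [y [xy <- <-]]]|a|a b /gl[x [y [xy <- <-]]]].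
  - by rewrite /= !gval; apply: ge.
  - by have [x <-] := gs a; exists (contract_map x); rewrite /= gval.
  - by exists (contract_map x), (contract_map y); rewrite /= !gval; split=> //; apply: fe.
move=> S /gc/(gconnected_imset fe); congr gconnected.
apply/setP => p; rewrite !inE; apply/imsetP/idP => [[x + ->]|gpS].
  by rewrite !inE /= gval.
by exists (val p); rewrite ?inE // /contract_map valKd.
Qed.

End Contract.

(** * Fibres of monotone epimorphisms *)

(** No edge would leave a nonempty [Q :\: P]: edges leave [Q] only at [w], which is in [P], and
    enter [P] only from [v], which is not in [Q]. This makes a walk along a fibre descend to smaller
    and smaller sides. *)
Lemma bridge_sub (G : fgr) (u v w : fvert G) (P Q : {set fvert G}) :
  gconnected [set: fvert G] -> w != v -> fedge G u v ->
  bridge u v P -> w \in P -> bridge w u Q -> Q \subset P.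
Proof.
move=> /gconnectedP cG wv uv [uP vP cP] wP [wQ uQ cQ].
have vQ : v \notin Q.
  apply: contraNN wv => vQ; rewrite fedge_sym in uv.
  by have [->] := cQ v u vQ uQ uv.
apply/subsetP => z zQ; apply/negPn/negP => zP.
suff /subsetP/(_ u) : [set: fvert G] \subset Q :\: P.
  by rewrite !inE uP => /(_ isT).
apply: (cG _ z) => //; first by rewrite !inE zP.
move=> x y _ /setDP[xQ xP] _ xy; apply/setDP; split.
  apply/negPn/negP => yQ; have [exw _] := cQ _ _ xQ yQ xy.
  by rewrite exw wP in xP.
apply/negP => yP; rewrite fedge_sym in xy; have [_ exv] := cP y x yP xP xy.
by rewrite exv in xQ; rewrite xQ in vQ.
Qed.

(** Descent on the size of [P]: besides [v], the vertex [u] has two further neighbours. If one of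
    them is in the fibre, its own smaller side already provides both outer vertices; otherwise these
    two are outer. *)
Lemma fibre_bridge_outer (A B : fgr) (g : fvert B -> fvert A) :
  is_tree B ->
  (forall u v, u != v -> fedge B u v -> g u = g v -> (2 < vorder u)%N) ->
  forall (P : {set fvert B}) u v, bridge u v P -> u != v -> fedge B u v -> g u = g v ->
  exists y1 y2, [/\ y1 != y2, y1 \in P, y2 \in P &
    forall y, y \in [set y1; y2] -> g y != g u /\ exists2 x, g x = g u & fedge B x y].
Proof.
move=> tB big P; have cB := tree_connected tB; have bB := tree_bridged tB.
elim: {P}_.+1 {-2}P (ltnSn #|P|) => // n IH P leP u v bP nuv uv guv.
have [uP vP cP] := bP.
have : (1 < #|nbr u :\ v|)%N.
  have := big u v nuv uv guv; rewrite /vorder -/(nbr u) (cardsD1 v).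
  by case: (v \in nbr u) => //= /ltnW.
case/card_gt1P => w1 [w2 [w1N w2N w12]].
have nP w : w \in nbr u :\ v -> w \in P.
  rewrite !inE => /and3P[wv wu uw]; apply/negPn/negP => wP.
  by have [_ e] := cP u w uP wP uw; rewrite e eqxx in wv.
have inner w : w \in nbr u :\ v -> g w = g u -> exists y1 y2, [/\ y1 != y2, y1 \in P,
    y2 \in P & forall y, y \in [set y1; y2] ->
      g y != g u /\ exists2 x, g x = g u & fedge B x y].
  move=> wN gw; have wP := nP _ wN; move: wN; rewrite !inE => /and3P[wv wu uw].
  have wu' : fedge B w u by rewrite fedge_sym.
  have [Q bQ] := bB w u wu wu'.
  have sQP := bridge_sub cB wv uv bP wP bQ.
  have [_ uQ _] := bQ.
  have ltQ : (#|Q| < n)%N.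
    apply: leq_trans (_ : #|P| <= n)%N; last by rewrite -ltnS.
    by apply: proper_card; apply/properP; split=> //; exists u.
  have [y1 [y2 [y12 y1Q y2Q hy]]] := IH Q ltQ w u bQ wu wu' gw.
  exists y1, y2; split=> //; try exact: (subsetP sQP).
  by move=> y /hy; rewrite gw.
have [e1|n1] := eqVneq (g w1) (g u); first exact: inner e1.
have [e2|n2] := eqVneq (g w2) (g u); first exact: inner e2.
exists w1, w2; split=> //; try exact: nP.
move=> y; rewrite !inE => /orP[]/eqP->; split=> //; exists u => //.
  by move: w1N; rewrite !inE => /and3P[].
by move: w2N; rewrite !inE => /and3P[].
Qed.

(* If every vertex of a nontrivial fibre had order 3, both sides of an edge
   inside the fibre would be attached to two outer neighbours, and these four
   have distinct images. *)
Lemma fibre_edge (A B : fgr) (g : fvert B -> fvert A) x0 y0 :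
  TM3_mor g -> x0 != y0 -> g x0 = g y0 ->
  exists u v, [/\ u != v, fedge B u v, g u = g v & (vorder u <= 2)%N].
Proof.
move=> [[tB cardB oB] [tA cA oA] [[ge gs gl] gc]] nxy gxy.
have cB := tree_connected tB; have bB := tree_bridged tB.
apply: contrapT => nex.
have big u v : u != v -> fedge B u v -> g u = g v -> (2 < vorder u)%N.
  by move=> nuv uv guv; rewrite ltnNge; apply/negP => le; apply: nex; exists u, v.
have [v [nuv uv guv]] : exists v, [/\ x0 != v, fedge B x0 v & g x0 = g v].
  apply: contrapT => nv.
  have /gconnectedP cT := gc _ (@gconnected1 _ (g x0)).
  suff /subsetP/(_ y0) : g @^-1: [set g x0] \subset [set x0].
    by rewrite !inE gxy eqxx (eq_sym y0) (negPf nxy) => /(_ isT).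
  apply: (cT _ x0); rewrite ?inE ?eqxx // => y z /[!inE] _ /eqP-> /eqP gz x0z.
  by apply/eqP; apply: contrapT => nz; apply: nv; exists z; split=> //;
    apply/eqP => e; apply: nz.
have [P bP] := bB _ _ nuv uv.
have vu : v != x0 by rewrite eq_sym.
have vu' : fedge B v x0 by rewrite fedge_sym.
have [y1 [y2 [y12 y1P y2P h12]]] := fibre_bridge_outer tB big bP nuv uv guv.
have [y3 [y4 [y34 y3P y4P h34]]] :=
  fibre_bridge_outer tB big (bridgeC bP) vu vu' (esym guv).
pose Y := [set y1; y2] :|: [set y3; y4].
have hY y : y \in Y -> g y != g x0 /\ exists2 x, g x = g x0 & fedge B x y.
  by rewrite inE => /orP[/h12//|/h34]; rewrite guv.
(* Two edges joining the same pair of fibres coincide: the fibres are connected, so the bridge from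
   [x] to [y] has one on each side and is the only crossing. *)
have gY : {in Y &, injective g}.
  move=> y y' /hY[ny [x gx xy]] /hY[ny' [x' gx' xy']] e.
  have nxy' : x != y by apply: contraNneq ny => <-; rewrite gx.
  have [Q bQ] := bB x y nxy' xy; have [xQ yQ cQ] := bQ.
  have x'Q : x' \in Q.
    rewrite -(bridge_side (S := g @^-1: [set g x0]) (x := x) bQ) //.
    - by rewrite !inE (negPf ny) andbF.
    - exact/gc/gconnected1.
    - by rewrite !inE gx.
    - by rewrite !inE gx'.
  have y'Q : y' \notin Q.
    rewrite -(bridge_side (S := g @^-1: [set g y]) (x := y) bQ) //.
    - by rewrite !inE gx eq_sym (negPf ny).
    - exact/gc/gconnected1.
    - by rewrite !inE.
    - by rewrite !inE e.
  by have [] := cQ _ _ x'Q y'Q xy'.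
have : (#|g @: Y| <= vorder (g x0))%N.
  apply: subset_leq_card; apply/subsetP => _ /imsetP[y /hY[ny [x gx xy]] ->].
  by rewrite !inE ny -gx ge.
rewrite card_in_imset // cardsU !cards2 y12 y34.
rewrite (_ : _ :&: _ = set0) ?cards0 => [|]; last first.
  apply/setP => y; rewrite !inE; apply/negP => /andP[h1 h2].
  have yP : y \in P by case/orP: h1 => /eqP->.
  by case/orP: h2 yP => /eqP-> yP; [move: y3P|move: y4P]; rewrite inE yP.
by move=> /leq_trans/(_ (oA _)).
Qed.

From mathcomp Require Import all_order all_algebra.
From mathcomp Require Import all_classical all_reals interval_inference topology normedtype sequences.
From mathcomp Require Import ring lra.
Import Order.TTheory GRing.Theory Num.Theory.
Import numFieldNormedType.Exports.
Local Open Scope classical_set_scope.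

(** * Ordered continua and arcs *)

Lemma connected_sub_open (T : topologicalType) (V A B : set T) x :
  connected V -> open A -> open B -> V `<=` A `|` B ->
  (forall y, V y -> A y -> B y -> False) -> V x -> A x -> V `<=` A.
Proof.
move=> cV oA oB VAB dAB Vx Ax; suff -> : V = V `&` A by apply: subIsetr.
apply/esym; apply: cV; first by exists x.
  by exists A.
exists (~` B); first exact: open_closedC.
apply/seteqP; split=> y [Vy h]; split=> //; first by move=> By; exact: dAB By.
by have [//|/h] := VAB y Vy.
Qed.

Lemma connected_sub_closed (T : topologicalType) (V A B : set T) x :
  connected V -> closed A -> closed B -> V `<=` A `|` B ->
  (forall y, V y -> A y -> B y -> False) -> V x -> A x -> V `<=` A.
Proof.
move=> cV cA cB VAB dAB Vx Ax.
have VAC : V `<=` ~` B.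
  apply: (@connected_sub_open _ V _ (~` A) x) => //; try exact: closed_openC.
  - by move=> y Vy; have [Ay|By] := VAB y Vy; [left=> By; exact: dAB By|right=> Ay; exact: dAB By].
  - by move=> y Vy nB nA; have [] := VAB y Vy.
  - by move=> Bx; exact: dAB Bx.
by move=> y Vy; have [//|By] := VAB y Vy; have := VAC y Vy.
Qed.

Lemma open_component (T : topologicalType) (U : set T) x :
  Defs.locally_connected T -> open U -> open (connected_component U x).
Proof.
move=> lT oU; rewrite openE => y /[dup] Cy [B [Bx BU cB] By].
have [V [oV cV Vy VU]] := lT y U (open_nbhs_nbhs (conj oU (BU _ By))).
apply: (@filterS _ _ _ V); last exact: open_nbhs_nbhs.
move=> z Vz; apply: (connected_component_trans Cy).
by exists V => //; split.
Qed.

Lemma nested_sub (T : topologicalType) (C : nat -> set T) (O : set T) :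
  compact [set: T] -> (forall n, closed (C n)) -> (forall n, C n.+1 `<=` C n) ->
  open O -> \bigcap_n C n `<=` O -> exists n, C n `<=` O.
Proof.
move=> cT clC decC oO CO; apply: contrapT => /forallNP nC.
have dec n m : (n <= m)%N -> C m `<=` C n.
  elim: m => [|m IH]; first by rewrite leqn0 => /eqP->.
  rewrite leq_eqVlt => /orP[/eqP->//|/IH h]; exact: subset_trans (decC _) h.
pose F := filter_from [set: nat] (fun n => C n `\` O).
have FF : ProperFilter F.
  apply: filter_from_proper; last first.
    move=> n _; apply: contrapT => h; apply: (nC n) => x Cx.
    by apply: contrapT => Ox; apply: h; exists x.
  apply: filter_from_filter; first by exists 0%N.
  move=> i j _ _; exists (maxn i j) => // x [Cx Ox].
  by split; split=> //; apply: dec Cx; rewrite ?leq_maxl ?leq_maxr.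
have [|x [_ cx]] := cT F FF; first by exists 0%N.
have clx n : C n x /\ ~ O x.
  have : closed (C n `\` O) by apply: closedI => //; exact: open_closedC.
  by move=> /(_ x); apply => A /(cx (C n `\` O) A); apply; exists n.
by have [_] := clx 0%N; apply; apply: CO => n _; have [] := clx n.
Qed.

Lemma nested_nonempty (T : topologicalType) (C : nat -> set T) :
  compact [set: T] -> (forall n, closed (C n)) -> (forall n, C n.+1 `<=` C n) ->
  (forall n, C n !=set0) -> \bigcap_n C n !=set0.
Proof.
move=> cT clC decC C0; apply: contrapT => h.
have [|n] := nested_sub cT clC decC open0; first by move=> x Cx; apply: h; exists x.
by have [x Cx] := C0 n; move=> /(_ x Cx).
Qed.

(** By normality a separation of the intersection extends to disjoint open sets, and these already
    cover and separate some [C n]. *)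
Lemma nested_connected (R : realType) (X : pseudoMetricType R) (C : nat -> set X) :
  compact [set: X] -> (forall n, closed (C n)) -> (forall n, C n.+1 `<=` C n) ->
  (forall n, connected (C n)) -> connected (\bigcap_n C n).
Proof.
move=> cX clC decC cC B [x Bx] [O oO BO] [F cF BF].
set K := \bigcap_n C n in BO BF *.
have clK : closed K by apply: closed_bigI.
have clB : closed B by rewrite BF; apply: closedI.
have clB' : closed (K `\` O) by apply: closedI => //; exact: open_closedC.
have [] := (@normal_openP R X).1 (@pseudometric_normal R X) B (K `\` O) clB clB'.
  by rewrite BO; apply/seteqP; split=> // y [[_ Oy] [_ /(_ Oy)]].
move=> U [V [oU oV BU KV UV]].
have dUV y : U y -> V y -> False by move=> Uy Vy; have : (U `&` V) y by []; rewrite UV.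
have [|n CUV] := @nested_sub _ C (U `|` V) cX clC decC (openU oU oV).
  move=> y Ky; have [Oy|Oy] := pselect (O y); last by right; apply: KV.
  by left; apply: BU; rewrite BO.
have Kx : K x by move: Bx; rewrite BF => -[].
have CU : C n `<=` U.
  apply: (@connected_sub_open _ (C n) U V x) => //; last exact: BU.
    by move=> y _; apply: dUV.
  exact: Kx.
apply/seteqP; split=> y; first by rewrite BF => -[].
move=> Ky; have Uy : U y by apply: CU; exact: Ky.
rewrite BO; split=> //; apply: contrapT => Oy.
by apply: (dUV y) => //; apply: KV.
Qed.

(** * Chains of sets *)

Section Linked.
Variables (T : Type) (I : eqType) (L : I -> set T).

(** Links are given by indices in [I], so that a chain can carry labels; [p'] is the point at which
    one link hands over to the next. *)
Fixpoint linked (p : T) (s : seq I) (q : T) : Prop :=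
  if s is W :: s' then exists p', [/\ L W p, L W p' & linked p' s' q] else p = q.

(** [behead] skips the next link: only links that are not consecutive have to be disjoint. *)
Fixpoint simple (s : seq I) : Prop :=
  if s is W :: s' then
    (forall V, V \in behead s' -> L W `&` L V = set0) /\ simple s'
  else True.

Lemma linked_cat p s q t r : linked p s q -> linked q t r -> linked p (s ++ t) r.
Proof.
elim: s p => [p ->//|W s IH p [p' [Wp Wp' h]] hr].
by exists p'; split=> //; apply: IH.
Qed.

Lemma linked_start p p' W s q : L W p' -> linked p (W :: s) q -> linked p' (W :: s) q.
Proof. by move=> Wp' [p2 [_ Wp2 h]]; exists p2. Qed.

Lemma last_split (P : I -> Prop) (s : seq I) :
  (exists2 x, x \in s & P x) ->
  exists u x w, [/\ s = u ++ x :: w, P x & forall y, y \in w -> ~ P y].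
Proof.
elim: s => [[]//|a s IH] h.
have [/IH[u [x [w [-> Px hw]]]]|ns] := pselect (exists2 x, x \in s & P x).
  by exists (a :: u), x, w.
exists [::], a, s; split=> // [|y ys Py]; last by apply: ns; exists y.
by case: h => x; rewrite inE => /orP[/eqP<-//|xs Px]; case: ns; exists x.
Qed.

(* Greedy extraction: jump each time to the last link met by the current one. *)
Lemma simple_sublink (W : I) s p q :
  linked p (W :: s) q ->
  exists s2, [/\ subseq s2 s, simple (W :: s2) & linked p (W :: s2) q].
Proof.
elim: {s}_.+1 {-2}s (ltnSn (size s)) W p => // n IH s les W p hl.
have [hE|hE] := pselect (exists2 V, V \in s & L W `&` L V !=set0); last first.
  case: s hE hl {les} => [|V s] hE hl; first by exists [::].
  case: hE; exists V; first exact: mem_head.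
  by case: hl => [p' [_ Wp' [p2 [Vp' _ _]]]]; exists p'.
have [u [V [w [es [x [Wx Vx]] hw]]]] := last_split hE.
have hV : linked x (V :: w) q.
  have hl' : exists p0, linked p0 (u ++ V :: w) q.
    by case: hl => p' [_ _]; rewrite es; exists p'.
  case: hl' => p0; elim: u p0 {es les} => [|a u IHu] p0.
    by apply: linked_start.
  by case=> p' [_ _ /IHu].
have [|s2 [sub2 sim2 lin2]] := IH w _ V x hV.
  rewrite es size_cat /= addnS ltnS in les.
  by apply: leq_ltn_trans les; rewrite leq_addl.
exists (V :: s2); split.
- rewrite es; apply: (@subseq_trans _ (V :: w)); last exact: suffix_subseq.
  by rewrite /= eqxx.
- split=> // Z /(mem_subseq sub2)/hw h.
  by apply/seteqP; split=> // y Wy; apply: h; exists y.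
by case: hl => p' [Wp _ _]; exists x.
Qed.

End Linked.

Lemma linked_map (T : Type) (I J : eqType) (f : J -> I) (L : I -> set T) s p q :
  linked L p (map f s) q <-> linked (L \o f) p s q.
Proof.
elim: s p => [//|W s IH] p /=.
by split=> -[p' [h1 h2 /IH h3]]; exists p'.
Qed.

Lemma simple_map (T : Type) (I J : eqType) (f : J -> I) (L : I -> set T) s :
  simple (L \o f) s -> simple L (map f s).
Proof.
elim: s => [//|W s IH] [h /IH h']; split=> //.
by case: s h {IH h'} => //= V s h Z /mapP[Z' /h e ->].
Qed.

Lemma simple_nth (T : Type) (I : eqType) (L : I -> set T) s d i j :
  simple L s -> (i.+1 < j)%N -> (j < size s)%N -> L (nth d s i) `&` L (nth d s j) = set0.
Proof.
elim: s i j => [//|W s IH] [|i] [|j] //= [h hs] ij js; last exact: IH.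
apply: h; case: s js ij {IH hs} => //= V s; case: j => // j js _.
exact: mem_nth.
Qed.

Lemma linked_connected (T : topologicalType) (s : seq (set T)) p q :
  linked id p s q -> (forall W, W \in s -> connected W) ->
  connected (\bigcup_(W in [set W | W \in s]) W) /\
  (s != [::] -> exists2 W, W \in s & W p).
Proof.
elim: s p => [p _ _|W s IH p [p' [Wp Wp' /IH hs]] cs].
  split=> //; rewrite bigcup0 => [|W]; [exact: connected0|by rewrite /= in_nil].
split=> [|_]; last by exists W => //; apply: mem_head.
have [|cU hp'] := hs; first by move=> V Vs; apply: cs; rewrite inE Vs orbT.
have cW : connected W by apply: cs; apply: mem_head.
case: s {IH} hs cU hp' cs => [|V s] hs cU hp' cs.
  rewrite (_ : \bigcup_(_ in _) _ = W) //; apply/seteqP; split=> x.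
    by move=> [Z /=]; rewrite inE => /eqP->.
  by move=> Wx; exists W => //=; apply: mem_head.
rewrite (_ : \bigcup_(_ in _) _ =
   W `|` \bigcup_(Z in [set Z | Z \in V :: s]) Z); last first.
  apply/seteqP; split=> x.
    by move=> [Z /=]; rewrite inE => /orP[/eqP->|Zs Zx]; [left|right; exists Z].
  move=> [Wx|[Z /= Zs Zx]]; first by exists W => //=; apply: mem_head.
  by exists Z => //=; rewrite inE Zs orbT.
by apply: connectedU => //; have [//|Z Zs Zp'] := hp'; exists p'; split=> //; exists Z.
Qed.

Section Chains.
Variables (R : realType) (X : pseudoMetricType R).
Hypotheses (lX : Defs.locally_connected X).

(** The points of [V] reachable from [p] by such chains form a relatively clopen set, since every
    point of [V] has a good neighbourhood with which a chain can be prolonged. *)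
Lemma small_chain (V : set X) (e : R) p q :
  open V -> connected V -> (0 < e)%R -> V p -> V q ->
  exists c, [/\ c != [::], linked id p c q &
    forall W, W \in c -> [/\ open W, connected W, closure W `<=` V &
                            exists a, W `<=` ball a e]].
Proof.
move=> oV cV e0 Vp Vq.
pose good W := [/\ open W, connected W, closure W `<=` V & exists a, W `<=` ball a e].
have goodP z : V z -> exists2 W, good W & W z.
  move=> Vz; have /= [U Uz UV] := @uniform_regular X z V (open_nbhs_nbhs (conj oV Vz)).
  have [W [oW cW Wz WU]] := lX (filterI Uz (nbhsx_ballx z e e0)).
  exists W => //; split=> //; last by exists z => y /WU[].
  by apply: subset_trans UV; apply: closureS => y /WU[].
pose A := [set z | V z /\ exists c, [/\ c != [::], linked id p c z &
   forall W, W \in c -> good W]].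
have ext z z' W : good W -> W z -> W z' -> A z -> A z'.
  move=> gW Wz Wz' [Vz [c [c0 lc gc]]]; split.
    by have [_ _ cWV _] := gW; apply: cWV; apply: subset_closure.
  exists (rcons c W); split; first by case: (c).
    by rewrite -cats1; apply: linked_cat lc _; exists z'.
  by move=> Z; rewrite mem_rcons inE => /orP[/eqP->|/gc].
have openP (B : set X) : B `<=` V ->
    (forall z W, B z -> good W -> W z -> W `<=` B) -> open B.
  move=> BV h; rewrite openE => z Bz; have [W gW Wz] := goodP z (BV z Bz).
  apply: (@filterS _ _ _ W); first exact: h Bz gW Wz.
  by apply: open_nbhs_nbhs; case: gW.
suff /(_ _ Vq)[_ [c [c0 lc gc]]] : V `<=` A by exists c; split=> // W /gc.
apply: (@connected_sub_open _ V A (V `\` A) p) => //.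
- by apply: openP => [z []//|z W Az gW Wz z' Wz']; exact: (ext z z' W).
- apply: openP => [z []//|z W [Vz nAz] gW Wz z' Wz']; split.
    by have [_ _ cWV _] := gW; apply: cWV; apply: subset_closure.
  by move=> Az'; apply: nAz; exact: (ext z' z W).
- by move=> z Vz; have [|] := pselect (A z); [left|right].
- by move=> y _ Ay [_ /(_ Ay)].
have [W gW Wp] := goodP p Vp; split=> //; exists [:: W]; split=> //.
  by exists p.
by move=> Z; rewrite inE => /eqP->.
Qed.

(** Each new link is labelled by the position of the old link containing its closure. The labels are
    pairwise nondecreasing, a form that passes to the sublist extracted for simplicity. *)
Lemma refine_links (e : R) s p q :
  (0 < e)%R -> (forall W, W \in s -> open W /\ connected W) -> linked id p s q ->
  exists t : seq (nat * set X), [/\ s != [::] -> t != [::],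
    linked snd p t q, pairwise (fun a b : nat * set X => a.1 <= b.1)%N t &
    forall a, a \in t -> [/\ (a.1 < size s)%N, open a.2, connected a.2,
      closure a.2 `<=` nth set0 s a.1 & exists x, a.2 `<=` ball x e]].
Proof.
move=> e0; elim: s p => [p _ <-|V s IH p oc [p' [Vp Vp' lp']]]; first by exists [::].
have [t [_ lt st ht]] := IH p' (fun W Ws => oc W (mem_behead (s := V :: s) Ws)) lp'.
have [oV cV] := oc V (mem_head _ _).
have [c [c0 lc hc]] := small_chain oV cV e0 Vp Vp'.
exists (map (pair 0%N) c ++ map (fun a => (a.1.+1, a.2)) t); split.
- by move=> _; case: (c) c0.
- by apply: linked_cat; apply/linked_map; [exact: lc|exact: lt].
- rewrite pairwise_cat !pairwise_map; apply/and3P; split.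
  + by apply/allrelP => _ _ /mapP[W _ ->] /mapP[a _ ->].
  + apply: sub_pairwise (_ : pairwise (fun _ _ => true) c) => //.
    by elim: (c) => //= a l ->; rewrite all_predT.
  + by apply: sub_pairwise st.
move=> a; rewrite mem_cat => /orP[/mapP[W /hc[? ? ? ?] ->] //|/mapP[b /ht[? ? ? ? ?] ->]].
by split.
Qed.

Definition chain (p q : X) (s : seq (set X)) : Prop :=
  [/\ s != [::], linked id p s q, simple id s &
      forall W, W \in s -> open W /\ connected W].

(** Monotonicity of [r] is what makes the linear orders of successive chains compatible. *)
Definition refines (e : R) (s s2 : seq (set X)) : Prop :=
  exists r : nat -> nat,
    (forall i j, (i <= j)%N -> (j < size s2)%N -> (r i <= r j)%N) /\
    (forall i, (i < size s2)%N -> [/\ (r i < size s)%N,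
       closure (nth set0 s2 i) `<=` nth set0 s (r i) &
       exists a, nth set0 s2 i `<=` ball a e]).

Lemma refine_chain (e : R) p q s : (0 < e)%R -> chain p q s ->
  exists s2, chain p q s2 /\ refines e s s2.
Proof.
move=> e0 [s0 ls _ oc]; have [t [t0 lt st ht]] := refine_links e0 oc ls.
case: t {t0} (t0 s0) lt st ht => // a t _ lt st ht.
have [t2 [sub2 sim2 lin2]] := simple_sublink lt.
have sub : subseq (a :: t2) (a :: t) by rewrite /= eqxx.
exists (map snd (a :: t2)); split.
  split=> //; first exact/linked_map.
    exact: simple_map.
  by move=> W /mapP[b /(mem_subseq sub)/ht[_ ? ? _ _] ->].
exists (fun i => (nth (0%N, set0) (a :: t2) i).1); split=> [i j ij|i].
  rewrite size_map => js; move: ij; rewrite leq_eqVlt => /orP[/eqP->//|ij].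
  have /(pairwiseP (0%N, set0)) := subseq_pairwise sub st.
  by apply => //; rewrite inE; exact: ltn_trans ij js.
rewrite size_map => is_; rewrite (nth_map (0%N, set0)) //.
by have /(mem_subseq sub)/ht[? _ _ ? ?] := mem_nth (0%N, set0) is_.
Qed.

End Chains.

Lemma linked_first (T : Type) (s : seq (set T)) p q :
  s != [::] -> linked id p s q -> nth set0 s 0 p.
Proof. by case: s => // W s _ [p' []]. Qed.

Lemma linked_end (T : Type) (s : seq (set T)) p q :
  s != [::] -> linked id p s q -> nth set0 s (size s).-1 q.
Proof.
elim: s p => // W s IH p _ [p' [_ Wp']].
by case: s IH => [_ <-//|V s IH h]; exact: (IH p').
Qed.

Lemma linked_meet (T : Type) (s : seq (set T)) p q i :
  linked id p s q -> (i.+1 < size s)%N -> exists z, nth set0 s i z /\ nth set0 s i.+1 z.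
Proof.
elim: s p i => // W s IH p [|i] [p' [_ Wp' h]] is_; last exact: IH h is_.
by case: s h is_ {IH} => // V s [p2 [Vp' _ _]] _; exists p'.
Qed.

(** * Ordered continua as limits of chains *)

Definition ordered_continuum (T : topologicalType) (K : set T) (le : T -> T -> Prop)
    (p q : T) : Prop :=
  [/\ [/\ compact K, connected K, K p & K q],
      (forall x y, K x -> K y -> le x y \/ le y x) /\
      (forall x y, K x -> K y -> le x y -> le y x -> x = y),
      forall x y z, K x -> K y -> K z -> le x y -> le y z -> le x z,
      forall x, K x -> closed [set y | K y /\ le x y] /\ closed [set y | K y /\ le y x] &
      forall x, K x -> le p x /\ le x q].

Section OrderedContinuum.
Variables (R : realType) (X : pseudoMetricType R).
Hypotheses (hX : hausdorff_space X) (cX : compact [set: X]).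
Hypotheses (lX : Defs.locally_connected X).

Lemma eq_of_balls (x y : X) n0 :
  (forall n, (n0 <= n)%N -> ball x (6 * n.+1%:R^-1)%R y) -> x = y.
Proof.
move=> h; apply: (close_eq hX); rewrite ball_close => e.
have e6 : (0 < e%:num / 6)%R by apply: divr_gt0.
have [n _ hn] := near_infty_natSinv_lt (PosNum e6).
have := hn (maxn n n0) (leq_maxl _ _) => /= lt.
apply: le_ball (h (maxn n n0) (leq_maxr _ _)).
by rewrite mulrC -ler_pdivlMr // ltW.
Qed.

Lemma dist_links (e : R) s (p q x y : X) i k : linked id p s q ->
  (forall j, (j < size s)%N -> exists a, nth set0 s j `<=` ball a e) ->
  (i + k < size s)%N -> nth set0 s i x -> nth set0 s (i + k) y ->
  ball x (k.+1%:R * (e + e))%R y.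
Proof.
move=> ls hs; elim: k y => [|k IH] y ks ix ky.
  have is_ : (i < size s)%N by rewrite addn0 in ks.
  have [a ha] := hs i is_; rewrite mul1r addn0 in ky *.
  by apply: (@ball_triangle _ _ a); [apply: ball_sym|]; apply: ha.
rewrite addnS in ks ky; have [z [z1 z2]] := linked_meet ls ks.
have [a ha] := hs _ ks.
rewrite -[k.+2]addn1 natrD mulrDl mul1r; apply: (@ball_triangle _ _ z).
  by apply: IH => //; apply: ltnW.
by apply: (@ball_triangle _ _ a); [apply: ball_sym|]; apply: ha.
Qed.

(** [K] is the intersection of successively refined chains whose links shrink to points, and [x]
    precedes [y] when in every chain some link of [x] comes no later than some link of [y].
    Simplicity determines the position of a point up to 1, so a failure of antisymmetry or
    transitivity forces two points to be arbitrarily close. *)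
Lemma ordered_continuum_exists (U : set X) p q :
  open U -> connected U -> U p -> U q ->
  exists K le, ordered_continuum K le p q /\ K `<=` U.
Proof.
move=> oU cU Up Uq.
have ch0 : chain p q [:: U].
  split=> // [|W]; first by exists q.
  by rewrite inE => /eqP->.
pose step (ns : nat * {s | chain p q s}) (s2 : {s | chain p q s}) :=
  refines (ns.1.+1%:R^-1 : R)%R (sval ns.2) (sval s2).
have [f hf] : {f & forall ns, step ns (f ns)}.
  apply: choice => -[n [s hs]]; rewrite /step /=.
  have n0 : (0 < n.+1%:R^-1 :> R)%R by rewrite invr_gt0.
  by have [s2 [h1 h2]] := refine_chain lX n0 hs; exists (exist _ s2 h1).
pose LL := nat_rect (fun _ => {s | chain p q s}) (exist _ _ ch0) (fun n s => f (n, s)).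
pose L n := sval (LL n).
have chL n : chain p q (L n) by exact: (svalP (LL n)).
have rL n : refines (n.+1%:R^-1 : R)%R (L n) (L n.+1) by exact: (hf (n, LL n)).
pose lk n i := nth set0 (L n) i.
pose ix n := [set i | (i < size (L n))%N].
have fix_ n (D : set nat) : D `<=` ix n -> finite_set D.
  by move=> h; apply: (sub_finite_set h); exact: finite_II.
pose C n := \bigcup_(i in ix n) closure (lk n i).
have clC n : closed (C n).
  by apply: closed_bigcup => [|i _]; [exact: (fix_ n)|exact: closed_closure].
have CS n x : C n.+1 x -> exists2 i, ix n i & lk n i x.
  case=> i is_ ix_; have [r [_ hr]] := rL n; have [h1 h2 _] := hr i is_.
  by exists (r i) => //; apply: h2.
have subC n i x : ix n i -> lk n i x -> C n x.
  by move=> ii xi; exists i => //; apply: subset_closure.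
have decC n : C n.+1 `<=` C n by move=> x /CS[i]; apply: subC.
have cC n : connected (C n).
  have [s0 ls _ oc] := chL n.
  have [cU' _] := linked_connected ls (fun W h => (oc W h).2).
  suff -> : C n = closure (\bigcup_(W in [set W | W \in L n]) W).
    exact: connected_closure.
  apply/seteqP; split=> [x [i ii]|].
    apply: closureS x => x xi; exists (lk n i) => //=; exact: mem_nth.
  rewrite [X in _ `<=` X](closure_id _).1 //; apply: closureS => x [W /= WL Wx].
  by apply: (@subC n (index W (L n))); rewrite /ix /lk /= ?index_mem // nth_index.
pose K := \bigcap_n C n.
have KL n x : K x -> exists2 i, ix n i & lk n i x by move=> Kx; apply: CS; apply: Kx.
pose rel n x y := exists i j, [/\ (i <= j)%N, ix n j, lk n i x & lk n j y].
pose crel n x y :=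
  exists i j, [/\ (i <= j)%N, ix n j, closure (lk n i) x & closure (lk n j) y].
pose le x y := forall n, rel n x y.
have rcrel n x y : rel n x y -> crel n x y.
  by case=> i [j [? ? ? ?]]; exists i, j; split=> //; apply: subset_closure.
(* The closure of a link lies inside a link of the previous chain. So links and their closures
   define the same [le], and the closures show its rays to be closed. *)
have crelS n x y : crel n.+1 x y -> rel n x y.
  case=> i [j [ij jj xi yj]]; have [r [mr hr]] := rL n.
  have ii : ix n.+1 i by exact: leq_ltn_trans ij jj.
  have [hi1 hi2 _] := hr i ii; have [hj1 hj2 _] := hr j jj.
  exists (r i), (r j); split; [exact: mr|exact: hj1|exact: hi2|exact: hj2].
have relmono n m x y : (n <= m)%N -> rel m x y -> rel n x y.
  elim: m => [|m IH]; first by rewrite leqn0 => /eqP->.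
  by rewrite leq_eqVlt => /orP[/eqP->//|/IH h /rcrel/crelS].
have leC x y : le x y <-> forall n, crel n x y.
  by split=> h n; [exact/rcrel|exact/crelS].
have adj n i j x : ix n j -> lk n i x -> lk n j x -> (j <= i.+1)%N.
  move=> jj xi xj; rewrite leqNgt; apply/negP => ij.
  have [_ _ sL _] := chL n; have := simple_nth set0 sL ij jj.
  by move=> /seteqP[/(_ x) h _]; apply: h.
(* Positions at most 2 apart span three links, each contained in a ball of radius 1/(n+1): this is
   the 6 = 3 * 2. *)
have dist n i j x y : (i <= j)%N -> (j <= i.+2)%N -> ix n.+1 j ->
    lk n.+1 i x -> lk n.+1 j y -> ball x (6 * n.+1%:R^-1)%R y.
  move=> ij ji jj xi yj; have [_ ls _ _] := chL n.+1; have [r [_ hr]] := rL n.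
  have hs k : (k < size (L n.+1))%N -> exists a, nth set0 (L n.+1) k `<=` ball a (n.+1%:R^-1 : R)%R.
    by move=> /hr[].
  have := @dist_links _ _ _ _ x y i (j - i) ls hs; rewrite subnKC // => /(_ jj xi yj).
  have -> : (n.+1%:R^-1 + n.+1%:R^-1 = 2%:R * n.+1%:R^-1 :> R)%R by rewrite mulrDl mul1r.
  apply: le_ball; rewrite mulrA ler_wpM2r ?invr_ge0 //.
  rewrite -natrM ler_nat (@leq_trans (3 * 2)) // leq_mul2r /=.
  by rewrite ltnS leq_subLR addn2.
have tot x y : K x -> K y -> le x y \/ le y x.
  move=> Kx Ky; have [|/existsNP[n nr]] := pselect (le x y); first by left.
  right=> m; have : rel (maxn n m) y x; last by apply: relmono; exact: leq_maxr.
  have [i ii xi] := KL (maxn n m) x Kx; have [j jj yj] := KL (maxn n m) y Ky.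
  have [ij|/ltnW ji] := leqP i j; last by exists j, i.
  by case: nr; apply: (relmono n (maxn n m)); [exact: leq_maxl|exists i, j].
have anti x y : K x -> K y -> le x y -> le y x -> x = y.
  move=> Kx Ky xy yx; apply: (@eq_of_balls _ _ 0) => n _.
  have [i [j [ij jj xi yj]]] := xy n.+1; have [k [l [kl ll yk xl]]] := yx n.+1.
  apply: (dist n i j) => //.
  have h1 := adj n.+1 i l x ll xi xl; have h2 := adj n.+1 k j y jj yk yj.
  by apply: (leq_trans h2); rewrite ltnS; apply: leq_trans kl _.
have trans x y z : K x -> K y -> K z -> le x y -> le y z -> le x z.
  move=> Kx Ky Kz xy yz; apply: contrapT => /existsNP[n0 nr].
  (* Once the relation fails at [n0], every later level has [z] before [x], while the links of [y]
     keep the two positions within 1. *)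
  suff e : z = x by apply: nr; rewrite e; have [i ii xi] := KL n0 x Kx; exists i, i.
  apply: (@eq_of_balls _ _ n0) => n n0n.
  have [i [j [ij jj xi yj]]] := xy n.+1; have [k [l [kl ll yk zl]]] := yz n.+1.
  have li : (l < i)%N.
    rewrite ltnNge; apply/negP => il; apply: nr; apply: (relmono _ n.+1).
      exact: leq_trans n0n _.
    by exists i, l.
  have h := adj n.+1 k j y jj yk yj.
  apply: (dist n l i) => //; first exact: ltnW.
    by apply: leq_trans ij (leq_trans h _); rewrite ltnS; apply: leqW.
  exact: leq_ltn_trans ij jj.
exists K, le; split; last first.
  by move=> x Kx; have [i] := KL 0%N x Kx; rewrite /ix /lk /=; case: i.
have Kp : K p.
  move=> n _; have [s0 ls _ _] := chL n; apply: (@subC n 0%N).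
    by rewrite /ix /=; case: (L n) s0.
  exact: linked_first ls.
have Kq : K q.
  move=> n _; have [s0 ls _ _] := chL n; apply: (@subC n (size (L n)).-1).
    by rewrite /ix /=; case: (L n) s0.
  exact: linked_end ls.
have clK : closed K by apply: closed_bigI.
split.
- split=> //; first exact: subclosed_compact cX _.
  exact: nested_connected.
- by [].
- by [].
- move=> x Kx; split.
    rewrite (_ : [set _ | _] = K `&` \bigcap_n
        \bigcup_(j in [set j | ix n j /\ exists2 i, (i <= j)%N & closure (lk n i) x])
          closure (lk n j)).
      apply: closedI => //; apply: closed_bigI => n _.
      apply: closed_bigcup => [|j _]; last exact: closed_closure.
      by apply: (fix_ n) => j [].
    apply/seteqP; split=> [y [Ky /leC xy]|y [Ky h]]; split=> //.
      by move=> n _; have [i [j [ij jj xi yj]]] := xy n; exists j => //; split=> //; exists i.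
    apply/leC => n; have [j [jj [i ij xi]] yj] := h n I.
    by exists i, j.
  rewrite (_ : [set _ | _] = K `&` \bigcap_n
      \bigcup_(i in [set i | ix n i /\ exists j, [/\ (i <= j)%N, ix n j & closure (lk n j) x]])
        closure (lk n i)).
    apply: closedI => //; apply: closed_bigI => n _.
    apply: closed_bigcup => [|j _]; last exact: closed_closure.
    by apply: (fix_ n) => j [].
  apply/seteqP; split=> [y [Ky /leC xy]|y [Ky h]]; split=> //.
    move=> n _; have [i [j [ij jj yi xj]]] := xy n; exists i => //; split.
      exact: leq_ltn_trans ij jj.
    by exists j.
  apply/leC => n; have [i [ii [j [ij jj xj]]] yi] := h n I.
  by exists i, j.
move=> x Kx; split=> n; have [i ii xi] := KL n x Kx.
  exists 0%N, i; split=> //; have [s0 ls _ _] := chL n; exact: linked_first ls.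
have [s0 ls _ _] := chL n; exists i, (size (L n)).-1; split=> //.
- by rewrite -ltnS prednK; [exact: ii|case: (L n) s0].
- by rewrite /ix /=; case: (L n) s0.
- exact: linked_end ls.
Qed.

End OrderedContinuum.

Local Open Scope ring_scope.

(** * Separating functions and running maxima *)

Lemma countable_basis (R : realType) (X : pseudoMetricType R) :
  compact [set: X] ->
  exists B : nat -> set X, (forall n, open (B n)) /\
    forall x V, open V -> V x -> exists n, B n x /\ B n `<=` V.
Proof.
move=> cX; have [[x0 _]|X0] := pselect ([set: X] !=set0); last first.
  exists (fun _ => set0); split=> [n|x]; first exact: open0.
  by exfalso; apply: X0; exists x.
pose Y : pseudoPMetricType R := HB.pack_for (pseudoPMetricType R) X (isPointed.Build X x0).
have [D cD [oD bD]] := @compact_second_countable R Y cX.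
have [f injf] := countable_injP _ cD.
pose B n := xget set0 [set U : set Y | D U /\ f U = n].
have Bf U : D U -> B (f U) = U.
  move=> DU; have [D' fe] : [set V : set Y | D V /\ f V = f U] (B (f U)).
    by apply: xgetPex; exists U.
  by apply: injf => //; exact/mem_set.
exists B; split=> [n|x V oV Vx].
  by rewrite /B; case: xgetP => [U _ [/oD oU _]|_]; [exact: oU|exact: (@open0 X)].
have [U [DU Ux UV]] := bD x V (open_nbhs_nbhs (conj oV Vx)).
exists (f U); rewrite Bf //; split=> //; exact: nbhs_singleton Ux.
Qed.

(** These are the Urysohn functions for the complement of [B i] and the closure of [B j], over all
    pairs of basic open sets; regularity fits such a pair between [x] and [F]. *)
Lemma separating_functions (R : realType) (X : pseudoMetricType R) :
  compact [set: X] ->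
  exists h : nat -> X -> R, [/\ forall n, continuous (h n),
    forall n x, 0 <= h n x <= 1 &
    forall F x, closed F -> ~ F x ->
      exists n, h n x = 1 /\ forall y, F y -> h n y = 0].
Proof.
move=> cX; have [B [oB bB]] := countable_basis cX.
pose h n : X -> R := let ij := odflt (0, 0)%N (unpickle n) in
  Urysohn (~` B ij.1) (closure (B ij.2)).
exists h; split=> [n|n x|F x cF Fx].
- exact: Urysohn_continuous.
- have /= := @Urysohn_range X R _ _ (h n x) (imageT (h n) x).
  by rewrite in_itv.
have [i [Bi BiF]] := bB x (~` F) (closed_openC cF) Fx.
have /= [U Ux UB] := @uniform_regular X x (B i) (open_nbhs_nbhs (conj (oB i) Bi)).
have [|j [Bj BjU]] := bB x U^° (open_interior _); first exact: Ux.
exists (pickle (i, j)); rewrite /h pickleK /=.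
have us : uniform_separator (~` B i) (closure (B j)).
  have /(@normal_separatorP R) := @pseudometric_normal R X; apply.
  - exact: open_closedC.
  - exact: closed_closure.
  apply/seteqP; split=> // y [nB cB]; apply: nB; apply: UB.
  by apply: closureS cB; apply: subset_trans BjU _; exact: interior_subset.
split.
  apply: (Urysohn_sub1 (R := R) us); exists x => //; exact: subset_closure.
by move=> y Fy; apply: (Urysohn_sub0 (R := R) us); exists y => // /BiF.
Qed.

(** The parts of [F] below its own points are closed and form a filter base, so by compactness they
    have a common point. *)
Lemma ordered_least (T : topologicalType) (K : set T) le p q (F : set T) :
  ordered_continuum K le p q -> closed F -> F `<=` K -> F !=set0 ->
  exists2 z, F z & forall y, F y -> le z y.
Proof.
move=> [[cK _ _ _] [tot _] trans cl _] cF FK [x0 Fx0].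
pose G := filter_from F (fun x => F `&` [set y | K y /\ le y x]).
have refl x : K x -> le x x by move=> Kx; case: (tot x x Kx Kx).
have FG : ProperFilter G.
  apply: filter_from_proper; last first.
    by move=> x Fx; exists x; split=> //; split; [exact: FK|exact/refl/FK].
  apply: filter_from_filter; first by exists x0.
  move=> i j Fi Fj; have [ij|ji] := tot i j (FK _ Fi) (FK _ Fj).
    exists i => // x [Fx [Kx xi]]; split; split=> //; split=> //.
    by apply: (trans x i j) => //; exact: FK.
  exists j => // x [Fx [Kx xj]]; split; split=> //; split=> //.
  by apply: (trans x j i) => //; exact: FK.
have [|z [_ cz]] := cK G FG; first by exists x0 => // y [/FK].
have clz x : F x -> F z /\ K z /\ le z x.
  move=> Fx; have : closed (F `&` [set y | K y /\ le y x]).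
    by apply: closedI => //; have [] := cl x (FK _ Fx).
  by move=> /(_ z); apply => A /(cz _ A); apply; exists x.
have [Fz _] := clz _ Fx0.
by exists z => // y /clz[_ []].
Qed.

Lemma ordered_closed (T : topologicalType) (K : set T) le p q :
  ordered_continuum K le p q -> closed K.
Proof.
move=> [[_ _ Kp _] _ _ cl least]; have [+ _] := cl p Kp.
rewrite (_ : [set _ | _] = K) //; apply/seteqP; split=> x; first by case.
by move=> Kx; split=> //; have [] := least x Kx.
Qed.

Section RunningMax.
Variables (R : realType) (X : pseudoMetricType R) (K : set X) (le : X -> X -> Prop).
Variables (p q : X) (oK : ordered_continuum K le p q) (h : X -> R).
Hypotheses (ch : continuous h) (h01 : forall x, 0 <= h x <= 1).

(** The largest value of [h] met so far along [K]: it trades injectivity for monotonicity, and both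
    are recovered by summing over many [h]. *)
Definition runmax (x : X) : R := sup [set h y | y in [set y | K y /\ le y x]].

Lemma ordered_refl x : K x -> le x x.
Proof. by move=> Kx; case: oK => _ [tot _] _ _ _; case: (tot x x Kx Kx). Qed.

Lemma runmax_has_sup x : K x -> has_sup [set h y | y in [set y | K y /\ le y x]].
Proof.
move=> Kx; split; first by exists (h x), x => //; split=> //; exact: ordered_refl.
by exists 1 => _ [y _ <-]; case/andP: (h01 y).
Qed.

Lemma runmax_ub x y : K x -> K y -> le y x -> h y <= runmax x.
Proof.
move=> Kx Ky yx; apply: ub_le_sup; last by exists y.
by case: (runmax_has_sup Kx).
Qed.

Lemma runmax_le x c : K x -> (forall y, K y -> le y x -> h y <= c) -> runmax x <= c.
Proof.
move=> Kx hc; apply: ge_sup; first by case: (runmax_has_sup Kx).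
by move=> _ [y [Ky yx] <-]; exact: hc.
Qed.

Lemma runmax_mono x y : K x -> K y -> le x y -> runmax x <= runmax y.
Proof.
move=> Kx Ky xy; apply: runmax_le => // z Kz zx; apply: runmax_ub => //.
by case: oK => _ _ trans _ _; exact: (trans z x y).
Qed.

Lemma runmax_01 x : K x -> 0 <= runmax x <= 1.
Proof.
move=> Kx; apply/andP; split.
  apply: le_trans (runmax_ub Kx Kx (ordered_refl Kx)).
  by case/andP: (h01 x).
by apply: runmax_le => // y _ _; case/andP: (h01 y).
Qed.

Lemma runmax_continuous : {within K, continuous runmax}.
Proof.
have [_ [tot anti] trans cl _] := oK.
apply/subspace_continuousP => x Kx; apply/cvgrPdist_lt => e e0.
rewrite near_withinE.
have [y [Ky yx] hy] : exists2 y, K y /\ le y x & runmax x - e < h y.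
  have := sup_adherent e0 (runmax_has_sup Kx).
  by move=> [_ [y Kyx <-]]; exists y.
pose F := K `&` h @^-1` [set r | runmax x + e / 2 <= r].
have cF : closed F.
  apply: closedI; first exact: ordered_closed oK.
  by apply: preimage_closed => //; exact: closed_ge.
(* The first point [z] at which [h] exceeds the running maximum by e/2 comes strictly after [x], and
   so do not the points close to [x] come after [z]. *)
have up : \forall z \near x, K z -> runmax z < runmax x + e.
  have e2 : runmax x + e / 2 < runmax x + e by rewrite ltrD2l ltr_pdivrMr // ltr_pMr // ltr1n.
  have [F0|/forallNP F0] := pselect (F !=set0); last first.
    near=> z => Kz; apply: le_lt_trans e2; apply: runmax_le => // w Kw _.
    by rewrite leNgt; apply/negP => lt; apply: (F0 w); split=> //; exact: ltW.
  have [z Fz hz] := ordered_least oK cF (@subIsetl _ _ _) F0.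
  have [cz _] := cl z (proj1 Fz).
  have nzx : ~ (K x /\ le z x).
    move=> [_ zx]; have := runmax_ub Kx (proj1 Fz) zx.
    rewrite leNgt => /negP; apply; apply: lt_le_trans (proj2 Fz).
    by rewrite ltrDl divr_gt0.
  have : nbhs x (~` [set y | K y /\ le z y]).
    by apply: open_nbhs_nbhs; split=> //; exact: closed_openC.
  apply: filterS => w nw Kw; apply: le_lt_trans e2; apply: runmax_le => // v Kv vw.
  rewrite leNgt; apply/negP => lt; apply: nw; split=> //.
  apply: (trans z v w) => //; first by case: Fz.
  by apply: hz; split=> //; exact: ltW.
(* The nearly maximal point [y] is either [x], where continuity of [h] decides, or strictly earlier,
   and then points close to [x] still come after it. *)
have down : \forall z \near x, K z -> runmax x - e < runmax z.
  have [eyx|nyx] := pselect (y = x).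
    have : \forall z \near x, runmax x - e < h z.
      have oU : open (h @^-1` [set r | runmax x - e < r]).
        by apply: open_comp => [? _|]; [exact: ch|exact: open_gt].
      by apply: (open_nbhs_nbhs (conj oU _)); rewrite /preimage /= -{2}eyx.
    apply: filterS => z lt Kz; apply: lt_le_trans lt _.
    exact: runmax_ub (ordered_refl Kz).
  have [_ cy] := cl y Ky.
  have : nbhs x (~` [set z | K z /\ le z y]).
    apply: open_nbhs_nbhs; split; first exact: closed_openC.
    by move=> [_ xy]; apply: nyx; exact: anti.
  apply: filterS => z nz Kz; apply: lt_le_trans hy _; apply: runmax_ub => //.
  by have [//|zy] := tot y z Ky Kz; case: nz.
near=> z => Kz; rewrite ltr_distlC.
apply/andP; split; [by apply: (near down z)|by apply: (near up z)].
Unshelve. all: by end_near. Qed.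

End RunningMax.

(* [phi] is the sum of [2^-(n+1) * runmax (h n)] for separating functions [h n]:
   running maxima are monotone along [K], and for [x] before [y] some [h n]
   vanishes up to [x] but not at [y]. *)
Lemma ordered_param (R : realType) (X : pseudoMetricType R) (K : set X) le p q :
  compact [set: X] -> ordered_continuum K le p q ->
  exists phi : X -> R, {within K, continuous phi} /\
    forall x y, K x -> K y -> le x y -> x <> y -> phi x < phi y.
Proof.
move=> cX oK; have [h [ch h01 hsep]] := separating_functions cX.
pose m n := runmax K le (h n).
have m01 n x : K x -> 0 <= m n x <= 1 by exact: (runmax_01 oK (h01 n)).
pose u n : R := 1 / 2 ^+ n.
have u_gt0 n : 0 < u n by rewrite divr_gt0 // exprn_gt0.
have uS n : u n = u n.+1 + u n.+1.
  by rewrite /u exprS invfM !mul1r -mulrDl; field.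
pose S N x := \sum_(n < N) u n.+1 * m n x.
have SS N x : S N.+1 x = S N x + u N.+1 * m N x by rewrite /S big_ord_recr.
have mono N x y : K x -> K y -> le x y -> S N x <= S N y.
  move=> Kx Ky xy; apply: ler_sum => n _; apply: ler_wpM2l; first exact: ltW.
  exact: (runmax_mono oK (h01 n)).
(* The weights from index [N] on add up to [u N], so the partial sums approximate [phi] uniformly on
   [K]. *)
have Sle N M x : K x -> (N <= M)%N -> S N x <= S M x <= S N x + (u N - u M).
  move=> Kx; elim: M => [|M IH]; first by rewrite leqn0 => /eqP->; rewrite subrr addr0 lexx.
  rewrite leq_eqVlt => /orP[/eqP->|/IH]; first by rewrite subrr addr0 lexx.
  move=> /andP[h1 h2]; have /andP[m0 m1] := m01 M x Kx; have u0 := u_gt0 M.+1.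
  have a0 : 0 <= u M.+1 * m M x by apply: mulr_ge0 => //; exact: ltW.
  have a1 : u M.+1 * m M x <= u M.+1 by rewrite ger_pMr.
  by have := uS M; rewrite SS => e; apply/andP; split; lra.
pose phi x := sup [set S N x | N in [set: nat]].
have Sub x N : K x -> S N x <= phi x.
  move=> Kx; apply: ub_le_sup; last by exists N.
  exists 1 => _ [M _ <-]; have /andP[_] := Sle 0%N M x Kx (leq0n _).
  have := u_gt0 M; rewrite /S big_ord0 /u expr0 divr1 => ? ?; lra.
have phi_le x c : (forall N, S N x <= c) -> phi x <= c.
  move=> hc; apply: ge_sup; first by exists (S 0%N x), 0%N.
  by move=> _ [N _ <-].
have phi_ub x N : K x -> phi x <= S N x + u N.
  move=> Kx; apply: phi_le => M; have [NM|/ltnW MN] := leqP N M.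
    by have /andP[_ ?] := Sle N M x Kx NM; have := u_gt0 M; lra.
  by have /andP[? _] := Sle M N x Kx MN; have := u_gt0 N; lra.
exists phi; split; last first.
  move=> x y Kx Ky xy nxy; have [_ [_ anti] _ cl _] := oK.
  have [_ cx] := cl x Kx.
  have [|n [hy1 hx0]] := hsep _ y cx; first by move=> [_ yx]; apply: nxy; exact: anti.
  have mx : m n x <= 0 by apply: (runmax_le oK (h01 n)) => // z Kz zx; rewrite hx0.
  have my : 1 <= m n y.
    by rewrite -hy1; apply: (runmax_ub oK (h01 n)) => //; exact: (ordered_refl oK).
  have lt : S n.+1 x + u n.+1 <= S n.+1 y.
    rewrite !SS; have := mono n x y Kx Ky xy; have u0 := u_gt0 n.+1.
    have : u n.+1 * m n x <= 0 by rewrite pmulr_rle0.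
    have : u n.+1 <= u n.+1 * m n y by rewrite ler_peMr // ltW.
    lra.
  (* The gain [u n.+1] made at index [n] is never lost, as all later summands are monotone. *)
  have key N : S N x + u n.+1 <= phi y.
    have [/leqW Nn|nN] := leqP N n.
      apply: le_trans (Sub y n.+1 Ky); apply: le_trans lt; rewrite lerD2r.
      by have /andP[] := Sle N n.+1 x Kx Nn.
    apply: le_trans (Sub y N Ky); elim: N nN => // N IH.
    rewrite ltnS leq_eqVlt => /orP[/eqP<-//|/IH le1].
    rewrite !SS addrAC; apply: lerD => //.
    by rewrite ler_pM2l //; exact: (runmax_mono oK (h01 N)).
  have : phi x <= phi y - u n.+1 by apply: phi_le => N; have := key N; lra.
  have := u_gt0 n.+1; lra.
have cS N : {within K, continuous (S N)}.
  apply/subspace_continuousP => x Kx; elim: N => [|N IH].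
    rewrite (_ : S 0%N = fun=> 0); first exact: cvg_cst.
    by apply/funext => z; rewrite /S big_ord0.
  rewrite (_ : S N.+1 = fun z => S N z + u N.+1 * m N z); last first.
    by apply/funext => z; exact: SS.
  apply: cvgD => //; apply: cvgMr.
  have /subspace_continuousP := runmax_continuous oK (ch N) (h01 N).
  exact.
apply/subspace_continuousP => x Kx.
suff close (e : R) : 0 < e -> \forall z \near within K (nbhs x), `|phi x - phi z| < e.
  by apply/cvgrPdist_lt => e; exact: close.
move=> e0; have e2 : 0 < e / 2 by rewrite divr_gt0.
have [N _ hN] := near_infty_natSinv_expn_lt (PosNum e2).
have uN : u N < e / 2 by apply: hN => /=.
have /subspace_continuousP/(_ x Kx)/cvgrPdist_lt/(_ _ e2) := cS N.
rewrite !near_withinE; apply: filterS => z lt Kz; have {}lt := lt Kz.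
have := Sub x N Kx; have := Sub z N Kz; have := phi_ub x N Kx; have := phi_ub z N Kz.
move: lt; rewrite /from_subspace !ltr_norml => /andP[? ?] ? ? ? ?; apply/andP; split; lra.
Qed.

(** * Arcs *)

Definition is_arc (R : realType) (T : topologicalType) (a : R -> T) (p q : T) : Prop :=
  [/\ continuous a, (forall s t : R, 0 <= s <= 1 -> 0 <= t <= 1 -> a s = a t -> s = t),
      a 0 = p & a 1 = q].

(** [phi] maps [K] bijectively onto an interval, and the arc is its inverse after rescaling.
    Clamping the parameter by [g] defines it on the whole line; compactness of [K] makes it
    continuous. *)
Lemma arc_exists (R : realType) (X : pseudoMetricType R) (U : set X) p q :
  hausdorff_space X -> compact [set: X] -> Defs.locally_connected X ->
  open U -> connected U -> U p -> U q -> p <> q ->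
  exists a : R -> X, is_arc a p q /\ forall t, U (a t).
Proof.
move=> hX cX lX oU cU Up Uq npq.
have [K [le [oK KU]]] := ordered_continuum_exists hX cX lX oU cU Up Uq.
have [phi [cphi inc]] := ordered_param cX oK.
have clK := ordered_closed oK.
have [[cK conK Kp Kq] [tot anti] _ _ least] := oK.
have inj x y : K x -> K y -> phi x = phi y -> x = y.
  move=> Kx Ky e; apply: contrapT => n.
  have [xy|yx] := tot x y Kx Ky; first by have := inc x y Kx Ky xy n; rewrite e ltxx.
  by have := inc y x Ky Kx yx (nesym n); rewrite e ltxx.
have lt : phi p < phi q by apply: inc => //; have [] := least q Kq.
pose g (t : R) : R := Num.max 0 (Num.min 1 t).
pose d t := phi p + g t * (phi q - phi p).
have g01 t : 0 <= g t <= 1 by rewrite /g le_max ge_max ge_min lexx ler01 /= lexx.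
have gid t : 0 <= t <= 1 -> g t = t.
  by move=> /andP[t0 t1]; rewrite /g (min_idPr t1) (max_idPr t0).
have img t : exists x, K x /\ phi x = d t.
  have /connected_intervalP iI := connected_continuous_connected conK cphi.
  have [|x Kx e] := iI (phi p) (phi q) (imageP phi Kp) (imageP phi Kq) (d t); last by exists x.
  by have /andP[? ?] := g01 t; rewrite /d; apply/andP; split; nra.
have [a ha] := choice img.
have aP t : K (a t) by have [] := ha t.
have ad t : phi (a t) = d t by have [] := ha t.
have aE x t : K x -> phi x = d t -> a t = x by move=> Kx e; apply: inj; rewrite ?ad.
have d0 : d 0 = phi p by rewrite /d gid ?lexx ?ler01 // mul0r addr0.
have d1 : d 1 = phi q by rewrite /d gid ?lexx ?ler01 // mul1r addrC subrK.
have cg : continuous g.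
  move=> t; have -> : g = (fun=> 0) \max ((fun=> 1) \min id) by [].
  apply: (@continuous_max R R); first exact: cst_continuous.
  by apply: (@continuous_min R R); [exact: cst_continuous|].
have cd : continuous d.
  by move=> t; apply: cvgD; [exact: cvg_cst|apply: cvgMl; exact: cg].
exists a; split; last by move=> t; apply: KU.
split.
- apply/continuous_closedP => C cC.
  have : closed (phi @` (K `&` C)).
    apply: compact_closed; first exact: Rhausdorff.
    apply: continuous_compact; first by apply: continuous_subspaceW cphi => x [].
    by apply: compact_closedI.
  move=> /(@preimage_closed _ _ d _ _); rewrite (_ : d @^-1` _ = a @^-1` C).
    by apply => t _; apply: cd.
  apply/seteqP; split=> t /=; first by move=> [x [Kx Cx] e]; rewrite (aE x).
  by move=> Ct; exists (a t).
- move=> s t s01 t01 e; have := ad s; rewrite e ad /d !gid // => e'.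
  have : (t - s) * (phi q - phi p) = 0 by lra.
  by move=> /eqP; rewrite mulf_eq0 !subr_eq0 (gt_eqF lt) orbF => /eqP.
- by apply: aE => //; rewrite d0.
- by apply: aE => //; rewrite d1.
Qed.

(** * Sides of points in a dendrite *)

(* Each half of the circle is parametrised by its first coordinate. *)
Lemma circle_of_arcs (R : realType) (T : topologicalType) (a b : R -> T) :
  continuous a -> continuous b ->
  (forall s t : R, -1 <= s <= 1 -> -1 <= t <= 1 -> a s = a t -> s = t) ->
  (forall s t : R, -1 <= s <= 1 -> -1 <= t <= 1 -> b s = b t -> s = t) ->
  a (-1) = b (-1) -> a 1 = b 1 ->
  (forall s t : R, -1 <= s <= 1 -> -1 < t < 1 -> a s <> b t) ->
  has_simple_closed_curve R T.
Proof.
move=> ca cb ia ib e0 e1 dab.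
pose g (p : R * R) : T := if 0 <= p.2 then a p.1 else b p.1.
have cfst : continuous (fst : R * R -> R) by move=> p; exact: cvg_fst.
have csnd : continuous (snd : R * R -> R) by move=> p; exact: cvg_snd.
have bound (p : R * R) : @unit_circle R p -> -1 <= p.1 <= 1.
  by rewrite /unit_circle /= => e; apply/andP; split; nra.
exists g; split.
  have clc : closed (@unit_circle R).
    have -> : @unit_circle R = (fun p : R * R => p.1 * p.1 + p.2 * p.2) @^-1` [set 1] by [].
    apply: preimage_closed => [p _|]; last exact: closed_eq.
    by apply: cvgD; apply: cvgM; (exact: cfst || exact: csnd).
  have -> : @unit_circle R =
      (@unit_circle R `&` snd @^-1` [set y | 0 <= y]) `|`
      (@unit_circle R `&` snd @^-1` [set y | y <= 0]).
    apply/seteqP; split=> [p cp|p [[]|[]]] //.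
    by have [h|/ltW h] := leP 0 p.2; [left|right].
  apply: withinU_continuous.
  - by apply: closedI => //; apply: preimage_closed => [p _|]; [exact: csnd|exact: closed_ge].
  - by apply: closedI => //; apply: preimage_closed => [p _|]; [exact: csnd|exact: closed_le].
  - apply: (@subspace_eq_continuous _ _ _ (a \o fst)).
      by move=> p /set_mem[_ /= h]; rewrite /from_subspace /g h.
    by apply: continuous_subspaceT => p; apply: continuous_comp; [exact: cfst|exact: ca].
  apply: (@subspace_eq_continuous _ _ _ (b \o fst)).
    move=> p /set_mem[cp /= h]; rewrite /from_subspace /g /=; case: leP => // h'.
    have p2 : p.2 = 0 by apply/eqP; rewrite eq_le h h'.
    have /eqP : (p.1 - 1) * (p.1 + 1) = 0.
      by move: cp; rewrite /unit_circle /= p2 => e; rewrite -subr_sqr; lra.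
    by rewrite mulf_eq0 subr_eq0 addr_eq0 => /orP[]/eqP->.
  by apply: continuous_subspaceT => p; apply: continuous_comp; [exact: cfst|exact: cb].
have sq (p p' : R * R) : @unit_circle R p -> @unit_circle R p' -> p.1 = p'.1 ->
    p.2 ^+ 2 = p'.2 ^+ 2.
  by rewrite /unit_circle /= => cp cp' e; rewrite e in cp; lra.
have strict (p : R * R) : @unit_circle R p -> p.2 < 0 -> -1 < p.1 < 1.
  by rewrite /unit_circle /= => e h; apply/andP; split; nra.
move=> p p' /set_mem cp /set_mem cp'; have bp := bound p cp; have bp' := bound p' cp'.
rewrite [p]surjective_pairing [p']surjective_pairing /g /=.
case: leP => h; case: leP => h' e.
- have e' := ia _ _ bp bp' e; have := sq p p' cp cp' e'.
  by move/eqP; rewrite eqrXn2 // => /eqP->; rewrite e'.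
- by case: (dab p.1 p'.1 bp (strict p' cp' h')).
- by case: (dab p'.1 p.1 bp' (strict p cp h)).
have e' := ib _ _ bp bp' e; have := sq p p' cp cp' e'.
rewrite -sqrrN -(sqrrN p'.2) => /eqP; rewrite eqrXn2 ?oppr_ge0 ?ltW // eqr_opp => /eqP->.
by rewrite e'.
Qed.

Lemma closed_max (R : realType) (E : set R) (c : R) :
  closed E -> E !=set0 -> (forall x, E x -> x <= c) ->
  exists2 m, E m & forall x, E x -> x <= m.
Proof.
move=> cE E0 Ec; have ub : has_ubound E by exists c.
exists (sup E); first by have := closure_sup E0 ub; rewrite -(closure_id E).1.
by move=> x Ex; exact: ub_le_sup.
Qed.

Lemma closed_min (R : realType) (E : set R) (c : R) :
  closed E -> E !=set0 -> (forall x, E x -> c <= x) ->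
  exists2 m, E m & forall x, E x -> m <= x.
Proof.
move=> cE [x0 Ex0] Ec.
have [|||m Em hm] := @closed_max R ((@GRing.opp R) @^-1` E) (- c).
- by apply: preimage_closed => // x _; exact: opp_continuous.
- by exists (- x0); rewrite /preimage /= opprK.
- by move=> x /Ec; rewrite lerNr.
by exists (- m) => // x Ex; rewrite lerNl; apply: hm; rewrite /preimage /= opprK.
Qed.

Section ArcBasics.
Variables (R : realType) (T : topologicalType) (a : R -> T).
Hypotheses (ca : continuous a).

Lemma image_itv_connected (s t : R) : connected (a @` `[s, t]).
Proof.
apply: connected_continuous_connected; first exact: segment_connected.
exact: continuous_subspaceT.
Qed.

Lemma image_itv_closed (s t : R) : hausdorff_space T -> closed (a @` `[s, t]).
Proof.
move=> hT; apply: compact_closed => //; apply: continuous_compact.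
  exact: continuous_subspaceT.
exact: segment_compact.
Qed.

End ArcBasics.

(** Empty for [x = c], so that [side c x y] already says that neither [x] nor [y] is [c]. *)
Definition side (T : topologicalType) (c x : T) : set T :=
  connected_component (~` [set c]) x.

Section Dendrite.
Variables (R : realType) (X : pseudoMetricType R).
Hypothesis dX : dendrite X.

Let hX : hausdorff_space X. Proof. by case: dX. Qed.
Let cX : compact [set: X]. Proof. by case: dX. Qed.
Let lX : Defs.locally_connected X. Proof. by case: dX => _ _ _ _ []. Qed.
Let ncX : ~ @has_simple_closed_curve R X. Proof. by case: dX => _ _ _ _ []. Qed.

Lemma closed_pt (x : X) : closed [set x].
Proof. exact/accessible_closed_set1/hausdorff_accessible. Qed.

Lemma open_setC1 (x : X) : open (~` [set x]).
Proof. exact/closed_openC/closed_pt. Qed.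

Lemma open_side (c x : X) : open (side c x).
Proof. by apply: open_component => //; exact: open_setC1. Qed.

Lemma side_refl (c x : X) : x <> c -> side c x x.
Proof. by move=> xc; exact: connected_component_refl. Qed.

Lemma side_neq (c x y : X) : side c x y -> y <> c.
Proof. by move/(@connected_component_sub X). Qed.

Lemma side_neql (c x y : X) : side c x y -> x <> c.
Proof. by move/connected_component_sym/side_neq. Qed.

Lemma side_sub (Z : set X) c x : connected Z -> ~ Z c -> Z x -> Z `<=` side c x.
Proof.
by move=> cZ Zc Zx; apply: connected_component_max => // y Zy e; rewrite e in Zy.
Qed.

Lemma side_of_arc (a : R -> X) p q (t s : R) (x y : R) : is_arc a p q ->
  0 <= t <= 1 -> 0 <= x -> x <= y -> y <= 1 -> (t < x) || (y < t) ->
  x <= s <= y -> forall s', x <= s' <= y -> side (a t) (a s) (a s').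
Proof.
move=> [ca ia _ _] t01 x0 xy y1 out sxy s' sxy'.
apply: (side_sub (Z := a @` `[x, y])).
- exact: image_itv_connected.
- move=> [u]; rewrite /= in_itv /= => /andP[xu uy] e.
  have : u = t by apply: ia => //; apply/andP; split; lra.
  by case/orP: out => ?; lra.
- by exists s => //=; rewrite in_itv.
by exists s' => //=; rewrite in_itv.
Qed.

(* Otherwise a second arc [b] from [p] to [q] avoids [a t]; between its last
   point on [a [0, t]] and its next point on [a [t, 1]] it closes up a circle. *)
Lemma arc_separates (a : R -> X) p q (t : R) :
  is_arc a p q -> 0 < t < 1 -> ~ side (a t) p q.
Proof.
move=> aa /andP[t0 t1] spq; have [ca ia a0 a1] := aa.
have tt : 0 <= t <= 1 by apply/andP; split; lra.
have npq : p <> q.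
  move=> e; have : (0 : R) = 1 by apply: ia; rewrite ?lexx ?ler01 // a0 a1.
  lra.
have pc : p <> a t by exact: side_neql spq.
have [b [[cb ib b0 b1] bU]] := @arc_exists R X (side (a t) p) p q hX cX lX
  (open_side _ _) (@component_connected X _ p) (side_refl pc) spq npq.
have bt s : b s <> a t by exact: side_neq (bU s).
have cl01 : closed (`[0, 1] : set R) by exact: interval_closed.
have [|||u [u01 [s0 s0t e0]] umax] := @closed_max R (`[0, 1] `&` b @^-1` (a @` `[0, t])) 1.
- apply: closedI => //; apply: preimage_closed => [? _|]; [exact: cb|].
  exact: image_itv_closed.
- exists 0; split; first by rewrite /= in_itv /= lexx ler01.
  by exists 0; rewrite /= ?in_itv /= ?lexx ?(ltW t0) // b0.
- by move=> x [/=]; rewrite in_itv /= => /andP[].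
have [|||v [/= uv1 [s1 s1t e1]] vmin] := @closed_min R (`[u, 1] `&` b @^-1` (a @` `[t, 1])) u.
- apply: closedI; first exact: interval_closed.
  by apply: preimage_closed => [? _|]; [exact: cb|exact: image_itv_closed].
- move: u01; rewrite /= in_itv /= => /andP[u0 u1].
  exists 1; split; first by rewrite /= in_itv /= lexx u1.
  by exists 1; rewrite /= ?in_itv /= ?lexx ?(ltW t1) // b1.
- by move=> x [/=]; rewrite in_itv /= => /andP[].
move: u01 s0t s1t uv1; rewrite /= !in_itv /= => /andP[u0 u1] /andP[s00 s0t] /andP[ts1 s11] /andP[uv v1].
have s0lt : s0 < t.
  by rewrite lt_neqAle s0t andbT; apply/eqP => e; case: (bt u); rewrite -e0 e.
have s1lt : t < s1.
  by rewrite lt_neqAle ts1 andbT; apply/eqP => e; case: (bt v); rewrite -e1 -e.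
have uvlt : u < v.
  rewrite lt_neqAle uv andbT; apply/eqP => e.
  have : s0 = s1 by apply: ia; [apply/andP; split; lra|apply/andP; split; lra|rewrite e0 e1 e].
  lra.
(* The affine map of [-1, 1] onto the interval from [x] to [y], matching the parametrisation of the
   two half circles. *)
pose f (x y z : R) := x + (z + 1) / 2 * (y - x).
have cf x y : continuous (f x y).
  move=> z; apply: cvgD; first exact: cvg_cst.
  apply: cvgMl; apply: cvgMl; apply: cvgD; [exact: cvg_id|exact: cvg_cst].
have f0 x y : f x y (-1) = x by rewrite /f addNr mul0r mul0r addr0.
have f1 x y : f x y 1 = y by rewrite /f; field.
have fb x y z : x <= y -> -1 <= z <= 1 -> x <= f x y z <= y.
  by move=> xy /andP[? ?]; rewrite /f; apply/andP; split; nra.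
have fs x y z : x < y -> -1 < z < 1 -> x < f x y z < y.
  by move=> xy /andP[? ?]; rewrite /f; apply/andP; split; nra.
have fi x y z z' : x < y -> f x y z = f x y z' -> z = z'.
  move=> xy; rewrite /f => e; have : (z - z') * (y - x) = 0 by lra.
  by move=> /eqP; rewrite mulf_eq0 !subr_eq0 (gt_eqF xy) orbF => /eqP.
have s01 : s0 < s1 by lra.
apply: ncX; apply: (@circle_of_arcs R X (a \o f s0 s1) (b \o f u v)).
- by move=> z; apply: continuous_comp; [exact: cf|exact: ca].
- by move=> z; apply: continuous_comp; [exact: cf|exact: cb].
- move=> z z' /(fb _ _ _ (ltW s01))/andP[? ?] /(fb _ _ _ (ltW s01))/andP[? ?] /ia e.
  by apply: (fi _ _ _ _ s01); apply: e; apply/andP; split; lra.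
- move=> z z' /(fb _ _ _ uv)/andP[? ?] /(fb _ _ _ uv)/andP[? ?] /ib e.
  by apply: (fi _ _ _ _ uvlt); apply: e; apply/andP; split; lra.
- by rewrite /= !f0.
- by rewrite /= !f1.
move=> z z' /(fb _ _ _ (ltW s01))/andP[z0 z1] /(fs _ _ _ uvlt)/andP[z'0 z'1] /= e.
have [zt|tz] := leP (f s0 s1 z) t.
  have : f u v z' <= u.
    apply: umax; split; first by rewrite /= in_itv /=; apply/andP; split; lra.
    by exists (f s0 s1 z) => //=; rewrite in_itv /=; apply/andP; split; lra.
  lra.
have : v <= f u v z'.
  apply: vmin; split; first by rewrite /= in_itv /=; apply/andP; split; lra.
  by exists (f s0 s1 z) => //=; rewrite in_itv /=; apply/andP; split; lra.
lra.
Qed.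

End Dendrite.

(** * Points of order 2 and ramification points *)

Definition cutpoint (T : topologicalType) (c : T) (K1 K2 : set T) : Prop :=
  [/\ [/\ open K1, connected K1 & K1 !=set0],
      [/\ open K2, connected K2 & K2 !=set0],
      forall x, K1 x -> K2 x -> False &
      forall x, x <> c <-> K1 x \/ K2 x].

Lemma cutC (T : topologicalType) (c : T) K1 K2 : cutpoint c K1 K2 -> cutpoint c K2 K1.
Proof.
by move=> [h1 h2 h3 h4]; split=> // [x k2 k1|x]; [exact: h3 k1 k2|rewrite h4 or_comm].
Qed.

Section DendriteSides.
Variables (R : realType) (X : pseudoMetricType R).
Hypothesis dX : dendrite X.

Let hX : hausdorff_space X. Proof. by case: dX. Qed.
Let cX : compact [set: X]. Proof. by case: dX. Qed.
Let lX : Defs.locally_connected X. Proof. by case: dX => _ _ _ _ []. Qed.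
Let conX : connected [set: X]. Proof. by case: dX. Qed.

Lemma no_clopen (A : set X) : open A -> closed A -> A !=set0 -> A = setT.
Proof.
by move=> oA cA A0; apply: conX => //; exists A; rewrite ?setTI.
Qed.

Lemma side_sym (c x y : X) : side c x y -> side c y x.
Proof. exact: connected_component_sym. Qed.

Lemma side_trans (c x y z : X) : side c x y -> side c y z -> side c x z.
Proof. exact: connected_component_trans. Qed.

Lemma side_connected (c x : X) : connected (side c x).
Proof. exact: component_connected. Qed.

(** Only [c] can be added, since [B] is open; and if it were not, [A] would be open and closed in a
    connected space. *)
Lemma closure_open_compl1 (c : X) (A B : set X) :
  open A -> open B -> (forall x, A x -> B x -> False) ->
  (forall x, x <> c <-> A x \/ B x) -> A !=set0 ->
  closure A = A `|` [set c].
Proof.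
move=> oA oB dAB AB A0.
have cAc : closed (A `|` [set c]).
  rewrite (_ : _ `|` _ = ~` B); first exact: open_closedC.
  apply/seteqP; split=> x.
    move=> [Ax Bx|->]; first exact: dAB Ax Bx.
    by move=> Bc; exact: (AB c).2 (or_intror Bc) erefl.
  move=> nB; have [->|nxc] := pselect (x = c); [by right|left].
  by have [//|] := (AB x).1 nxc.
have clA : closure A `<=` A `|` [set c].
  rewrite [X in _ `<=` X](closure_id _).1 //; apply: closureS => x; exact: or_introl.
apply/seteqP; split=> // x [|->]; first exact: subset_closure.
apply: contrapT => nc.
have cA : closed A.
  rewrite closure_id; apply/seteqP; split; first exact: subset_closure.
  by move=> y cy; have [//|yc] := clA y cy; rewrite yc in cy.
have := no_clopen oA cA A0; move=> e.
have : A c by rewrite e.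
by move=> Ac; exact: (AB c).2 (or_introl Ac) erefl.
Qed.

Lemma side_cover (c x : X) : x <> c ->
  (forall y, side c x y -> (~` [set c] `\` side c x) y -> False) /\
  (forall y, y <> c <-> side c x y \/ (~` [set c] `\` side c x) y).
Proof.
move=> xc; split=> [y s [_ ns]//|y]; split=> [yc|[/side_neq//|[]//]].
by have [?|?] := pselect (side c x y); [left|right; split].
Qed.

Lemma open_other_sides (c x : X) : open (~` [set c] `\` side c x).
Proof.
rewrite openE => y [yc ny]; apply: (@filterS _ _ _ (side c y)).
  move=> z yz; split; first exact: side_neq yz.
  by move=> xz; apply: ny; apply: side_trans xz _; exact: side_sym.
apply: open_nbhs_nbhs; split; first exact: open_side.
exact: side_refl.
Qed.

Lemma closure_side (c x : X) : x <> c -> closure (side c x) = side c x `|` [set c].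
Proof.
move=> xc; have [h1 h2] := side_cover xc.
apply: (@closure_open_compl1 c _ (~` [set c] `\` side c x)) => //.
- exact: open_side.
- exact: open_other_sides.
- by exists x; exact: side_refl.
Qed.

Lemma sideU_connected (c x : X) : x <> c -> connected (side c x `|` [set c]).
Proof.
by move=> xc; rewrite -closure_side //; apply: connected_closure; exact: side_connected.
Qed.

(** It is the union of the remaining sides, each with [c] adjoined, and all of these share [c]. *)
Lemma compl_side_connected (c x : X) : connected (~` side c x).
Proof.
rewrite (_ : ~` _ = \bigcup_(y in [set y | y = c \/ ~ side c x y])
    (if pselect (y = c) then [set c] else side c y `|` [set c])).
  apply: bigcup_connected.
    by exists c => y _; case: pselect => // ?; right.
  move=> y _; case: pselect => h; [exact: connected1|exact: sideU_connected].
apply/seteqP; split=> y.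
  move=> ny; exists y; first by right.
  by case: pselect => [yc|yc]; [exact: yc|left; exact: side_refl].
move=> [z /= hz]; case: pselect => [zc /= yc /side_neq//|nzc].
move=> [zy xy|-> /side_neq//]; case: hz => // nz; apply: nz.
by apply: side_trans xy _; exact: side_sym.
Qed.

Lemma compl_side_closed (c x : X) : closed (~` side c x).
Proof. by apply: open_closedC; exact: open_side. Qed.

Lemma cut_closure (c : X) K1 K2 : cutpoint c K1 K2 -> closure K1 = K1 `|` [set c].
Proof. by move=> [[o1 _ n1] [o2 _ _] d h]; exact: (@closure_open_compl1 c K1 K2). Qed.

Lemma cut_closed (c : X) K1 K2 : cutpoint c K1 K2 -> closed (K1 `|` [set c]).
Proof. by move=> h; rewrite -(cut_closure h); exact: closed_closure. Qed.

Lemma cut_connected (c : X) K1 K2 : cutpoint c K1 K2 -> connected (K1 `|` [set c]).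
Proof.
move=> h; rewrite -(cut_closure h); apply: connected_closure.
by case: h => -[].
Qed.

Lemma cut_sub (c : X) K1 K2 Z x :
  cutpoint c K1 K2 -> connected Z -> ~ Z c -> Z x -> K1 x -> Z `<=` K1.
Proof.
move=> [[o1 _ _] [o2 _ _] d h] cZ Zc Zx K1x.
apply: (@connected_sub_open _ Z K1 K2 x) => // [y Zy|y _]; last exact: d.
by apply/h => e; rewrite e in Zy.
Qed.

Lemma cut_side (c : X) K1 K2 x : cutpoint c K1 K2 -> K1 x -> side c x = K1.
Proof.
move=> h K1x; have xc : x <> c by case: h => _ _ _ h; apply/h; left.
apply/seteqP; split.
  apply: (cut_sub h _ _ _ K1x); [exact: side_connected|by move=> /side_neq|exact: side_refl].
case: h => -[_ c1 _] _ _ h; apply: side_sub => // K1c.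
exact: (h c).2 (or_introl K1c) erefl.
Qed.

Lemma ramificationP (c : X) : ramification_point c <-> exists x y z,
  [/\ x <> c, y <> c & z <> c] /\ [/\ ~ side c x y, ~ side c x z & ~ side c y z].
Proof.
have neqP x y : x <> c -> y <> c -> (side c x != side c y) <-> ~ side c x y.
  move=> xc yc; split=> [/eqP h s|h].
    by apply: h; exact: same_connected_component.
  by apply/eqP => e; apply: h; rewrite e; exact: side_refl.
split=> [[xs [sz al h]]|].
  case: xs sz al h => [|x [|y [|z [|? ?]]]] //= _ /and4P[/eqP xc /eqP yc /eqP zc _] h.
  exists x, y, z; split=> //.
  by split; apply/neqP => //; [apply: (h 0%N 1%N)|apply: (h 0%N 2%N)|apply: (h 1%N 2%N)].
move=> [x [y [z [[xc yc zc] [xy xz yz]]]]]; exists [:: x; y; z]; split=> //=.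
  by rewrite !(introN eqP).
have s w w' : ~ side c w w' -> ~ side c w' w by move=> h /side_sym.
by move=> [|[|[|//]]] [|[|[|//]]] //= _ _ _; apply/neqP => //; exact: s.
Qed.

Lemma four_sides (c x y z w : X) : ~ order_ge c 4 ->
  [/\ x <> c, y <> c, z <> c & w <> c] -> [/\ ~ side c x y, ~ side c x z & ~ side c y z] ->
  [\/ side c w x, side c w y | side c w z].
Proof.
move=> o4 [xc yc zc wc] [xy xz yz]; apply: contrapT => h; apply: o4.
have neqP u v : u <> c -> v <> c -> ~ side c u v -> (side c u != side c v).
  by move=> uc vc h'; apply/eqP => e; apply: h'; rewrite e; exact: side_refl.
have s u v : ~ side c u v -> ~ side c v u by move=> h' /side_sym.
have wx : ~ side c w x by move=> ?; apply: h; constructor 1.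
have wy : ~ side c w y by move=> ?; apply: h; constructor 2.
have wz : ~ side c w z by move=> ?; apply: h; constructor 3.
exists [:: x; y; z; w]; split=> //=; first by rewrite !(introN eqP).
by move=> [|[|[|[|//]]]] [|[|[|[|//]]]] //= _ _ _; apply: neqP => //; exact: s.
Qed.

Lemma cut_of_sides (c x y : X) : ~ ramification_point c -> x <> c -> y <> c ->
  ~ side c x y -> cutpoint c (side c x) (side c y).
Proof.
move=> nr xc yc nxy; split.
- split; [exact: open_side|exact: side_connected|by exists x; exact: side_refl].
- split; [exact: open_side|exact: side_connected|by exists y; exact: side_refl].
- by move=> z xz yz; apply: nxy; apply: side_trans xz _; exact: side_sym.
move=> z; split=> [zc|[/side_neq//|/side_neq//]].
apply: contrapT => /not_orP[xz yz]; apply: nr; apply/ramificationP.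
by exists x, y, z.
Qed.

Lemma arc_between (p q : X) : p <> q -> exists a : R -> X, is_arc a p q.
Proof.
move=> npq.
have [a [aa _]] := @arc_exists R X setT p q hX cX lX openT conX I I npq.
by exists a.
Qed.

Lemma continuum_between (U : set X) x y : open U -> connected U -> U x -> U y ->
  exists Z, [/\ closed Z, connected Z, Z x, Z y & Z `<=` U].
Proof.
move=> oU cU Ux Uy; have [<-|nxy] := pselect (x = y).
  exists [set x]; split=> //; [exact: closed_pt|exact: connected1|by move=> _ ->].
have [a [[ca ia a0 a1] aU]] := arc_exists hX cX lX oU cU Ux Uy nxy.
exists (a @` `[0, 1]); split.
- exact: image_itv_closed.
- exact: image_itv_connected.
- by exists 0 => //=; rewrite in_itv /= lexx ler01.
- by exists 1 => //=; rewrite in_itv /= lexx ler01.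
by move=> _ [t _ <-].
Qed.

Lemma arc_neq (a : R -> X) p q (s t : R) :
  is_arc a p q -> 0 <= s <= 1 -> 0 <= t <= 1 -> s != t -> a s <> a t.
Proof. by move=> [_ ia _ _] s01 t01 /eqP nst /ia e; apply: nst; exact: e. Qed.

(** Uncountability through Baire: if [n] is injective, each of its fibres has at most one point and
    an open dense complement, and a point of the interval lying in all these complements would have
    no value. *)
Lemma uncountable_itv (e : R) (n : R -> nat) : 0 < e ->
  ~ (forall s t : R, 0 < s < e -> 0 < t < e -> n s = n t -> s = t).
Proof.
move=> e0 inj; pose F i := ~` [set t : R | 0 < t < e /\ n t = i].
have F1 i : exists t0, ~` F i `<=` [set t0].
  have [[t0 [h0 e']]|h] := pselect (exists t, 0 < t < e /\ n t = i).
    by exists t0 => t; rewrite setCK => -[ht et]; apply: inj => //; rewrite et.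
  by exists 0 => t; rewrite setCK => ht; case: h; exists t.
have dF i : open (F i) /\ dense (F i).
  have [t0 ht0] := F1 i; split.
    rewrite -closedC; have [[t Ft]|h] := pselect (~` F i !=set0).
      rewrite (_ : ~` F i = [set t0]).
        exact/accessible_closed_set1/hausdorff_accessible/Rhausdorff.
      apply/seteqP; split=> // _ ->; have := ht0 _ Ft; rewrite /= => <-.
      exact: Ft.
    by rewrite (_ : ~` F i = set0); [exact: closed0|apply/seteqP; split=> // t Ft; apply: h; exists t].
  move=> O [x Ox] oO; apply: contrapT => h.
  have On y : O y -> y = t0.
    by move=> Oy; apply: ht0 => Fy; apply: h; exists y.
  have /nbhs_ballP[r /= r0 rO] := open_nbhs_nbhs (conj oO Ox).
  have : x + r / 2 = t0.
    apply: On; apply: rO; rewrite /ball /= opprD addNKr normrN gtr0_norm ?divr_gt0 //.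
    by rewrite ltr_pdivrMr // ltr_pMr // ltr1n.
  rewrite (On x Ox) => /eqP; rewrite -subr_eq0 addrAC subrr add0r.
  by rewrite gt_eqF // divr_gt0.
have ne : [set` `]0, e[] !=set0.
  by exists (e / 2); rewrite /= in_itv /=; apply/andP; split; lra.
have [t [t0e ht]] := Baire dF ne (@interval_open R (BRight 0) (BLeft e) erefl erefl).
by have := ht (n t) I; apply; split=> //; move: t0e; rewrite /= in_itv.
Qed.

(* Third sides at distinct ramification points of an arc are disjoint, so there
   are only countably many such points. *)
Lemma arc_unramified (a : R -> X) p q (e : R) : is_arc a p q -> 0 < e <= 1 ->
  exists t, 0 < t < e /\ ~ ramification_point (a t).
Proof.
move=> aa /andP[e0 e1]; apply: contrapT => nt; have [ca ia a0 a1] := aa.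
have ram t : 0 < t < e -> ramification_point (a t).
  by move=> ht; apply: contrapT => nr; apply: nt; exists t.
have pc t : 0 < t < e -> p <> a t /\ q <> a t.
  move=> /andP[t0 t1]; rewrite -a0 -a1; have t01 : 0 <= t <= 1 by apply/andP; split; lra.
  have z01 : 0 <= (0 : R) <= 1 by rewrite lexx ler01.
  have o01 : 0 <= (1 : R) <= 1 by rewrite lexx ler01.
  split; first by apply: (arc_neq aa z01 t01); rewrite lt_eqF.
  by apply: (arc_neq aa o01 t01); rewrite gt_eqF //; lra.
have [B [oB bB]] := countable_basis cX.
have third t : exists y, 0 < t < e ->
    [/\ y <> a t, ~ side (a t) p y & ~ side (a t) q y].
  have [te|?] := pselect (0 < t < e); last by exists p.
  have [x [y [z [[xc yc zc] [xy xz yz]]]]] := (ramificationP _).1 (ram t te).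
  have bad u v w : ~ side (a t) u v -> side (a t) w u -> side (a t) w v -> False.
    by move=> nuv wu wv; apply: nuv; apply: side_trans (side_sym wu) wv.
  have [px|px] := pselect (side (a t) p x).
    have [qy|qy] := pselect (side (a t) q y).
      by exists z => _; split=> //; [exact: bad px|exact: bad qy].
    by exists y => _; split=> //; exact: bad px.
  have [qx|qx] := pselect (side (a t) q x); last by exists x.
  have [py|py] := pselect (side (a t) p y).
    by exists z => _; split=> //; [exact: bad py|exact: bad qx].
  by exists y => _; split=> //; exact: bad qx.
have [y hy] := choice third.
have idx t : exists n, 0 < t < e -> B n (y t) /\ B n `<=` side (a t) (y t).
  have [te|?] := pselect (0 < t < e); last by exists 0%N.
  have [yc _ _] := hy t te.
  have [n hn] := bB (y t) (side (a t) (y t)) (open_side dX _ _) (side_refl yc).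
  by exists n.
have [n hn] := choice idx.
apply: (@uncountable_itv e n e0).
have lt_case s t : 0 < s < e -> 0 < t < e -> n s = n t -> s < t -> False.
  move=> hs ht nst st; have [_ Bt] := hn t ht; have [Bs Bs'] := hn s hs.
  have sy : side (a s) (y s) (y s) by apply: Bs'.
  have ty : side (a t) (y t) (y s) by apply: Bt; rewrite -nst.
  have [ysc nps nqs] := hy s hs; have [ytc npt nqt] := hy t ht.
  have s01 : 0 <= s <= 1 by case/andP: hs => *; apply/andP; split; lra.
  have t01 : 0 <= t <= 1 by case/andP: ht => *; apply/andP; split; lra.
  have /andP[s0 _] := hs; have /andP[t0 te] := ht.
  have qt : side (a s) q (a t).
    rewrite -a1; apply: (@side_of_arc R X a p q s 1 t 1 aa) => //; rewrite ?ler01 ?lexx ?st //; lra.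
  have pt : side (a t) p (a s).
    rewrite -a0; apply: (@side_of_arc R X a p q t 0 0 s aa) => //;
      rewrite ?lexx ?st ?orbT ?(ltW s0) //; lra.
  (* The third side at [a s], with [a s] adjoined, is connected and misses [a t], so it lies on the
     side of [p] at [a t]; a point shared with the third side at [a t] is then impossible. *)
  have St : ~ (side (a s) (y s) `|` [set a s]) (a t).
    move=> [yt|/= e']; last by case: (arc_neq aa t01 s01 _ e'); rewrite gt_eqF.
    by apply: nqs; apply: side_trans qt _; exact: side_sym.
  have : side (a t) (a s) (y s).
    by apply: (side_sub (sideU_connected ysc) St); [right|left].
  move=> h; apply: npt; apply: side_trans pt _; apply: side_trans h _.
  exact: side_sym.
move=> s t hs ht nst; apply/eqP; rewrite eq_le !leNgt; apply/andP.
by split; apply/negP => lt; [apply: (lt_case t s)|apply: (lt_case s t)].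
Qed.

End DendriteSides.

(** * Medians and nearby cut points *)

Section Medians.
Variables (R : realType) (X : pseudoMetricType R).
Hypothesis dX : dendrite X.

(** An arc from [p] into [Z] passes an unramified point while still off [Z]. That point separates
    the ends of the arc, and [Z] stays whole on the side of [z]. *)
Lemma cut_near (Z : set X) p z : closed Z -> connected Z -> Z z -> ~ Z p ->
  exists c K1 K2, [/\ cutpoint c K1 K2, K1 p & Z `<=` K2].
Proof.
move=> cZ conZ Zz Zp; have npz : p <> z by move=> e; rewrite e in Zp.
have [a aa] := arc_between dX npz; have [ca _ a0 a1] := aa.
have oU : open (a @^-1` (~` Z)).
  by apply: open_comp => [t _|]; [exact: ca|exact: closed_openC].
have U0 : (a @^-1` (~` Z)) 0 by rewrite /preimage /= a0.
have /nbhs_ballP[r /= r0 rU] := open_nbhs_nbhs (conj oU U0).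
have e01 : 0 < Num.min r 1 <= 1 by rewrite lt_min r0 ltr01 ge_min lexx orbT.
have [t [/andP[t0 +] nr]] := arc_unramified dX aa e01.
rewrite lt_min => /andP[tr t1].
have Zc : ~ Z (a t) by apply: rU; rewrite /ball /= sub0r normrN gtr0_norm.
have t01 : 0 <= t <= 1 by rewrite !ltW.
have z01 : 0 <= (0 : R) <= 1 by rewrite lexx ler01.
have o01 : 0 <= (1 : R) <= 1 by rewrite lexx ler01.
have pc : p <> a t by rewrite -a0; apply: (arc_neq aa z01 t01); rewrite lt_eqF.
have zc : z <> a t by rewrite -a1; apply: (arc_neq aa o01 t01); rewrite gt_eqF.
exists (a t), (side (a t) p), (side (a t) z); split.
- by apply: cut_of_sides => //; apply: (arc_separates dX aa); rewrite t0.
- exact: side_refl.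
exact: side_sub.
Qed.

(** A continuum joining [x] to [w] within the side avoids [a t], hence also the points [a t'] for
    [t'] near [t]. *)
Lemma open_side_along (a : R -> X) x w :
  continuous a -> open [set t | side (a t) x w].
Proof.
move=> ca; rewrite openE => t /= xw; have xt := side_neql xw.
have [Z [cZ conZ Zx Zw Zs]] := continuum_between dX (open_side dX (a t) x)
  (@side_connected _ _ _ _) (side_refl xt) xw.
have oU : open (a @^-1` (~` Z)).
  by apply: open_comp => [? _|]; [exact: ca|exact: closed_openC].
apply: (@filterS _ _ _ (a @^-1` (~` Z))).
  by move=> t' Zt'; exact: (side_sub conZ Zt' Zx).
by apply: open_nbhs_nbhs; split=> //= /Zs/side_neq.
Qed.

(* Otherwise the parameters at which [w] is on the side of [r] and those at which
   it is on the side of [s] would disconnect the arc from [r] to [s]. *)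
Lemma median (r s w : X) : r <> s -> side r s w -> side s r w ->
  exists t, [/\ r <> t, s <> t, ~ side t r s &
    t = w \/ (~ side t r w /\ ~ side t s w)].
Proof.
move=> nrs rsw srw; have [a aa] := arc_between dX nrs; have [ca _ a0 a1] := aa.
apply: contrapT => nt.
have z01 : 0 <= (0 : R) <= 1 by rewrite lexx ler01.
have o01 : 0 <= (1 : R) <= 1 by rewrite lexx ler01.
have sep t : 0 < t < 1 -> ~ side (a t) r s by exact: (arc_separates dX aa).
pose S := [set t | side (a t) s w]; pose Q := [set t | side (a t) r w].
have oS : open S by exact: open_side_along.
have oQ : open Q by exact: open_side_along.
have S0 : S 0 by rewrite /S /= a0.
have Q1 : Q 1 by rewrite /Q /= a1.
have nQ0 : ~ Q 0 by rewrite /Q /= a0 => /side_neql.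
have nS1 : ~ S 1 by rewrite /S /= a1 => /side_neql.
have cov : `[0, 1] `<=` S `|` Q.
  move=> t; rewrite /= in_itv /= => /andP[t0 t1].
  have [->|n0] := eqVneq t 0; first by left.
  have [->|n1] := eqVneq t 1; first by right.
  have t01 : 0 <= t <= 1 by rewrite t0.
  apply: contrapT => /not_orP[nS nQ]; apply: nt; exists (a t); split; last by right.
  - by rewrite -a0; apply: (arc_neq aa z01 t01); rewrite eq_sym.
  - by rewrite -a1; apply: (arc_neq aa o01 t01); rewrite eq_sym.
  - by apply: sep; rewrite !lt_neqAle eq_sym n0 t0 n1 t1.
have : `[0, 1] `<=` S.
  apply: (@connected_sub_open _ _ S Q 0) => //.
  - exact: segment_connected.
  - move=> t; rewrite /= in_itv /= => /andP[t0 t1] St Qt.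
    have [e|n0] := eqVneq t 0; first by apply: nQ0; rewrite -e.
    have [e|n1] := eqVneq t 1; first by apply: nS1; rewrite -e.
    apply: (sep t); first by rewrite !lt_neqAle eq_sym n0 t0 n1 t1.
    by apply: side_trans Qt _; exact: side_sym.
by move=> /(_ 1); rewrite /= in_itv /= ler01 lexx => /(_ isT).
Qed.

(** The point where the three connections meet. The median cannot be [p3] itself, because [p3] does
    not separate [p1] from [p2]. *)
Lemma tripod (p1 p2 p3 : X) : p1 <> p2 ->
  side p1 p2 p3 -> side p2 p1 p3 -> side p3 p1 p2 ->
  exists t, [/\ p1 <> t, p2 <> t & p3 <> t] /\
    [/\ ~ side t p1 p2, ~ side t p1 p3 & ~ side t p2 p3].
Proof.
move=> n12 h1 h2 h3; have [t [t1 t2 t12 [e|[t13 t23]]]] := median n12 h1 h2.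
  by rewrite e in t12.
have [e|n] := pselect (t = p3); first by rewrite e in t12.
by exists t; split; split=> // e; apply: n.
Qed.

(** Density gives a ramification point [w] on the side of [s] at [r] and on the side of [r] at [s].
    The median of the three points is [w] or has three sides of its own. *)
Lemma ramification_between (r s : X) : dense [set p : X | ramification_point p] ->
  r <> s -> exists t, [/\ ramification_point t, r <> t, s <> t & ~ side t r s].
Proof.
move=> dr nrs; have [a aa] := arc_between dX nrs; have [ca _ a0 a1] := aa.
have l1 : 0 < 1 / 2 :> R by lra.
have l2 : 1 / 2 <= 1 :> R by lra.
have l3 : 1 / 2 < 1 :> R by lra.
have z01 : 0 <= (0 : R) <= 1 by rewrite lexx ler01.
have o01 : 0 <= (1 : R) <= 1 by rewrite lexx ler01.
have [||w [[rsw srw] ramw]] := dr (side r s `&` side s r).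
- exists (a (1 / 2)); split.
    rewrite -{1}a0 -a1; apply: (@side_of_arc R X a r s 0 1 (1/2) 1 aa z01);
      by rewrite ?l1 ?l2 ?(ltW l1) ?lexx.
  rewrite -{1}a1 -a0; apply: (@side_of_arc R X a r s 1 0 0 (1/2) aa o01);
    by rewrite ?l1 ?l3 ?(ltW l1) ?lexx ?orbT.
- by apply: openI; exact: open_side.
have [t [rt st nrst h]] := median nrs rsw srw.
exists t; split=> //; have [->//|tw] := pselect (t = w).
case: h => // -[nrw nsw]; apply/ramificationP; exists r, s, w.
by split; split=> // e; apply: tw.
Qed.

End Medians.

(** * Decompositions indexed by trees *)

Lemma bridged_triangle (G : fgr) (a b c : fvert G) : bridged G ->
  a != b -> a != c -> b != c -> fedge G a b -> fedge G a c -> fedge G b c -> False.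
Proof.
move=> bG ab ac bc eab eac ebc; have [P [aP bP cP]] := bG a b ab eab.
have [cIP|cNP] := boolP (c \in P).
  rewrite fedge_sym in ebc; have [e _] := cP _ _ cIP bP ebc.
  by rewrite e eqxx in ac.
have [_ e] := cP _ _ aP cNP eac; by rewrite e eqxx in bc.
Qed.

Lemma nbr_neq0 (G : fgr) (v : fvert G) : inTM3 G -> exists w, w \in nbr v.
Proof.
move=> [tG cG _]; apply: contrapT => h.
have /gconnectedP cT := tree_connected tG.
have /fintype.subsetP sub : [set: fvert G]%SET \subset [set v]%SET.
  apply: (cT _ v); rewrite ?inE // => y z _ /set1P-> _ vz; apply/set1P/eqP.
  by apply: contrapT => /negP nz; apply: h; exists z; rewrite !inE nz.
have := cG; rewrite -cardsT; apply/negP; rewrite -leqNgt -(cards1 v).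
by apply: subset_leq_card; apply/fintype.subsetP.
Qed.

Lemma cards_le2 (T : finType) (A : {set T}) : (#|A| <= 2)%N ->
  [\/ A = finset.set0, exists x, A = [set x]%SET | exists x y, x != y /\ A = [set x; y]%SET].
Proof.
rewrite leq_eqVlt => /orP[/cards2P[x [y [xy ->]]]|].
  by constructor 3; exists x, y.
rewrite ltnS leq_eqVlt => /orP[/cards1P[x ->]|].
  by constructor 2; exists x.
by rewrite ltnS leqn0 cards_eq0 => /eqP->; constructor 1.
Qed.

(* Cut points have exactly two sides, so they are end points of the pieces; hence
   the marked points of a piece can be distributed freely over the two parts of
   a further cut. *)
Definition decomposition (T : topologicalType) (A : fgr) (D : fvert A -> set T) : Prop :=
  [/\ forall a, closed (D a) /\ connected (D a),
      forall x, exists a, D a x,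
      forall a b x, a <> b -> D a x -> D b x -> fedge A a b,
      forall a b, a <> b -> fedge A a b -> exists c K1 K2,
        [/\ cutpoint c K1 K2, D a `&` D b = [set c],
            D a `<=` K1 `|` [set c] & D b `<=` K2 `|` [set c]] &
      forall a, exists x, D a x /\ forall b, b <> a -> ~ D b x].

Definition subdivides (T : Type) (B A : fgr) (f : fvert B -> fvert A)
    (E : fvert B -> set T) (D : fvert A -> set T) : Prop :=
  forall a x, D a x <-> exists b, f b = a /\ E b x.

(** A relatively clopen part missing [c] lies in [K] and is therefore clopen in the whole of [D]; so
    it is empty, and two complementary parts cannot both contain [c]. *)
Lemma half_connected (T : topologicalType) (D K : set T) c :
  connected D -> D c -> open K -> ~ K c -> closed (K `|` [set c]) ->
  connected (D `&` (K `|` [set c])).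
Proof.
move=> cD Dc oK Kc cKc.
have key O F : open O -> closed F ->
    D `&` (K `|` [set c]) `&` O = D `&` (K `|` [set c]) `&` F -> ~ O c ->
    D `&` (K `|` [set c]) `&` O = set0.
  move=> oO cF OF nOc; apply: contrapT => /eqP/set0P ne.
  have := cD _ ne; move=> /(_ _ _)/seteqP h.
  have [||_ /(_ c Dc)[_ Oc]//] := h.
  - exists (K `&` O); first exact: openI.
    by apply/seteqP; split=> [x [[Dx [Kx|->]] Ox]|x [Dx [Kx Ox]]] //; split=> //; split=> //; left.
  by exists ((K `|` [set c]) `&` F); [exact: closedI|rewrite OF setIA].
move=> B [x Bx] [O oO BO] [F cF BF].
have OF : D `&` (K `|` [set c]) `&` O = D `&` (K `|` [set c]) `&` F by rewrite -BO.
have [Oc|nOc] := pselect (O c); last by move: Bx; rewrite BO (key O F).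
have FO : D `&` (K `|` [set c]) `&` ~` F = D `&` (K `|` [set c]) `&` ~` O.
  apply/seteqP; split=> y [Py n]; split=> // h; apply: n.
    by have : (D `&` (K `|` [set c]) `&` O) y by []; rewrite OF => -[].
  by have : (D `&` (K `|` [set c]) `&` F) y by []; rewrite -OF => -[].
have nFc : ~ (~` F) c.
  move=> h; have : (D `&` (K `|` [set c]) `&` O) c by split=> //; split=> //; right.
  by rewrite OF => -[_ /h].
have e := key _ _ (closed_openC cF) (open_closedC oO) FO nFc.
rewrite BF; apply/seteqP; split=> y; first by case.
move=> Py; split=> //; apply: contrapT => nF.
by have : (D `&` (K `|` [set c]) `&` ~` F) y by []; rewrite e.
Qed.

Section Decompositions.
Variables (R : realType) (X : pseudoMetricType R).
Hypothesis dX : dendrite X.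

Lemma cutpoint_neq1 (c : X) K1 K2 : cutpoint c K1 K2 -> ~ K1 c.
Proof. by move=> [_ _ _ h] K1c; exact: (h c).2 (or_introl K1c) erefl. Qed.

Lemma cutpoint_neq2 (c : X) K1 K2 : cutpoint c K1 K2 -> ~ K2 c.
Proof. by move=> /cutC/cutpoint_neq1. Qed.

Lemma cutpoint_in (c : X) K1 K2 Z x y :
  cutpoint c K1 K2 -> connected Z -> Z x -> Z y -> K1 x -> K2 y -> Z c.
Proof.
move=> h cZ Zx Zy x1 y2; apply: contrapT => Zc.
have K1y := cut_sub h cZ Zc Zx x1 Zy.
by case: h => _ _ d _; exact: d K1y y2.
Qed.

(** The piece over [f u] is cut at [c] and the others are kept. Since the pieces of the neighbours
    lie strictly inside [K1] or [K2], each half meets exactly the pieces that adjacency in [B]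
    prescribes. *)
Lemma elementary_decomposition (B A : fgr) (f : fvert B -> fvert A) u v
    (D : fvert A -> set X) (c : X) K1 K2 :
  elementary f u v -> decomposition D -> cutpoint c K1 K2 ->
  D (f u) c -> (forall b, b <> f u -> ~ D b c) ->
  (forall w, w != u -> w != v -> fedge B u w -> D (f w) `<=` K1) ->
  (forall w, w != u -> w != v -> fedge B v w -> D (f w) `<=` K2) ->
  exists E, [/\ decomposition E, subdivides f E D,
    E u `<=` K1 `|` [set c], E v `<=` K2 `|` [set c] &
    forall w, w != u -> w != v -> E w = D (f w)].
Proof.
move=> ef [clD covD nerD marD corD] cut Dc onlyD hu hv.
have [nuv euv fuv [fe fs fl] finj] := ef; have cut' := cutC cut.
have [[o1 con1 n1] [o2 con2 n2] d12 cov12] := cut.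
have nc1 := cutpoint_neq1 cut; have nc2 := cutpoint_neq2 cut.
pose E w := if w == u then D (f u) `&` (K1 `|` [set c])
            else if w == v then D (f u) `&` (K2 `|` [set c]) else D (f w).
have Eu : E u = D (f u) `&` (K1 `|` [set c]) by rewrite /E eqxx.
have Ev : E v = D (f u) `&` (K2 `|` [set c]) by rewrite /E eq_sym (negPf nuv) eqxx.
have Ew w : w != u -> w != v -> E w = D (f w) by move=> wu wv; rewrite /E (negPf wu) (negPf wv).
have ED w : E w `<=` D (f w).
  have [->|wu] := eqVneq w u; first by rewrite Eu; apply: subIsetl.
  have [->|wv] := eqVneq w v; first by rewrite Ev -fuv; apply: subIsetl.
  by rewrite Ew.
have DE x : D (f u) x -> E u x \/ E v x.
  move=> Dx; rewrite Eu Ev; have [->|xc] := pselect (x = c); first by left; split=> //; right.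
  by have [?|?] := (cov12 x).1 xc; [left|right]; split=> //; left.
have neqf w : w != u -> w != v -> f w <> f u.
  by move=> wu wv /(elementary_in ef)[] e; [rewrite e eqxx in wu|rewrite e eqxx in wv].
have sub : subdivides f E D.
  move=> a x; split=> [Dx|[b [<-]]]; last exact: ED.
  have [b eb] := fs a; subst a.
  have [bu|bu] := eqVneq b u.
    by subst b; have [?|?] := DE x Dx; [exists u|exists v; rewrite -fuv].
  have [bv|bv] := eqVneq b v.
    subst b; rewrite -fuv in Dx.
    by have [?|?] := DE x Dx; [exists u; rewrite fuv|exists v].
  by exists b; rewrite Ew.
have sepu w x : w != u -> w != v -> E u x -> E w x -> fedge B u w.
  move=> wu wv; rewrite Eu Ew // => -[Dx K1x] Dwx.
  have : fedge A (f u) (f w) by apply: nerD Dx Dwx; exact/nesym/neqf.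
  move=> /fl[x' [y' [xy ex ey]]]; have e := elementary_out ef wu wv ey; subst y'.
  have [e|e] := elementary_in ef ex; subst x' => //.
  have K2x := hv w wu wv xy x Dwx; case: K1x => [K1x|e]; first by case: (d12 x).
  by rewrite e in K2x.
have sepv w x : w != u -> w != v -> E v x -> E w x -> fedge B v w.
  move=> wu wv; rewrite Ev Ew // => -[Dx K2x] Dwx.
  have : fedge A (f u) (f w) by apply: nerD Dx Dwx; exact/nesym/neqf.
  move=> /fl[x' [y' [xy ex ey]]]; have e := elementary_out ef wu wv ey; subst y'.
  have [e|e] := elementary_in ef ex; subst x' => //.
  have K1x := hu w wu wv xy x Dwx; case: K2x => [K2x|e]; first by case: (d12 x).
  by rewrite e in K1x.
exists E; split=> //; try by [rewrite Eu; exact: subIsetr|rewrite Ev; exact: subIsetr].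
split.
- move=> w; have [->|wu] := eqVneq w u.
    rewrite Eu; split; first by apply: closedI; [exact: (clD _).1|exact: (cut_closed dX cut)].
    by apply: half_connected => //; [exact: (clD _).2|exact: (cut_closed dX cut)].
  have [->|wv] := eqVneq w v; last by rewrite Ew.
  rewrite Ev; split; first by apply: closedI; [exact: (clD _).1|exact: (cut_closed dX cut')].
  by apply: half_connected => //; [exact: (clD _).2|exact: (cut_closed dX cut')].
- by move=> x; have [a /sub[b [_ Ex]]] := covD x; exists b.
- move=> w1 w2 x /eqP n12 E1 E2.
  have [e1|w1u] := eqVneq w1 u.
    subst w1; have [e2|w2v] := eqVneq w2 v; first by subst w2.
    by apply: sepu E1 E2 => //; rewrite eq_sym.
  have [e1|w1v] := eqVneq w1 v.
    subst w1; have [e2|w2u] := eqVneq w2 u; first by subst w2; rewrite fedge_sym.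
    by apply: sepv E1 E2 => //; rewrite eq_sym.
  have [e2|w2u] := eqVneq w2 u; first by subst w2; rewrite fedge_sym; exact: sepu E2 E1.
  have [e2|w2v] := eqVneq w2 v; first by subst w2; rewrite fedge_sym; exact: sepv E2 E1.
  have nf : f w1 <> f w2.
    by move=> /(elementary_out ef w2u w2v) e; rewrite e eqxx in n12.
  have /fl[x' [y' [xy ex ey]]] := nerD _ _ _ nf (ED _ _ E1) (ED _ _ E2).
  by rewrite -(elementary_out ef w1u w1v ex) -(elementary_out ef w2u w2v ey).
- have inh w1 w2 : f w1 <> f w2 -> fedge B w1 w2 ->
      (forall x, D (f w1) x -> D (f w2) x -> E w1 x /\ E w2 x) ->
      exists c K1 K2, [/\ cutpoint c K1 K2, E w1 `&` E w2 = [set c],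
        E w1 `<=` K1 `|` [set c] & E w2 `<=` K2 `|` [set c]].
    move=> nf e12 h; have [c' [K1' [K2' [ct De s1 s2]]]] := marD _ _ nf (fe _ _ e12).
    exists c', K1', K2'; split=> //.
    + rewrite -De; apply/seteqP; split=> x [].
        by move=> /ED ? /ED ?; split.
      by move=> d1 d2; have [? ?] := h x d1 d2; split.
    + by apply: subset_trans s1; exact: ED.
    by apply: subset_trans s2; exact: ED.
  have inu w x : w != u -> w != v -> fedge B u w -> D (f u) x -> D (f w) x -> E u x /\ E w x.
    by move=> wu wv uw Dux Dwx; rewrite Eu Ew //; split=> //; split=> //; left; apply: hu Dwx.
  have inv w x : w != u -> w != v -> fedge B v w -> D (f v) x -> D (f w) x -> E v x /\ E w x.
    by move=> wu wv uw Dux Dwx; rewrite Ev Ew // fuv; split=> //; split=> //; left; apply: hv Dwx.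
  have Euv : E u `&` E v = [set c].
    rewrite Eu Ev; apply/seteqP; split=> [x [[Dx [k1|//]] [_ [k2|//]]]|x ->].
      by case: (d12 x).
    by split; split=> //; right.
  move=> w1 w2 /eqP n12 e12.
  have [e1|w1u] := eqVneq w1 u.
    subst w1; have [e2|w2v] := eqVneq w2 v.
      subst w2; exists c, K1, K2; split=> //; first by rewrite Eu; exact: subIsetr.
      by rewrite Ev; exact: subIsetr.
    have w2u : w2 != u by rewrite eq_sym.
    by apply: inh => //; [exact/nesym/neqf|move=> x; exact: inu].
  have [e1|w1v] := eqVneq w1 v.
    subst w1; have [e2|w2u] := eqVneq w2 u.
      subst w2; exists c, K2, K1; split=> //; first by rewrite setIC.
        by rewrite Ev; exact: subIsetr.
      by rewrite Eu; exact: subIsetr.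
    have w2v : w2 != v by rewrite eq_sym.
    by apply: inh => //; [rewrite -fuv; exact/nesym/neqf|move=> x; exact: inv].
  have [e2|w2u] := eqVneq w2 u.
    subst w2; apply: inh => //; first exact: neqf.
    rewrite fedge_sym in e12; move=> x d1 d2.
    by have [] := inu w1 x w1u w1v e12 d2 d1.
  have [e2|w2v] := eqVneq w2 v.
    subst w2; apply: inh => //; first by rewrite -fuv; exact: neqf.
    rewrite fedge_sym in e12; move=> x d1 d2.
    by have [] := inv w1 x w1u w1v e12 d2 d1.
  apply: inh => // [|x]; last by rewrite !Ew.
  by move=> /(elementary_out ef w2u w2v) e; rewrite e eqxx in n12.
(* Both sides accumulate at [c], and no other piece comes close to [c], so each half has points
   belonging to it alone. *)
have clE' : closed (\bigcup_(b in [set b | b <> f u]) D b).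
  by apply: closed_bigcup => [|b _]; [exact: finite_finset|exact: (clD b).1].
have nearc : nbhs c (~` (\bigcup_(b in [set b | b <> f u]) D b)).
  apply: open_nbhs_nbhs; split; first exact: closed_openC.
  by move=> [b /= bu]; exact: onlyD.
have corK K K' : cutpoint c K K' -> exists x, [/\ K x, D (f u) x & forall b, b <> f u -> ~ D b x].
  move=> ct; have : closure K c by rewrite (cut_closure dX ct); right.
  move=> /(_ _ nearc)[x [Kx nx]]; exists x; split=> //.
    have [a Dax] := covD x; have [<-//|na] := pselect (a = f u).
    by case: nx; exists a.
  by move=> b bu Dbx; apply: nx; exists b.
move=> w; have [->|wu] := eqVneq w u.
  have [x [K1x Dx nx]] := corK _ _ cut; exists x; split; first by rewrite Eu; split=> //; left.
  move=> b /eqP bu; have [->|bv] := eqVneq b v; last by rewrite Ew //; apply: nx; exact: neqf.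
  by rewrite Ev => -[_ [K2x|e]]; [exact: d12 K2x|rewrite e in K1x].
have [->|wv] := eqVneq w v.
  have [x [K2x Dx nx]] := corK _ _ cut'; exists x; split; first by rewrite Ev; split=> //; left.
  move=> b /eqP bv; have [->|bu] := eqVneq b u; last by rewrite Ew //; apply: nx; exact: neqf.
  by rewrite Eu => -[_ [K1x|e]]; [exact: d12 K2x|rewrite e in K2x].
have [x [Dx nx]] := corD (f w); exists x; split; first by rewrite Ew.
move=> b bw /ED; apply: nx => /(elementary_out ef wu wv) e; exact: bw.
Qed.

End Decompositions.

(** * Lifting decompositions along monotone epimorphisms *)

Section Refinement.
Variables (R : realType) (X : pseudoMetricType R).
Hypothesis wX : Wazewski_D3 X.

Let dX : dendrite X. Proof. by case: wX. Qed.

Section Piece.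
Variables (A : fgr) (D : fvert A -> set X).
Hypotheses (tA : is_tree A) (dD : decomposition D).

(** Equal marks of two neighbours would put one point into three pieces, making their vertices a
    triangle. *)
Lemma piece_marks (a : fvert A) : exists m : fvert A -> X,
  [/\ forall b, b \in nbr a -> D a `&` D b = [set m b],
      forall b b', b \in nbr a -> b' \in nbr a -> b <> b' -> m b <> m b' &
      forall b, b \in nbr a -> forall x y, D a x -> D a y -> x <> m b -> y <> m b ->
        side (m b) x y].
Proof.
have [clD covD nerD marD corD] := dD.
have ex b : exists c, b \in nbr a -> D a `&` D b = [set c] /\
    forall x y, D a x -> D a y -> x <> c -> y <> c -> side c x y.
  have [/[!inE] /andP[/eqP ba ab]|_] := boolP (b \in nbr a); last first.
    by have [x _] := corD a; exists x.
  have [c [K1 [K2 [ct De s1 s2]]]] := marD a b (nesym ba) ab.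
  exists c => _; split=> // x y Dx Dy xc yc.
  have [K1x|//] := s1 x Dx; have [K1y|//] := s1 y Dy.
  by rewrite (cut_side ct K1x).
have [m hm] := choice ex; exists m; split=> [b /hm[]//| |b /hm[]//].
move=> b b' hb hb' bb' e; have [Db _] := hm b hb; have [Db' _] := hm b' hb'.
have [_ Dmb] : (D a `&` D b) (m b) by rewrite Db.
have [_ Dmb'] : (D a `&` D b') (m b) by rewrite Db' e.
move: hb hb'; rewrite !inE => /andP[ba ab] /andP[b'a ab'].
apply: (bridged_triangle (tree_bridged tA) _ _ _ ab ab' (nerD _ _ _ bb' Dmb Dmb')).
- by rewrite eq_sym.
- by rewrite eq_sym.
exact/eqP.
Qed.

Variables (a : fvert A) (m : fvert A -> X).
Hypotheses (hm : forall b, b \in nbr a -> D a `&` D b = [set m b]).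

Lemma mark_in b : b \in nbr a -> D a (m b) /\ D b (m b).
Proof. by move=> /hm e; have : (D a `&` D b) (m b) by rewrite e. Qed.

Lemma unmarked c : D a c -> (forall b, b \in nbr a -> m b <> c) ->
  forall b, b <> a -> ~ D b c.
Proof.
have [_ _ nerD _ _] := dD; move=> Dc nm b ba Dbc.
have hb : b \in nbr a by rewrite !inE (introN eqP ba) (nerD _ _ _ (nesym ba) Dc Dbc).
have : (D a `&` D b) c by [].
by rewrite (hm hb) => e; apply: (nm b hb).
Qed.

(** The piece [D b] is connected and avoids [c], so its mark decides the side. *)
Lemma nbr_side c K1 K2 b : cutpoint c K1 K2 -> D a c ->
  (forall b, b \in nbr a -> m b <> c) -> b \in nbr a -> K1 (m b) -> D b `<=` K1.
Proof.
have [clD _ _ _ _] := dD; move=> ct Dc nm hb K1m.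
have [_ Dbm] := mark_in hb.
apply: (cut_sub ct (clD b).2 _ Dbm K1m); apply: unmarked => //.
by move: hb; rewrite !inE => /andP[/eqP].
Qed.

Lemma separate_near p z (Z : set X) : closed Z -> connected Z -> Z z -> D a z ->
  ~ Z p -> D a p -> exists c K1 K2, [/\ cutpoint c K1 K2, K1 p, Z `<=` K2 & D a c].
Proof.
have [clD _ _ _ _] := dD; move=> cZ conZ Zz Dz Zp Dp.
have [c [K1 [K2 [ct K1p ZK2]]]] := cut_near dX cZ conZ Zz Zp.
exists c, K1, K2; split=> //.
exact: (cutpoint_in ct (clD a).2 Dp Dz K1p (ZK2 _ Zz)).
Qed.

End Piece.

Lemma cutpoint_neq (c x : X) K1 K2 : cutpoint c K1 K2 -> K1 x \/ K2 x -> x <> c.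
Proof. by move=> [_ _ _ h] /h. Qed.

(** The bounds 1 and 2 are those of a split edge whose ends have orders at most 2 and 3. If [N1] has
    a vertex, the cut is made next to its mark, away from a continuum through the marks of [N2]. If
    [N1] is empty, one vertex in [N2] is treated likewise with a point of [D a] alone, and for two
    vertices a branch between their marks is cut off. *)
Lemma cut_place (A : fgr) (D : fvert A -> set X) (a : fvert A) (N1 N2 : {set fvert A}) :
  inTM3 A -> decomposition D -> (forall b, (b \in nbr a) = (b \in N1) || (b \in N2)) ->
  (forall b, b \in N1 -> b \in N2 -> False) -> (#|N1| <= 1)%N -> (#|N2| <= 2)%N ->
  exists c K1 K2, [/\ cutpoint c K1 K2, D a c,
    forall b, b <> a -> ~ D b c,
    forall b, b \in N1 -> D b `<=` K1 & forall b, b \in N2 -> D b `<=` K2].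
Proof.
move=> hA dD hN disN c1 c2; have [tA _ _] := hA.
have [clD covD nerD marD corD] := dD.
have [m [hm minj msid]] := piece_marks tA dD a.
have N1n b : b \in N1 -> b \in nbr a by rewrite hN => ->.
have N2n b : b \in N2 -> b \in nbr a by rewrite hN => ->; rewrite orbT.
have [z0 [Dz0 z0c]] := corD a.
have z0m b : b \in nbr a -> z0 <> m b.
  move=> hb e; have [_] := mark_in hm hb; rewrite -e; apply: z0c.
  by move: hb; rewrite !inE => /andP[/eqP].
suff [c [K1 [K2 [ct Dc k1 k2]]]] : exists c K1 K2, [/\ cutpoint c K1 K2, D a c,
    forall b, b \in N1 -> K1 (m b) & forall b, b \in N2 -> K2 (m b)].
  have nm b : b \in nbr a -> m b <> c.
    by rewrite hN => /orP[/k1|/k2] h; apply: (cutpoint_neq ct); [left|right].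
  exists c, K1, K2; split=> //; first exact: (unmarked dD hm).
    by move=> b hb; apply: (nbr_side dD hm ct) => //; [exact: N1n|exact: k1].
  by move=> b hb; apply: (nbr_side dD hm (cutC ct)) => //; [exact: N2n|exact: k2].
move: c1; rewrite leq_eqVlt ltnS leqn0 cards_eq0 => /orP[/cards1P[b1 e1]|/eqP e1].
  have hb1 : b1 \in nbr a by apply: N1n; rewrite e1 inE.
  have [Dp _] := mark_in hm hb1.
  suff [Z [z [cZ conZ Zz Dz [Zp ZN]]]] : exists Z z, [/\ closed Z, connected Z, Z z, D a z &
      ~ Z (m b1) /\ forall b, b \in N2 -> Z (m b)].
    have [c [K1 [K2 [ct K1p ZK2 Dc]]]] := separate_near dD cZ conZ Zz Dz Zp Dp.
    exists c, K1, K2; split=> // b; last by move=> /ZN/ZK2.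
    by rewrite e1 => /set1P->.
  have n12 b : b \in N2 -> b <> b1.
    by move=> hb e; apply: (disN b) => //; rewrite e1 inE e.
  case: (cards_le2 c2) => [e2|[b2 e2]|[b2 [b3 [n23 e2]]]].
  - exists [set z0], z0; split=> //; [exact: (closed_pt dX)|exact: connected1|].
    by split=> [/= e|b]; [apply: (z0m b1 hb1)|rewrite e2 inE].
  - have h2 : b2 \in N2 by rewrite e2 inE.
    have [D2 _] := mark_in hm (N2n _ h2).
    exists [set m b2], (m b2); split=> //; [exact: (closed_pt dX)|exact: connected1|].
    split=> [/= e|b]; last by rewrite e2 => /set1P->.
    exact: (minj b1 b2 hb1 (N2n _ h2) (nesym (n12 _ h2)) e).
  - have h2 : b2 \in N2 by rewrite e2 !inE eqxx.
    have h3 : b3 \in N2 by rewrite e2 !inE eqxx orbT.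
    have [D2 _] := mark_in hm (N2n _ h2); have [D3 _] := mark_in hm (N2n _ h3).
    have m21 := minj b2 b1 (N2n _ h2) hb1 (n12 _ h2).
    have m31 := minj b3 b1 (N2n _ h3) hb1 (n12 _ h3).
    have s23 := msid b1 hb1 _ _ D2 D3 m21 m31.
    have [Z [cZ conZ Z2 Z3 Zs]] := continuum_between dX (open_side dX _ _)
      (@side_connected _ _ _ _) (side_refl m21) s23.
    exists Z, (m b2); split=> //; split; first by move=> /Zs/side_neq.
    by move=> b; rewrite e2 => /set2P[]->.
have N10 b : b \in N1 -> False by rewrite e1 inE.
have [w wN] := nbr_neq0 a hA; have wN2 : w \in N2 by rewrite hN e1 inE in wN.
have sing b : N2 = [set b]%SET -> exists c K1 K2, [/\ cutpoint c K1 K2, D a c,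
    forall b, b \in N1 -> K1 (m b) & forall b, b \in N2 -> K2 (m b)].
  move=> e2; have h2 : b \in N2 by rewrite e2 inE.
  have [Dp _] := mark_in hm (N2n _ h2).
  have [|c [K1 [K2 [ct K1p ZK2 Dc]]]] := separate_near (Z := [set z0]) dD (@closed_pt R X dX z0)
    (@connected1 X z0) erefl Dz0 _ Dp.
    by move=> /esym; exact: z0m (N2n _ h2).
  exists c, K2, K1; split=> //; [exact: cutC|by move=> b' /N10|].
  by move=> b'; rewrite e2 => /set1P->.
have [e2|[b2 e2]|[b2 [b3 [/eqP n23 e2]]]] := cards_le2 c2.
- by move: wN2; rewrite e2 inE.
- exact: sing e2.
have h2 : b2 \in N2 by rewrite e2 !inE eqxx.
have h3 : b3 \in N2 by rewrite e2 !inE eqxx orbT.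
have [D2 _] := mark_in hm (N2n _ h2); have [D3 _] := mark_in hm (N2n _ h3).
have m23 := minj b2 b3 (N2n _ h2) (N2n _ h3) n23.
have [_ _ dense_ram] := wX.
have [t [ramt n2t n3t nst]] := ramification_between dX dense_ram m23.
have Dt : D a t.
  by apply: contrapT => nDt; apply: nst; exact: (side_sub (clD a).2 nDt D2).
have [q [qt n2q n3q]] : exists q, [/\ q <> t, ~ side t (m b2) q & ~ side t (m b3) q].
  have [x [y [z [[xt yt zt] [xy xz yz]]]]] := (ramificationP t).1 ramt.
  have bad u v u' : ~ side t u v -> side t u' u -> side t u' v -> False.
    by move=> nuv wu wv; apply: nuv; apply: side_trans (side_sym wu) wv.
  have [px|px] := pselect (side t (m b2) x).
    have [qy|qy] := pselect (side t (m b3) y).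
      by exists z; split=> //; [exact: bad px|exact: bad qy].
    by exists y; split=> //; exact: bad px.
  have [qx|qx] := pselect (side t (m b3) x); last by exists x.
  have [py|py] := pselect (side t (m b2) y).
    by exists z; split=> //; [exact: bad py|exact: bad qx].
  by exists y; split=> //; exact: bad qx.
pose T := side t q.
(* The branch at [t] holding [q] contains neither mark, and [D a] can be left only through a
   mark. *)
have TD : T `|` [set t] `<=` D a.
  pose E := \bigcup_(b in [set b | b <> a]) D b.
  have clE : closed E.
    by apply: closed_bigcup => [|b _]; [exact: finite_finset|exact: (clD b).1].
  apply: (@connected_sub_closed _ _ (D a) E t) => //; last by right.
  - exact: (sideU_connected dX).
  - exact: (clD a).1.
  - move=> x _; have [b Dbx] := covD x; have [e|n] := pselect (b = a).
      by left; rewrite -e.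
    by right; exists b.
  move=> x Tx Dx [b /= ba Dbx].
  have hb : b \in nbr a.
    by rewrite !inE (introN eqP ba) (nerD _ _ _ (nesym ba) Dx Dbx).
  have : (D a `&` D b) x by [].
  rewrite (hm _ hb) /= => ex; move: hb; rewrite hN e1 inE /= e2 => /set2P[] eb; subst b x.
    by case: Tx => [/side_sym|/= e]; [exact: n2q|exact: n2t].
  by case: Tx => [/side_sym|/= e]; [exact: n3q|exact: n3t].
have nTp b : b \in N2 -> (~` T) (m b).
  by rewrite e2 => /set2P[]-> /side_sym.
(* Separating [q] from the whole complement of its branch forces the cut into the branch and leaves
   both marks on one side. *)
have [||c [K1 [K2 [ct K1q ZK2]]]] := @cut_near _ _ dX (~` T) q t (@compl_side_closed R X dX t q)
    (@compl_side_connected R X dX t q).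
- by move=> /side_neq.
- by apply; exact: side_refl.
exists c, K1, K2; split=> //; last 2 first.
- by move=> b /N10.
- by move=> b /nTp/ZK2.
apply: TD; left; apply: contrapT => nTc; apply: (cutpoint_neq2 ct).
exact: ZK2.
Qed.

(** Induction on the number of vertices of [B]: contract an edge inside a fibre with one end of
    order at most 2, lift to the contraction, and split the merged vertex again. An injective
    morphism is an isomorphism and only renames pieces. *)
Lemma extend_decomposition (A B : fgr) (g : fvert B -> fvert A) (D : fvert A -> set X) :
  TM3_mor g -> decomposition D ->
  exists E : fvert B -> set X, decomposition E /\ subdivides g E D.
Proof.
have [n leB] := ubnP #|fvert B|; elim: n => // n IH in B leB g *; move=> hg dD.
have [hB hA [[ge gs gl] gc]] := hg; have [tB _ oB] := hB.
have [clD covD nerD marD corD] := dD.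
have [injg|ninj] := pselect (injective g).
  exists (D \o g); split; last first.
    move=> a x; split=> [Dx|[b [<-]]//]; have [b eb] := gs a.
    by exists b; rewrite /= eb.
  have lift x y : fedge A (g x) (g y) -> fedge B x y.
    by move=> /gl[x' [y' [xy' /injg <- /injg <-]]].
  have gn x y : x <> y -> g x <> g y by move=> xy /injg.
  split=> /=.
  - by move=> b.
  - by move=> x; have [a Dx] := covD x; have [b eb] := gs a; exists b; rewrite eb.
  - by move=> b b' x /gn nb Db Db'; apply: lift; exact: nerD nb Db Db'.
  - by move=> b b' /gn nb /ge; exact: marD.
  by move=> b; have [x [Dx nx]] := corD (g b); exists x; split=> // b' /gn; exact: nx.
have [x0 [y0 [nxy gxy]]] : exists x y, x != y /\ g x = g y.
  apply: contrapT => h; apply: ninj => x y e; apply: contrapT => /eqP nxy.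
  by apply: h; exists x, y.
have [u [v [nuv euv guv du]]] := fibre_edge hg nxy gxy.
have vu : v != u by rewrite eq_sym.
pose C := contract_graph vu; pose f : fvert B -> fvert C := contract_map vu.
have ef : elementary f u v := contract_elementary vu euv.
have hg' := contract_TM3 vu euv hg guv du.
have [hC _ _] := hg'.
have ltC : (#|fvert C| < n)%N.
  rewrite ltnS in leB; apply: leq_trans leB.
  have -> : #|fvert C| = #|predC1 u| by exact: card_sig.
  by rewrite cardC1 prednK //; apply/card_gt0P; exists u.
have [E [dE sE]] := IH C ltC _ hg' dD.
have [_ _ fuv [fe fs fl] _] := ef.
(* The remaining neighbours of [u] and of [v], seen in the contraction; they are disjoint because a
   tree has no triangle. *)
pose N1 := (f @: (nbr u :\ v))%SET; pose N2 := (f @: (nbr v :\ u))%SET.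
have vI : v \in nbr u by rewrite !inE vu.
have uI : u \in nbr v by rewrite !inE nuv fedge_sym.
have fI w : w != u -> w != v -> f w != f u.
  by move=> wu wv; apply/eqP => /(elementary_in ef)[] e; [rewrite e eqxx in wu|rewrite e eqxx in wv].
have [||||c [K1 [K2 [ct Dc nDc k1 k2]]]] := @cut_place C E (f u) N1 N2 hC dE.
- move=> b; apply/idP/orP.
    rewrite !inE => /andP[bu /fl[x [y [xy ex ey]]]]; subst b.
    have yu : y != u by apply: contraNneq bu => ->.
    have yv : y != v by apply: contraNneq bu => ->; rewrite fuv.
    case: (elementary_in ef ex) => e; subst x; [left|right].
      by apply: imset_f; rewrite !inE yv yu.
    by apply: imset_f; rewrite !inE yv yu.
  case=> /imsetP[w] /[!inE] /and3P[w1 w2 w3] ->.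
    by rewrite fI // fe.
  by rewrite fI // fuv fe.
- move=> b /imsetP[w] /[!inE] /and3P[wv wu uw] eb /imsetP[w'] /[!inE] /and3P[w'u w'v vw'].
  rewrite eb => /(elementary_out ef w'u w'v) e; subst w'.
  by apply: (bridged_triangle (tree_bridged tB) nuv _ _ euv uw vw'); rewrite eq_sym.
- apply: leq_trans (leq_imset_card _ _) _; move: du.
  by rewrite /vorder -/(nbr u) (cardsD1 v (nbr u)) vI.
- apply: leq_trans (leq_imset_card _ _) _; have := oB v.
  by rewrite /vorder -/(nbr v) (cardsD1 u (nbr v)) uI.
have [||E' [dE' sE' _ _ _]] := elementary_decomposition dX ef dE ct Dc nDc.
- by move=> w wu wv uw; apply: k1; apply: imset_f; rewrite !inE wu wv.
- by move=> w wu wv vw; apply: k2; apply: imset_f; rewrite !inE wu wv.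
exists E'; split=> // a x; split.
  move=> /sE[b [<- /sE'[b' [<- Eb']]]]; exists b'; split=> //.
  by rewrite /= val_contract_map; case: eqVneq => // ->.
move=> [b [<- Eb]]; apply/sE; exists (f b); split; last by apply/sE'; exists b.
by rewrite /= val_contract_map; case: eqVneq => // ->.
Qed.

End Refinement.

Lemma subdivides_trans (T : Type) (A B C : fgr) (f : fvert B -> fvert A)
    (g : fvert C -> fvert B) (D : fvert A -> set T) E F :
  subdivides f E D -> subdivides g F E -> subdivides (f \o g) F D.
Proof.
move=> s1 s2 a x; split.
  by move=> /s1[b [<- /s2[c [<- Fc]]]]; exists c.
by move=> [c [<- Fc]]; apply/s1; exists (g c); split=> //; apply/s2; exists c.
Qed.

(** * Turning a given point into a cut point *)

Section Tasks.
Variables (R : realType) (X : pseudoMetricType R).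
Hypothesis wX : Wazewski_D3 X.

Let dX : dendrite X. Proof. by case: wX. Qed.

Lemma cut_sided (c : X) K1 K2 Z : cutpoint c K1 K2 -> connected Z -> ~ Z c ->
  Z `<=` K1 \/ Z `<=` K2.
Proof.
move=> ct cZ Zc; have [[x Zx]|Z0] := pselect (Z !=set0); last first.
  by left=> x Zx; case: Z0; exists x.
have xc : x <> c by move=> e; rewrite e in Zx.
have [_ _ _ h] := ct; have [K1x|K2x] := (h x).1 xc.
  by left; exact: cut_sub ct cZ Zc Zx K1x.
by right; exact: cut_sub (cutC ct) cZ Zc Zx K2x.
Qed.

Lemma split_at (A : fgr) (D : fvert A -> set X) (a : fvert A) (N : {set fvert A})
    (c : X) K1 K2 :
  inTM3 A -> decomposition D -> cutpoint c K1 K2 -> D a c ->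
  (forall b, b <> a -> ~ D b c) ->
  (forall b, b \in nbr a -> b \in N -> D b `<=` K1) ->
  (forall b, b \in nbr a -> b \notin N -> D b `<=` K2) ->
  exists E : fvert (split_graph a N) -> set X,
    [/\ decomposition E, subdivides (@split_map A a N) E D,
        E None `<=` K1 `|` [set c], E (Some a) `<=` K2 `|` [set c] &
        forall y, y <> a -> E (Some y) = D y].
Proof.
move=> hA dD ct Dc nDc h1 h2.
have [||E [dE sE s1 s2 sw]] := @elementary_decomposition _ _ dX _ _ _ _ _ D c K1 K2
  (split_elementary a N) dD ct Dc nDc.
- move=> [y|//] _ ya /= /orP[/eqP e|]; first by rewrite e eqxx in ya.
  by rewrite finset.in_setI => /andP[]; exact: h1.
- move=> [y|//] _ ya /= /and3P[ay]; rewrite eqxx /= => hy _.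
  have hn : y \in nbr a.
    by rewrite !inE ay andbT; apply: contraNneq ya => ->.
  by apply: h2 => //; apply: contraNN hy => yN; rewrite finset.in_setI hn yN.
by exists E; split=> // y ya; rewrite sw //; apply/eqP => -[].
Qed.

(** Only the effect of [c] being a cut point is recorded, namely that no piece has points strictly
    on both sides; this is what later separates points. *)
Definition refined_at (A : fgr) (D : fvert A -> set X) (c : X) (K1 K2 : set X) : Prop :=
  exists (B : fgr) (f : fvert B -> fvert A) (E : fvert B -> set X),
    [/\ TM3_mor f, decomposition E, subdivides f E D &
      forall b, E b `<=` K1 `|` [set c] \/ E b `<=` K2 `|` [set c]].

Lemma refined_atC A (D : fvert A -> set X) c K1 K2 :
  refined_at D c K2 K1 -> refined_at D c K1 K2.
Proof.
by move=> [B [f [E [h1 h2 h3 h4]]]]; exists B, f, E; split=> // b; rewrite or_comm.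
Qed.

(** One split at [c] itself, with the neighbours of [a] sorted by side; the two bounds keep it in
    the family. *)
Lemma refine_low A (D : fvert A -> set X) (a : fvert A) (N : {set fvert A}) c K1 K2 :
  inTM3 A -> decomposition D -> cutpoint c K1 K2 -> D a c ->
  (forall b, b <> a -> ~ D b c) ->
  (forall b, b \in nbr a -> b \in N -> D b `<=` K1) ->
  (forall b, b \in nbr a -> b \notin N -> D b `<=` K2) ->
  (#|nbr a :&: N| <= 2)%N -> (#|nbr a :\: N| <= 2)%N -> refined_at D c K1 K2.
Proof.
move=> hA dD ct Dc nDc h1 h2 c1 c2.
have [E [dE sE s1 s2 sw]] := split_at hA dD ct Dc nDc h1 h2.
exists (split_graph a N), (@split_map A a N), E; split=> //; first exact: split_TM3.
move=> [y|]; last by left.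
have [->|ya] := pselect (y = a); first by right.
rewrite sw //; have [clD _ _ _ _] := dD.
have [h|h] := cut_sided ct (clD y).2 (nDc y ya); [left|right] => x /h ?; by left.
Qed.

(** [c] lies on the side of [p] at [t], so the complement of that side is a connected set through
    [t] and [q] that misses [c]. *)
Lemma far_side (c t p q : X) K1 K2 : cutpoint c K1 K2 -> t <> p -> K1 t -> K2 p ->
  ~ side t p q -> K1 q.
Proof.
move=> ct tp K1t K2p npq.
have cs : side t p c.
  have : (side t p `|` [set t]) c.
    apply: (cutpoint_in ct (sideU_connected dX (nesym tp)) _ _ K1t K2p); first by right.
    by left; exact: side_refl (nesym tp).
  by move=> [//|/= e]; rewrite -e in K1t; case: (cutpoint_neq1 ct).
apply: (@cut_sub _ _ c K1 K2 (~` side t p) t) => //.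
- exact: (@compl_side_connected _ _ dX).
- by move=> /side_neq.
Qed.

(** [c] lies on the branch at [t] towards the mark of [b1]. A cut [c'] separating [t] from both [c]
    and that mark splits off a vertex whose piece contains [c] and which has at most two neighbours,
    so that a second split, at [c], is possible. *)
Lemma refine_tripod A (D : fvert A -> set X) (a : fvert A) (m : fvert A -> X)
    (t c : X) K1 K2 b1 b2 b3 :
  inTM3 A -> decomposition D -> cutpoint c K1 K2 -> D a c ->
  (forall b, b <> a -> ~ D b c) ->
  (forall b, b \in nbr a -> D a `&` D b = [set m b]) ->
  nbr a = [set b1; b2; b3]%SET -> t <> m b1 -> b1 != b2 ->
  ~ side t (m b1) (m b2) -> ~ side t (m b1) (m b3) -> side t (m b1) c ->
  refined_at D c K1 K2.
Proof.
move=> hA dD ct Dc nDc hm ea t1 n12 n2 n3 s1c.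
have [clD _ _ _ _] := dD; have [_ _ oA] := hA.
have hb1 : b1 \in nbr a by rewrite ea !inE eqxx.
have hb2 : b2 \in nbr a by rewrite ea !inE eqxx orbT.
have [Dm1 _] := mark_in hm hb1; have [Dm2 _] := mark_in hm hb2.
have [Z [cZ conZ Z1 Zc Zs]] := continuum_between dX (open_side dX t (m b1))
  (@side_connected _ _ _ _) (side_refl (nesym t1)) s1c.
have nZt : ~ Z t by move=> /Zs/side_neq.
have [c' [K1' [K2' [ct' K1t ZK2]]]] := cut_near dX cZ conZ Z1 nZt.
have K2m1 := ZK2 _ Z1; have K2c := ZK2 _ Zc.
have K1m2 : K1' (m b2) := far_side ct' t1 K1t K2m1 n2.
have K1m3 : K1' (m b3) := far_side ct' t1 K1t K2m1 n3.
have Dc' : D a c' := cutpoint_in ct' (clD a).2 Dm2 Dm1 K1m2 K2m1.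
have nm b : b \in nbr a -> m b <> c'.
  rewrite ea !inE => /orP[/orP[]|] /eqP->; apply: (cutpoint_neq ct');
    by [left|right].
have nDc' := unmarked dD hm Dc' nm.
pose N := [set b1]%SET.
have [||E [dE sE E1 E2 Ew]] := @split_at A D a N c' K2' K1' hA dD (cutC ct') Dc' nDc'.
- by move=> b hb /set1P eb; subst b; exact: (nbr_side dD hm (cutC ct') Dc' nm).
- move=> b hb; rewrite inE => nb; apply: (nbr_side dD hm ct' Dc' nm hb).
  by move: hb nb; rewrite ea !inE => /orP[/orP[]|] /eqP-> //; rewrite eqxx.
have cN : (#|nbr a :&: N| <= 1)%N.
  by rewrite -(cards1 b1); apply: subset_leq_card; exact: finset.subsetIr.
have cN' : (#|nbr a :\: N| <= 2)%N.
  by rewrite -ltnS; apply: leq_trans (oA a); rewrite /vorder -/(nbr a) [X in (_ < X)%N](cardsD1 b1) hb1.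
have hf : TM3_mor (@split_map A a N) by apply: split_TM3 => //; exact: leqW.
have [hB _ _] := hf.
have nEa : ~ E (Some a) c.
  move=> /E2[K1c|/= e]; first by case: ct' => _ _ d _; exact: d K1c K2c.
  by rewrite e in K2c; case: (cutpoint_neq2 ct').
have Ec : E None c.
  have /sE[[y|] [/= ey Ey]] // := Dc; subst y; by case: nEa.
have nEc w : w <> None -> ~ E w c.
  case: w => // y _; have [->//|ya] := pselect (y = a).
  by rewrite Ew //; exact: nDc.
have [clE _ _ _ _] := dE.
pose M := [set w : fvert (split_graph a N) | `[< E w `<=` K1 >]]%SET.
have cNone : (#|nbr (None : fvert (split_graph a N))| <= 2)%N.
  by apply: leq_trans (vorder_split_None a N) _; rewrite ltnS.
have [||||B [g [F [hg dF sF hF]]]] := @refine_low _ E None M c K1 K2 hB dE ct Ec nEc.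
- by move=> w _; rewrite inE => /asboolP.
- move=> w hw; rewrite inE => /asboolP n1.
  have nw : w <> None by move=> ew; rewrite ew !inE in hw.
  by have [] := cut_sided ct (clE w).2 (nEc w nw).
- by apply: leq_trans cNone; apply: subset_leq_card; exact: finset.subsetIl.
- by apply: leq_trans cNone; apply: subset_leq_card; exact: finset.subsetDl.
exists B, (@split_map A a N \o g), F; split=> //; first exact: TM3_comp.
exact: subdivides_trans sE sF.
Qed.

(* Cutting at [c] would leave all three neighbours on one part, so a first cut
   towards [c] is made next to the median of their marks. *)
Lemma refine_three A (D : fvert A -> set X) (a : fvert A) c K1 K2 :
  inTM3 A -> decomposition D -> cutpoint c K1 K2 -> D a c ->
  (forall b, b <> a -> ~ D b c) ->
  (forall b, b \in nbr a -> D b `<=` K1) -> (2 < #|nbr a|)%N -> refined_at D c K1 K2.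
Proof.
move=> hA dD ct Dc nDc h1 c3; have [tA _ oA] := hA.
have [m [hm minj msid]] := piece_marks tA dD a.
have /card_gt2P[b1 [b2 [b3 [[hb1 hb2 hb3] [n12 n23 n31]]]]] := c3.
have ea : nbr a = [set b1; b2; b3]%SET.
  apply/esym/eqP; rewrite eqEcard; apply/andP; split.
    apply/fintype.subsetP => b; rewrite !(finset.in_setU, finset.in_set1).
    by move=> /orP[/orP[]|] /eqP->.
  apply: leq_trans (oA a) _; rewrite finset.setUC cardsU1 cards2 n12.
  by rewrite !(finset.in_setU, finset.in_set1) negb_or n31 eq_sym n23.
have [Dm1 D1] := mark_in hm hb1; have [Dm2 D2] := mark_in hm hb2.
have [Dm3 D3] := mark_in hm hb3.
have m12 := minj b1 b2 hb1 hb2 (elimN eqP n12).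
have m23 := minj b2 b3 hb2 hb3 (elimN eqP n23).
have m31 := minj b3 b1 hb3 hb1 (elimN eqP n31).
have [t [[t1 t2 t3] [n12t n13t n23t]]] := tripod dX m12
  (msid b1 hb1 _ _ Dm2 Dm3 (nesym m12) m31) (msid b2 hb2 _ _ Dm1 Dm3 m12 (nesym m23))
  (msid b3 hb3 _ _ Dm1 Dm2 (nesym m31) m23).
have K1m1 := h1 _ hb1 _ D1; have K1m2 := h1 _ hb2 _ D2.
have ct_ : c <> t.
  by move=> e; subst t; apply: n12t; rewrite (cut_side ct K1m1).
have ram : ramification_point t.
  by apply/ramificationP; exists (m b1), (m b2), (m b3).
have [_ o4 _] := wX.
have sN x y : ~ side t x y -> ~ side t y x by move=> h /side_sym.
(* As [t] has no fourth side, [c] lies on one of its three branches; the cases differ by a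
   permutation of the neighbours. *)
have [/side_sym s|/side_sym s|/side_sym s] :=
  @four_sides R X t _ _ _ c (o4 t ram) (And4 t1 t2 t3 ct_) (And3 n12t n13t n23t).
- exact: (refine_tripod hA dD ct Dc nDc hm ea (nesym t1) n12 n12t n13t s).
- have ea' : nbr a = [set b2; b1; b3]%SET by rewrite ea (finset.setUC [set b1]%SET).
  by apply: (refine_tripod hA dD ct Dc nDc hm ea' (nesym t2) _ (sN _ _ n12t) n23t s); rewrite eq_sym.
have ea' : nbr a = [set b3; b1; b2]%SET.
  by rewrite ea (finset.setUC _ [set b3]%SET) finset.setUA.
exact: (refine_tripod hA dD ct Dc nDc hm ea' (nesym t3) n31 (sN _ _ n13t) (sN _ _ n23t) s).
Qed.

(** A point shared by two pieces is already their cut point. Otherwise a single piece contains it,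
    the neighbouring pieces are sorted by side, and only three of them on one side call for an extra
    split. *)
Lemma refine_at A (D : fvert A -> set X) c K1 K2 :
  inTM3 A -> decomposition D -> cutpoint c K1 K2 -> refined_at D c K1 K2.
Proof.
move=> hA dD ct; have [clD covD nerD marD corD] := dD; have [tA _ oA] := hA.
have [[a [b [ab Da Db]]]|uni] := pselect (exists a b, [/\ a <> b, D a c & D b c]).
  exists A, id, D; split=> //; first exact: TM3_id.
    by move=> e x; split=> [De|[e' [<-]]//]; exists e.
  move=> e; have [De|nDe] := pselect (D e c); last first.
    have [h|h] := cut_sided ct (clD e).2 nDe; [left|right] => x /h ?; by left.
  have [e' [ee' De']] : exists e', e <> e' /\ D e' c.
    have [->|ea] := pselect (e = a); first by exists b.
    by exists a.
  have [c' [L1 [L2 [ct' dEE s1 _]]]] := marD e e' ee' (nerD _ _ _ ee' De De').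
  have ec : c = c' by have : (D e `&` D e') c by []; rewrite dEE.
  subst c'; have nL := cutpoint_neq1 ct'.
  have cL : connected L1 by case: ct' => -[].
  have [h|h] := cut_sided ct cL nL; [left|right] => x /s1[/h ?|]; by [left|right].
have [a Da] := covD c.
have nDc b : b <> a -> ~ D b c by move=> ba Db; apply: uni; exists b, a.
have sided b : b \in nbr a -> D b `<=` K1 \/ D b `<=` K2.
  move=> hb; apply: (cut_sided ct (clD b).2); apply: nDc.
  by move: hb; rewrite !inE => /andP[/eqP].
pose N := [set b | `[< D b `<=` K1 >]]%SET.
have N1 b : b \in nbr a -> b \in N -> D b `<=` K1 by move=> _; rewrite inE => /asboolP.
have N2 b : b \in nbr a -> b \notin N -> D b `<=` K2.
  by move=> hb; rewrite inE => /asboolP n1; have [] := sided b hb.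
have [c1|c1] := leqP #|nbr a :&: N| 2; last first.
  have eN : nbr a :&: N = nbr a.
    by apply/eqP; rewrite eqEcard finset.subsetIl (leq_trans (oA a)).
  rewrite eN in c1; apply: (refine_three hA dD ct Da nDc _ c1) => b hb.
  by apply: N1 => //; move: hb; rewrite -{1}eN finset.in_setI => /andP[].
have [c2|c2] := leqP #|nbr a :\: N| 2; first exact: (refine_low hA dD ct Da nDc N1 N2).
have eN : nbr a :\: N = nbr a.
  by apply/eqP; rewrite eqEcard finset.subsetDl (leq_trans (oA a)).
rewrite eN in c2; apply/refined_atC.
apply: (refine_three hA dD (cutC ct) Da nDc _ c2) => b hb.
by apply: N2 => //; move: hb; rewrite -{1}eN finset.in_setD => /andP[].
Qed.

(** * An initial decomposition and countably many cuts *)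

Definition edge_graph : fgr :=
  @MkFgr bool (fun _ _ => true) (fun _ => erefl) (fun _ _ => erefl).

Lemma edge_graph_TM3 : inTM3 edge_graph.
Proof.
split; last 2 first.
- by rewrite /= card_bool.
- by move=> v; rewrite (leq_trans (max_card _)) //= card_bool.
apply: bridged_tree.
  apply/gconnectedP => P x _ xP h; apply/fintype.subsetP => z _.
  by apply: (h x) => //; rewrite inE.
move=> u v uv _; exists [set u]%SET; split; rewrite ?inE // 1?eq_sym // => x y.
by rewrite !inE => /eqP-> yu _; split=> //; case: u v y uv yu => [] [] [].
Qed.

Lemma cutpoint_exists (x y : X) : x <> y ->
  exists c K1 K2, [/\ cutpoint c K1 K2, K1 x & K2 y].
Proof.
move=> xy; have [|c [K1 [K2 [ct K1x K2y]]]] := cut_near dX (@closed_pt _ _ dX y)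
  (@connected1 X y) (erefl : [set y] y) (p := x); first by [].
by exists c, K1, K2; split=> //; exact: K2y.
Qed.

Lemma two_points : exists x y : X, x <> y.
Proof.
have [[_ _ _ [x0 _] _] _ dr] := wX.
have [||p [_ /ramificationP[x [_ [_ [[xp _ _] _]]]]]] := dr setT.
- by exists x0.
- exact: openT.
by exists x, p.
Qed.

Lemma decomposition_exists : exists D : fvert edge_graph -> set X, decomposition D.
Proof.
have [x [y /cutpoint_exists[c [K1 [K2 [ct K1x K2y]]]]]] := two_points.
have [_ _ d h] := ct; have ct' := cutC ct.
exists (fun b : bool => (if b then K1 else K2) `|` [set c]); split.
- by case; split; [exact: (cut_closed dX ct)|exact: (cut_connected dX ct)|
    exact: (cut_closed dX ct')|exact: (cut_connected dX ct')].
- move=> z; have [->|zc] := pselect (z = c); first by exists true; right.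
  by have [?|?] := (h z).1 zc; [exists true; left|exists false; left].
- by [].
- have e : (K1 `|` [set c]) `&` (K2 `|` [set c]) = [set c].
    apply/seteqP; split=> [z [[k1|//] [k2|//]]|z ->]; first by case: (d z).
    by split; right.
  case=> [] [] // _ _; [exists c, K1, K2|exists c, K2, K1]; split=> //.
  by rewrite setIC.
case; [exists x|exists y]; (split; first by left) => -[] // _ [k|/= e].
- exact: d K1x k.
- by apply: (cutpoint_neq1 ct); rewrite -e.
- exact: d k K2y.
by apply: (cutpoint_neq2 ct); rewrite -e.
Qed.

(** For each pair of basic open sets that some cut separates, one such cut is chosen; this suffices
    for all points because the sides of a cut are open. The remaining pairs get the default cut
    [c0]. *)
Lemma countable_cuts : exists (c : nat -> X) (K1 K2 : nat -> set X),
  (forall n, cutpoint (c n) (K1 n) (K2 n)) /\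
  forall x y, x <> y -> exists n, K1 n x /\ K2 n y.
Proof.
have cX : compact [set: X] by case: dX.
have [B [oB bB]] := countable_basis cX.
have [x0 [y0 /cutpoint_exists[c0 [L1 [L2 [ct0 _ _]]]]]] := two_points.
pose P n (w : X * set X * set X) := cutpoint w.1.1 w.1.2 w.2 /\
  let ij := odflt (0, 0)%N (unpickle n) in
  (exists c K1 K2, [/\ cutpoint c K1 K2, B ij.1 `<=` K1 & B ij.2 `<=` K2]) ->
  B ij.1 `<=` w.1.2 /\ B ij.2 `<=` w.2.
have exP n : exists w, P n w.
  rewrite /P; case: (odflt _ _) => i j /=.
  have [[c [K1 [K2 [ct h1 h2]]]]|h] :=
    pselect (exists c K1 K2, [/\ cutpoint c K1 K2, B i `<=` K1 & B j `<=` K2]).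
    by exists (c, K1, K2).
  by exists (c0, L1, L2).
have [w hw] := choice exP.
exists (fun n => (w n).1.1), (fun n => (w n).1.2), (fun n => (w n).2); split=> [n|x y xy].
  by case: (hw n).
have [c [K1 [K2 [ct K1x K2y]]]] := cutpoint_exists xy.
have [[o1 _ _] [o2 _ _] _ _] := ct.
have [i [Bx B1]] := bB x K1 o1 K1x; have [j [By B2]] := bB y K2 o2 K2y.
exists (pickle (i, j)); have [_] := hw (pickle (i, j)); rewrite pickleK /=.
case; first by exists c, K1, K2.
by move=> h1 h2; split; [exact: h1|exact: h2].
Qed.

End Tasks.

(** * The realization *)

Section Threads.
Variables (F : nat -> fgr) (alpha : forall n, fvert (F n.+1) -> fvert (F n)).
Arguments alpha : clear implicits.

Lemma limproj_alpha n (x : Defs.limV alpha) : alpha n (limproj n.+1 x) = limproj n x.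
Proof. by case: x. Qed.

Lemma limproj_eq n i (x y : Defs.limV alpha) : (i <= n)%N ->
  limproj n x = limproj n y -> limproj i x = limproj i y.
Proof.
elim: n => [|n IH]; first by rewrite leqn0 => /eqP->.
rewrite leq_eqVlt => /orP[/eqP->//|/IH h e].
by apply: h; rewrite -(limproj_alpha n x) e limproj_alpha.
Qed.

(** A thread through [alpha m a] is overwritten by [a] at coordinate [m.+1] and continued upwards by
    sections of the bonding maps. *)
Lemma limproj_surj : (forall n (b : fvert (F n)), exists a, alpha n a = b) ->
  forall m (a : fvert (F m)), exists x : Defs.limV alpha, limproj m x = a.
Proof.
move=> surj.
have up n : {s : fvert (F n) -> fvert (F n.+1) & forall b, alpha n (s b) = b}.
  by apply: (@choice _ _ (fun b a => alpha n a = b)) => b; exact: surj.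
pose s n := projT1 (up n).
have sK n b : alpha n (s n b) = b := projT2 (up n) b.
elim=> [|m IH] a.
  pose x := nat_rect (fun n => fvert (F n)) a (fun n y => s n y).
  have xP n : alpha n (x n.+1) = x n by exact: sK.
  by exists (exist _ x xP).
have [[x xP] /= xa] := IH (alpha m a).
pose t : forall n, fvert (F n) := @dfwith nat (fun n => fvert (F n)) x m.+1 a.
have ta : t m.+1 = a by exact: dfwith_in.
have tx n : (n <= m)%N -> t n = x n.
  by move=> nm; apply: dfwith_out; rewrite gtn_eqF.
pose u := nat_rect (fun n => fvert (F n)) (t 0%N)
  (fun n y => if (n <= m)%N then t n.+1 else s n y).
have ut n : (n <= m.+1)%N -> u n = t n by case: n => [//|n]; rewrite ltnS /= => ->.
have uP n : alpha n (u n.+1) = u n.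
  rewrite [u n.+1]/=; case: ifP => [nm|_]; last exact: sK.
  rewrite (ut n (leqW nm)) (tx n nm); move: nm; rewrite leq_eqVlt => /orP[/eqP e|nm].
    by subst n; rewrite ta -xa.
  by rewrite (tx _ nm) xP.
by exists (exist _ u uP); exact: etrans (ut m.+1 (leqnn _)) ta.
Qed.

(** Koenig's lemma: each condition depends on finitely many coordinates, a vertex is [alive] when
    every condition has a thread through it, and finiteness of the next level prolongs an alive
    vertex. *)
Lemma limV_compact (Phi : nat -> Defs.limV alpha -> Prop) :
  (forall n x, Phi n.+1 x -> Phi n x) -> (forall n, exists x, Phi n x) ->
  (forall n, exists N, forall x y, limproj N x = limproj N y -> Phi n x -> Phi n y) ->
  exists x, forall n, Phi n x.
Proof.
move=> dec ex loc.
have decm n m x : (n <= m)%N -> Phi m x -> Phi n x.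
  elim: m => [|m IH]; first by rewrite leqn0 => /eqP->.
  by rewrite leq_eqVlt => /orP[/eqP->//|/IH h /dec].
pose alive n (a : fvert (F n)) := forall N, exists y : Defs.limV alpha, limproj n y = a /\ Phi N y.
have pigeon n (P : fvert (F n) -> Prop) :
    (forall N, exists y : Defs.limV alpha, P (limproj n y) /\ Phi N y) ->
    exists a, P a /\ alive n a.
  move=> h; apply: contrapT => na.
  have bad a : exists N, P a -> forall y : Defs.limV alpha, limproj n y = a -> ~ Phi N y.
    apply: contrapT => /forallNP hb; apply: na; exists a; split.
      by apply: contrapT => nP; apply: (hb 0%N).
    move=> N; apply: contrapT => nN; apply: (hb N) => Pa y ya PN; apply: nN.
    by exists y.
  have [B hB] := choice bad.
  (* Every candidate vertex fails at some stage [B a]; at the largest of these stages all of them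
     have failed. *)
  have [y [Py Phy]] := h (\max_a B a)%N.
  apply: (hB _ Py y erefl); apply: decm Phy; exact: (leq_bigmax (limproj n y)).
have [a0 [_ al0]] : exists a, True /\ alive 0%N a.
  by apply: pigeon => N; have [y Py] := ex N; exists y.
have step n (a : {a | alive n a}) : exists b : {b | alive n.+1 b}, alpha n (sval b) = sval a.
  case: a => a al; have [|b [ba alb]] := pigeon n.+1 (fun b => alpha n b = a).
    by move=> N; have [y [ya Py]] := al N; exists y; rewrite limproj_alpha.
  by exists (exist _ b alb).
have [nxt hn] : {f : forall n, {a | alive n a} -> {b | alive n.+1 b} &
    forall n a, alpha n (sval (f n a)) = sval a}.
  have st n : {f : {a | alive n a} -> {b | alive n.+1 b} &
      forall a, alpha n (sval (f a)) = sval a}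
    by apply: (@choice _ _ (fun a b => alpha n (sval b) = sval a)); exact: step.
  by exists (fun n => projT1 (st n)) => n; exact: projT2 (st n).
pose w := nat_rect (fun n => {a | alive n a}) (exist _ a0 al0) (fun n a => nxt n a).
have wP n : alpha n (sval (w n.+1)) = sval (w n) by exact: hn.
exists (exist _ (fun n => sval (w n)) wP) => n.
have [N hN] := loc n; have [y [yN Py]] := svalP (w N) n.
exact: hN Py.
Qed.

End Threads.

(** * The quotient map onto the dendrite *)

Section Realization.
Variables (F : nat -> fgr) (alpha : forall n, fvert (F n.+1) -> fvert (F n)).
Variables (R : realType) (X : pseudoMetricType R).
Hypotheses (hF : is_TM3_Fraisse_limit alpha) (wX : Wazewski_D3 X).

Let dX : dendrite X. Proof. by case: wX. Qed.

Lemma limproj_mor n m : (n <= m)%N -> exists f : fvert (F m) -> fvert (F n),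
  TM3_mor f /\ forall x : Defs.limV alpha, f (limproj m x) = limproj n x.
Proof.
have [hal _ _] := hF.
elim: m => [|m IH].
  rewrite leqn0 => /eqP->; exists id; split=> //; apply: TM3_id.
  by have [] := hal 0%N.
rewrite leq_eqVlt => /orP[/eqP->|/IH[f [hf fx]]].
  by exists id; split=> //; apply: TM3_id; have [] := hal m.+1.
exists (f \o @alpha m); split; first exact: TM3_comp.
by move=> x; rewrite /= limproj_alpha.
Qed.

Lemma limproj_onto m (a : fvert (F m)) : exists x : Defs.limV alpha, limproj m x = a.
Proof.
by apply: limproj_surj => n b; have [/(_ n)[_ _ [[_ h _] _]] _ _] := hF; exact: h.
Qed.

Lemma fedge_down n i (x y : Defs.limV alpha) : (i <= n)%N ->
  fedge (F n) (limproj n x) (limproj n y) -> fedge (F i) (limproj i x) (limproj i y).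
Proof.
move=> /limproj_mor[f [[_ _ [[fe _ _] _]] fx]] /fe.
by rewrite !fx.
Qed.

Record stage := Stage {
  level : nat;
  pieces : fvert (F level) -> set X;
  piecesP : decomposition pieces }.

Definition piece (s : stage) (x : Defs.limV alpha) : set X := pieces (limproj (level s) x).

(** The bound [n] keeps the levels cofinal. The fourth clause complements the nesting: a point of a
    piece can be followed into a piece above it. The last clause makes the stages separate
    points. *)
Definition next_stage (n : nat) (c : X) (K1 K2 : set X) (s s' : stage) : Prop :=
  [/\ (n <= level s')%N, (level s <= level s')%N,
      forall x, piece s' x `<=` piece s x,
      forall (a : fvert (F (level s))) z, pieces a z -> exists y : fvert (F (level s')),
        pieces y z /\ forall x : Defs.limV alpha, limproj (level s') x = y -> limproj (level s) x = a &
      forall x, piece s' x `<=` K1 `|` [set c] \/ piece s' x `<=` K2 `|` [set c]].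

(** The refinement lives over a tree [B] outside the sequence. Projective extension factors the
    projection to [F m] through [B], admissibility factors the resulting map through some [F m'],
    and the decomposition over [B] lifts to a level [M] above [m'], [n] and [m]. *)
Lemma next_stage_exists n c K1 K2 s : cutpoint c K1 K2 ->
  exists s', next_stage n c K1 K2 s s'.
Proof.
case: s => m D dD ct; have [hal _ ext] := hF.
have hm : inTM3 (F m) by have [_ ?] := hal m.
have [B [f [E [hf dE sE sided]]]] := refine_at wX hm dD ct.
have adm : admissible (limproj m : Defs.limV alpha -> _).
  by exists m, id; split=> //; exact: TM3_id.
have [h [[m' [h' [hh' hx]]] fh]] := ext _ _ _ _ adm hf.
pose M := maxn m' (maxn n m).
have [g [hg gx]] := limproj_mor (leq_maxl m' (maxn n m)).
have hhg : TM3_mor (h' \o g) by exact: TM3_comp.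
have [G [dG sG]] := extend_decomposition wX hhg dE.
have sGD := subdivides_trans sE sG.
have key (x : Defs.limV alpha) : f (h' (g (limproj M x))) = limproj m x.
  by rewrite (gx x) -(hx x) -(fh x).
exists (@Stage M G dG); split=> /=.
- by rewrite /M !leq_max leqnn orbT.
- by rewrite /M !leq_max leqnn !orbT.
- move=> x z; rewrite /piece /= => Gz; apply/sGD; exists (limproj M x); split=> //.
  exact: key.
- move=> a z /sGD[y [ey Gy]]; exists y; split=> // x xy.
  by rewrite -ey -xy -key.
move=> x; rewrite /piece /=.
have GE : G (limproj M x) `<=` E (h' (g (limproj M x))).
  by move=> z Gz; apply/sG; exists (limproj M x).
by have [h1|h1] := sided (h' (g (limproj M x))); [left|right];
  exact: subset_trans GE h1.
Qed.

Lemma stage_exists : exists s : stage, True.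
Proof.
have [hal adm _] := hF; have [D dD] := decomposition_exists wX.
have [f [m [h [hh _]]]] := adm _ edge_graph_TM3.
have [G [dG _]] := extend_decomposition wX hh dD.
by exists (@Stage m G dG).
Qed.

Lemma realization : realization_homeomorphic alpha X.
Proof.
have [hX cX _ _ _] := dX.
have [c [K1 [K2 [ct sep]]]] := countable_cuts wX.
have [nxt hn] : {f : nat * stage -> stage &
    forall ns, next_stage ns.1 (c ns.1) (K1 ns.1) (K2 ns.1) ns.2 (f ns)}.
  by apply: (@choice _ _ (fun ns s' => next_stage ns.1 (c ns.1) (K1 ns.1) (K2 ns.1) ns.2 s'))
    => -[n s]; exact: next_stage_exists.
have [s0 _] := stage_exists.
pose S := nat_rect (fun _ => stage) s0 (fun n s => nxt (n, s)).
have SP n : next_stage n (c n) (K1 n) (K2 n) (S n) (S n.+1) by exact: (hn (n, S n)).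
pose m k := level (S k); pose P k x := piece (S k) x.
have mS k : (m k <= m k.+1)%N by have [] := SP k.
have mono_m k l : (k <= l)%N -> (m k <= m l)%N.
  elim: l => [|l IH]; first by rewrite leqn0 => /eqP->.
  by rewrite leq_eqVlt => /orP[/eqP->//|/IH h]; exact: leq_trans h (mS l).
have m_ge k : (k <= m k.+1)%N by have [] := SP k.
have Pdec k x : P k.+1 x `<=` P k x by have [_ _ h _ _] := SP k; exact: h.
have Pclosed k x : closed (P k x) by have [h _ _ _ _] := piecesP (S k); exact: (h _).1.
have Pne k x : P k x !=set0.
  by have [_ _ _ _ h] := piecesP (S k); have [z [Pz _]] := h (limproj (m k) x); exists z.
have Peq k x y : limproj (m k) x = limproj (m k) y -> P k x = P k y.
  by rewrite /P /piece /m => ->.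
(* Some cut [c n] has [z] and [z'] strictly on different sides, and a piece of stage [n.+1] does not
   reach both sides. *)
have Puniq x z z' : (forall k, P k x z) -> (forall k, P k x z') -> z = z'.
  move=> hz hz'; apply: contrapT => /sep[n [z1 z2]].
  have [_ _ d _] := ct n; have [_ _ _ _ /(_ x)[h|h]] := SP n.
    case: (h _ (hz' n.+1)) => [z1'|/= e]; [exact: d z1' z2|].
    by rewrite e in z2; case: (cutpoint_neq2 (ct n)).
  case: (h _ (hz n.+1)) => [z2'|/= e]; [exact: d z1 z2'|].
  by rewrite e in z1; case: (cutpoint_neq1 (ct n)).
have Pex x : exists z, forall k, P k x z.
  have [z hz] := nested_nonempty cX (Pclosed ^~ x) (Pdec ^~ x) (Pne ^~ x).
  by exists z => k; exact: hz.
have [q hq] := choice Pex.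
have qE x z : (forall k, P k x z) -> q x = z by exact: Puniq.
(* Every point of a piece is the image of a thread through its vertex: [z] is followed to higher and
   higher levels, and compactness of the space of threads yields a limit. *)
have lift k x z : P k x z -> exists y, limproj (m k) y = limproj (m k) x /\ q y = z.
  move=> Pz.
  have [|j|j|y hy] := @limV_compact F alpha
      (fun j y => limproj (m k) y = limproj (m k) x /\ P (k + j)%N y z).
  - by move=> j y [e]; rewrite addnS => /Pdec.
  - elim: j => [|j [y [e Py]]]; first by exists x; rewrite addn0.
    have [_ le _ h _] := SP (k + j)%N.
    have [w [wz hw]] := h _ _ Py; have [y' ey'] := limproj_onto w.
    have e' := hw _ ey'; exists y'; rewrite addnS; split; last by rewrite /P /piece ey'.
    by rewrite -e; apply: limproj_eq e'; apply: mono_m; exact: leq_addr.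
  - exists (m (k + j)%N) => y y' e [ey Py]; split; last by rewrite -(Peq _ y y').
    by rewrite -ey; symmetry; apply: limproj_eq e; apply: mono_m; exact: leq_addr.
  exists y; split; first by have [] := hy 0%N.
  apply: qE => l; have [_] := hy l; elim: (k) => [|i IH]; first by rewrite add0n.
  by rewrite addSn => /Pdec.
have qsurj z : exists x, q x = z.
  have [_ cov _ _ _] := piecesP (S 0%N); have [a az] := cov z.
  have [x xa] := limproj_onto a.
  have [|y [_ <-]] := lift 0%N x z; first by rewrite /P /piece xa.
  by exists y.
exists q; split=> //.
(* Threads with a common image have meeting pieces at all stages, so their vertices are equal or
   adjacent there, and by cofinality at every level. *)
- move=> x y; split=> [e n|exy].
    apply: (@fedge_down (m n.+1)) => //.
    have [_ _ h _ _] := piecesP (S n.+1).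
    have [->|nxy] := pselect (limproj (m n.+1) x = limproj (m n.+1) y); first exact: fedge_refl.
    by apply: (h _ _ (q x) nxy); [exact: hq|rewrite e; exact: hq].
  (* Adjacent pieces meet, and the nested nonempty intersections have a common point, which is the
     image of both threads. *)
  have [|||z hz] := @nested_nonempty X (fun k => P k x `&` P k y) cX.
  - by move=> k; apply: closedI.
  - by move=> k z [/Pdec ? /Pdec ?].
  - move=> k; have [e|nxy] := pselect (limproj (m k) x = limproj (m k) y).
      by rewrite (Peq k x y e) setIid.
    have [_ _ _ h _] := piecesP (S k).
    have [c' [_ [_ [_ e _ _]]]] := h _ _ nxy (exy _).
    by exists c'; rewrite /P /piece e.
  have -> : q x = z by apply: qE => k; have [] := hz k I.
  by symmetry; apply: qE => k; have [] := hz k I.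
move=> U; split=> [oU x Ux|loU].
  have [|k kU] := nested_sub cX (Pclosed ^~ x) (Pdec ^~ x) oU.
    by move=> z hz; rewrite -(qE x z) // => k; exact: hz.
  by exists (m k) => y e; apply: kU; rewrite -(Peq _ y x e); exact: hq.
(* If [U] is no neighbourhood of [z], every stage has a piece containing both [z] and a point
   outside [U], because only the pieces through [z] come close to it. A limiting thread has image
   [z], yet arbitrarily close threads have images outside [U]. *)
rewrite openE => z Uz; apply: contrapT => nU.
have [|k|k|x hx] := @limV_compact F alpha (fun k x => P k x z /\ exists2 z', P k x z' & ~ U z').
- by move=> k x [/Pdec ? [z' /Pdec ? ?]]; split=> //; exists z'.
- have [clD _ _ _ _] := piecesP (S k).
  pose O := ~` \bigcup_(a in [set a | ~ @pieces (S k) a z]) @pieces (S k) a.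
  have nO : nbhs z O.
    apply: open_nbhs_nbhs; split; last by move=> [a].
    by apply: closed_openC; apply: closed_bigcup => [|a _]; [exact: finite_finset|exact: (clD a).1].
  have [z' Oz' nUz'] : exists2 z', O z' & ~ U z'.
    apply: contrapT => h; apply: nU; apply: filterS nO => w Ow.
    by apply: contrapT => nUw; apply: h; exists w.
  have [x ex] := qsurj z'; exists x.
  have Pz' : P k x z' by rewrite -ex; exact: hq.
  split; last by exists z'.
  by apply: contrapT => nz; apply: Oz'; exists (limproj (level (S k)) x).
- by exists (m k) => x y e [h1 [z' h2 h3]]; rewrite -(Peq _ _ _ e); split=> //; exists z'.
have qx : q x = z by apply: qE => k; have [] := hx k.
have [|n hn'] := loU x; first by rewrite /preimage /= qx.
(* Stage [n.+1] is taken because it is the one whose level is known to be at least [n]. *)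
have [_ [z' Pz' nUz']] := hx n.+1.
have [y [ey qy]] := lift _ _ _ Pz'.
apply: nUz'; rewrite -qy; apply: hn'.
exact: limproj_eq (m_ge n) ey.
Qed.

End Realization.

Theorem theorem3p15 (F : nat -> fgr) (alpha : forall n, fvert (F n.+1) -> fvert (F n))
  (R : realType) (X : pseudoMetricType R) :
  is_TM3_Fraisse_limit alpha -> Wazewski_D3 X ->
  realization_homeomorphic alpha X.
Proof. by move=> hF wX; exact: realization. Qed.
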